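(* Let $u=u(x;a,E,c)$ be a $T$-periodic traveling wave profile with $T_a,T_E$ not both zero, and let $T,M,P$ be its period, mass and momentum as functions of $(a,E,c)$. If $\{T,M,P\}_{a,E,c}<0$, then $\operatorname{spec}(\partial_x\mathcal{L}[u])$ has a nontrivial intersection with the real axis, i.e. $\operatorname{spec}(\partial_x\mathcal{L}[u])\cap(\mathbb{R}\setminus\{0\})\neq\emptyset$.
   Context: Let $f\in C^2(\mathbb{R})$, $F'=f$, and for real parameters $(a,E,c)$ set $V(u;a,c)=F(u)-\frac{c}{2}u^2-au$. Standing assumption: $(a,E,c)$ lies in the interior of the parameter region for which $V(\cdot;a,c)$ has a local minimum and there are simple roots $u_-<u_+$ of $V(u;a,c)=E$ with $V(u;a,c)<E$ on $(u_-,u_+)$. Then $u(x)=u(x;a,E,c)$ denotes the nonconstant periodic solution of $\frac12u_x^2+V(u;a,c)=E$ (so $u_{xx}+f(u)-cu=a$) with $u(0)=u_-$, $u_x(0)=0$. Its period, mass and momentum are the $C^1$ functions of $(a,E,c)$ $$T=2\int_{u_-}^{u_+}\frac{du}{\sqrt{2(E-V(u;a,c))}},\quad M=\int_0^Tu\,dx,\quad P=\int_0^Tu^2\,dx.$$ Set $\mathcal{L}[u]=-\partial_x^2-f'(u)+c$. The spectrum $\operatorname{spec}(\partial_x\mathcal{L}[u])$ is the set of $\mu\in\mathbb{C}$ for which $\partial_x\mathcal{L}[u]\psi=\mu\psi$ has a nontrivial bounded solution on $\mathbb{R}$. Jacobian notation: $\{g,h,k\}_{y,z,w}=\begin{vmatrix}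 g_y & h_y & k_y \\ g_z & h_z & k_z \\ g_w & h_w & k_w \end{vmatrix}$. *)

(* Defs.v *)
From Stdlib Require Import Reals.
From Coquelicot Require Import Coquelicot.
Open Scope R_scope.

Definition is_C2 (f : R -> R) : Prop :=
  (forall x, ex_derive f x) /\
  (forall x, ex_derive (Derive f) x) /\
  (forall x, continuous (Derive (Derive f)) x).

(** Parameter triples, always in the order (a, E, c). *)
Definition param : Type := (R * R * R)%type.

Definition pa (p : param) : R := fst (fst p).
Definition pE (p : param) : R := snd (fst p).
Definition pc (p : param) : R := snd p.

Definition D_a (g : param -> R) (p : param) : R :=
  Derive (fun s => g (s, pE p, pc p)) (pa p).
Definition D_E (g : param -> R) (p : param) : R :=
  Derive (fun s => g (pa p, s, pc p)) (pE p).
Definition D_c (g : param -> R) (p : param) : R :=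
  Derive (fun s => g (pa p, pE p, s)) (pc p).

(** Rows: derivatives in a, E, c.  Columns: g, h, k. *)
Definition det3 (m11 m12 m13 m21 m22 m23 m31 m32 m33 : R) : R :=
  m11 * (m22 * m33 - m23 * m32)
  - m12 * (m21 * m33 - m23 * m31)
  + m13 * (m21 * m32 - m22 * m31).

Definition jacobian_aEc (g h k : param -> R) (p : param) : R :=
  det3 (D_a g p) (D_a h p) (D_a k p)
       (D_E g p) (D_E h p) (D_E k p)
       (D_c g p) (D_c h p) (D_c k p).

Definition Veff (F : R -> R) (a c v : R) : R :=
  F v - c / 2 * v ^ 2 - a * v.

Definition is_well (F : R -> R) (p : param) (um up : R) : Prop :=
  let V := Veff F (pa p) (pc p) in
  (exists v0, locally v0 (fun v => V v0 <= V v)) /\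
  um < up /\
  V um = pE p /\ Derive V um <> 0 /\
  V up = pE p /\ Derive V up <> 0 /\
  (forall v, um < v < up -> V v < pE p).

(** The second-order equation is required together with the energy equation:
    the latter alone also has [C^1] solutions that rest at a turning point. *)
Definition is_profile (f F : R -> R) (p : param) (um : R) (w : R -> R) : Prop :=
  (exists S, 0 < S /\ forall x, w (x + S) = w x) /\
  (exists x y, w x <> w y) /\
  (forall x, ex_derive w x) /\
  (forall x, / 2 * (Derive w x) ^ 2 + Veff F (pa p) (pc p) (w x) = pE p) /\
  (forall x, ex_derive (Derive w) x) /\
  (forall x, Derive (Derive w) x + f (w x) - pc p * w x = pa p) /\
  w 0 = um /\ Derive w 0 = 0.

(** The potential may have several wells at the same energy, so the turning
    points are a choice, made continuously near [p0]: this is what makes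
    period, mass and momentum differentiable functions of the parameters.
    Asking for the well on a whole neighbourhood of [p0] says that [p0] is
    interior to the parameter region. *)
Definition wave_family (f F : R -> R) (um up : param -> R)
    (u : param -> R -> R) (p0 : param) : Prop :=
  locally p0 (fun p =>
    is_well F p (um p) (up p) /\
    continuous um p /\ continuous up p /\
    is_profile f F p (um p) (u p)).

(** The integrand is singular at both ends, hence an improper integral. *)
Definition period (F : R -> R) (um up : param -> R) (p : param) : R :=
  2 * RInt_gen (fun v => / sqrt (2 * (pE p - Veff F (pa p) (pc p) v)))
        (at_right (um p)) (at_left (up p)).

Definition mass (F : R -> R) (um up : param -> R) (u : param -> R -> R)
    (p : param) : R :=
  RInt (fun x => u p x) 0 (period F um up p).

Definition momentum (F : R -> R) (um up : param -> R) (u : param -> R -> R)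
    (p : param) : R :=
  RInt (fun x => u p x ^ 2) 0 (period F um up p).

Definition ex_CDerive (psi : R -> C) (x : R) : Prop :=
  ex_derive (V := C_R_NormedModule) psi x.

(** Derivative of a complex-valued function of a real variable; junk, like
    [Derive], unless [ex_CDerive] holds. *)
Definition CDerive (psi : R -> C) (x : R) : C :=
  (Derive (fun t => Re (psi t)) x, Derive (fun t => Im (psi t)) x).

Definition Lop (f : R -> R) (c : R) (w : R -> R) (psi : R -> C) (x : R) : C :=
  (- CDerive (CDerive psi) x - RtoC (Derive f (w x)) * psi x
   + RtoC c * psi x)%C.

Definition spec_dxL (f : R -> R) (c : R) (w : R -> R) (mu : C) : Prop :=
  exists psi : R -> C,
    (forall x, ex_CDerive psi x) /\
    (forall x, ex_CDerive (CDerive psi) x) /\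
    (forall x, ex_CDerive (Lop f c w psi) x) /\
    (forall x, CDerive (Lop f c w psi) x = (mu * psi x)%C) /\
    (exists B, forall x, Cmod (psi x) <= B) /\
    (exists x, psi x <> RtoC 0).

(* Main.v *)
Require Import Defs.
From Stdlib Require Import Reals.
From Coquelicot Require Import Coquelicot.
From Stdlib Require Import Lra Lia.
From Stdlib Require Import Classical_Pred_Type FunctionalExtensionality IndefiniteDescription.
Open Scope R_scope.

(** Fix a real [mu > 0] and let [M(mu)] be the period map of the system solved by
    [(psi, psi', - L psi)] when [(L psi)' = mu psi]. If [D(mu) = det (M(mu) - 1)] vanishes, the
    equation has a periodic, hence bounded, solution. Differentiating the profile equation in
    [a], [E] and [c] yields solutions [u_a], [u_E], [u_c] of [- L u_a = 1], [L u_E = 0],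
    [- L u_c = u], whose increments over a period are governed by the derivatives of [T]; together
    with [u_x] they give [D(mu) = - {T,M,P} mu^3 / 2 + o(mu^3)], so [D > 0] for small [mu]. For
    large [mu] an energy identity excludes periodic solutions even when [f'(u) - c] is multiplied
    by any [tau] in [[0,1]], so [D] has there the sign of its value at constant coefficients
    ([tau = 0]), which is negative. Hence [D] has a zero in between. *)

(** The integrand defining [T] is singular at both turning points, so [T] is not differentiated
    under the integral. It is identified with the return time of the orbit, a zero of the velocity
    at [u_-], where the acceleration [k = a + c u_- - f(u_-)] is positive. Implicit differentiation
    there gives [T' = - v'(T) / k], with [v] the variation of the profile along a line of
    parameters; then [M' = int v + u_- T'] and [P' = 2 int u v + u_-^2 T']. The variations are
    constructed from their own linear equation and only afterwards shown to be derivatives. The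
    order [mu^3] has two sources. Pairing the equation with [1] and with [u] shows that the
    increments of [y3] and [y1] carry a factor [mu]. The solution starting near [u_x] contributes
    the third factor, because [u_x] is periodic and both [u_x] and [u u_x] have zero mean. What
    remains is the determinant with rows [(v'(T), int v, int u v)], which column operations turn
    into a multiple of the Jacobian. Expansions in [mu] and in the parameters are only needed to
    first order, and each is a Groenwall estimate for a system with three components. *)

Ltac rewrite_derive :=
  repeat match goal with
  | H : forall x, is_derive _ x _ |- context [Derive ?g ?t] =>
      rewrite (is_derive_unique g t _ (H t))
  end.

Ltac solve_derive :=
  auto_derive;
  [ repeat split; eexists; eauto
  | rewrite_derive; try ring ].

(** * Groenwall estimates for systems with three components *)

Lemma exp_le (x y : R) : x <= y -> exp x <= exp y.
Proof. intros [H| ->]; [left; now apply exp_increasing|lra]. Qed.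

Lemma is_derive_continuity_pt (g : R -> R) (x l : R) :
  is_derive g x l -> continuity_pt g x.
Proof.
  intros H. apply continuity_pt_filterlim, (ex_derive_continuous (V := R_NormedModule)).
  now exists l.
Qed.

Lemma is_derive_decr (g dg : R -> R) (x y : R) :
  (forall t, is_derive g t (dg t)) -> (forall t, x <= t <= y -> dg t <= 0) ->
  x <= y -> g y <= g x.
Proof.
  intros Hg Hd Hxy.
  destruct (MVT_gen g x y dg) as [t [Ht E]].
  - intros; apply Hg.
  - intros t _. now apply (is_derive_continuity_pt g t (dg t)).
  - rewrite Rmin_left, Rmax_right in Ht by lra.
    specialize (Hd t Ht). nra.
Qed.

(** The sum of squares [N] is used because it is differentiable where absolute values are not. With
    [S] the sum of absolute values, [N' <= 2 S (K S + eps)]; the bounds [S^2 <= 3 N] and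
    [2 S eps <= S^2 + eps^2] give [N' <= (6 K + 3) N + eps^2]. *)
Lemma gronwall_sq (K X eps : R) (y1 y2 y3 d1 d2 d3 : R -> R) :
  0 <= K ->
  (forall x, is_derive y1 x (d1 x)) ->
  (forall x, is_derive y2 x (d2 x)) ->
  (forall x, is_derive y3 x (d3 x)) ->
  (forall x, 0 <= x <= X ->
    Rabs (d1 x) <= K * (Rabs (y1 x) + Rabs (y2 x) + Rabs (y3 x)) + eps /\
    Rabs (d2 x) <= K * (Rabs (y1 x) + Rabs (y2 x) + Rabs (y3 x)) + eps /\
    Rabs (d3 x) <= K * (Rabs (y1 x) + Rabs (y2 x) + Rabs (y3 x)) + eps) ->
  forall x, 0 <= x <= X ->
  y1 x ^ 2 + y2 x ^ 2 + y3 x ^ 2 <=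
    (y1 0 ^ 2 + y2 0 ^ 2 + y3 0 ^ 2 + eps ^ 2 * X) * exp ((6 * K + 3) * X).
Proof.
  intros HK H1 H2 H3 Hd x Hx.
  set (L := 6 * K + 3).
  set (N := fun t => y1 t ^ 2 + y2 t ^ 2 + y3 t ^ 2).
  set (dN := fun t => 2 * (y1 t * d1 t + y2 t * d2 t + y3 t * d3 t)).
  assert (HN : forall t, is_derive N t (dN t)).
  { intros t. unfold N, dN. solve_derive. }
  assert (HdN : forall t, 0 <= t <= X -> dN t <= L * N t + eps ^ 2).
  { intros t Ht. destruct (Hd t Ht) as [B1 [B2 B3]].
    set (S := Rabs (y1 t) + Rabs (y2 t) + Rabs (y3 t)) in *.
    assert (P : forall y d, Rabs d <= K * S + eps -> y * d <= Rabs y * (K * S + eps)).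
    { intros y d B. eapply Rle_trans; [apply Rle_abs|]. rewrite Rabs_mult.
      apply Rmult_le_compat_l; [apply Rabs_pos|exact B]. }
    assert (HS : S ^ 2 <= 3 * N t).
    { unfold N, S. rewrite <- (pow2_abs (y1 t)), <- (pow2_abs (y2 t)), <- (pow2_abs (y3 t)).
      generalize (Rabs (y1 t)) (Rabs (y2 t)) (Rabs (y3 t)). intros u v w.
      generalize (pow2_ge_0 (u - v)) (pow2_ge_0 (v - w)) (pow2_ge_0 (u - w)). lra. }
    assert (Q : dN t <= 2 * (S * (K * S + eps))).
    { unfold dN. generalize (P (y1 t) _ B1) (P (y2 t) _ B2) (P (y3 t) _ B3).
      unfold S. lra. }
    assert (K * S ^ 2 <= K * (3 * N t)) by (apply Rmult_le_compat_l; lra).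
    generalize (pow2_ge_0 (S - eps)). unfold L. lra. }
  (* For [t >= 0] the integrating factor is at most 1, so subtracting [eps ^ 2 * t] absorbs the
     forcing and makes [g] nonincreasing. *)
  set (g := fun t => N t * exp (- L * t) - eps ^ 2 * t).
  assert (Hg : forall t, is_derive g t (dN t * exp (- L * t) - L * N t * exp (- L * t) - eps ^ 2)).
  { intros t. unfold g. solve_derive. }
  assert (G : g x <= g 0).
  { apply (is_derive_decr g _ 0 x Hg); [|lra].
    intros t Ht. specialize (HdN t ltac:(lra)).
    assert (0 < exp (- L * t)) by apply exp_pos.
    assert (exp (- L * t) <= 1).
    { rewrite <- exp_0.
      assert (0 <= L * t) by (apply Rmult_le_pos; unfold L; lra).
      apply exp_le. lra. }
    assert (dN t * exp (- L * t) <= (L * N t + eps ^ 2) * exp (- L * t))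
      by (apply Rmult_le_compat_r; lra).
    assert (eps ^ 2 * exp (- L * t) <= eps ^ 2 * 1)
      by (apply Rmult_le_compat_l; [apply pow2_ge_0|lra]).
    lra. }
  unfold g in G. rewrite Rmult_0_r, Rmult_0_r, exp_0 in G.
  assert (N0 : 0 <= N 0) by (unfold N; nra).
  assert (B : N x * exp (- L * x) <= N 0 + eps ^ 2 * X).
  { assert (eps ^ 2 * x <= eps ^ 2 * X) by (apply Rmult_le_compat_l; [apply pow2_ge_0|lra]). lra. }
  assert (Ex : exp (- L * x) * exp (L * x) = 1).
  { rewrite <- exp_plus. replace (- L * x + L * x) with 0 by ring. apply exp_0. }
  assert (Ne : 0 <= N 0 + eps ^ 2 * X) by (assert (0 <= eps ^ 2) by apply pow2_ge_0; nra).
  assert (EX : exp (L * x) <= exp (L * X)).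
  { apply exp_le, Rmult_le_compat_l; unfold L; lra. }
  change (N x <= (N 0 + eps ^ 2 * X) * exp (L * X)).
  apply Rle_trans with ((N 0 + eps ^ 2 * X) * exp (L * x)).
  - replace (N x) with (N x * exp (- L * x) * exp (L * x)) by (rewrite Rmult_assoc, Ex; ring).
    apply Rmult_le_compat_r; [left; apply exp_pos|exact B].
  - now apply Rmult_le_compat_l.
Qed.

Lemma Rabs_le_of_sq (y A : R) : 0 <= A -> y ^ 2 <= A ^ 2 -> Rabs y <= A.
Proof. intros HA H. apply Rabs_le. nra. Qed.

(** The point is the order of quantifiers: [C] depends on [K] and [X] only. One [eps] bounds both
    the forcing and the initial values, so the estimate can be applied with [eps] tending to 0. *)
Lemma gronwall3 (K X : R) : 0 <= K -> 0 <= X ->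
  exists C, 0 < C /\
  forall (eps : R) (y1 y2 y3 d1 d2 d3 : R -> R), 0 <= eps ->
  (forall x, is_derive y1 x (d1 x)) ->
  (forall x, is_derive y2 x (d2 x)) ->
  (forall x, is_derive y3 x (d3 x)) ->
  (forall x, 0 <= x <= X ->
    Rabs (d1 x) <= K * (Rabs (y1 x) + Rabs (y2 x) + Rabs (y3 x)) + eps /\
    Rabs (d2 x) <= K * (Rabs (y1 x) + Rabs (y2 x) + Rabs (y3 x)) + eps /\
    Rabs (d3 x) <= K * (Rabs (y1 x) + Rabs (y2 x) + Rabs (y3 x)) + eps) ->
  Rabs (y1 0) <= eps -> Rabs (y2 0) <= eps -> Rabs (y3 0) <= eps ->
  forall x, 0 <= x <= X ->
  Rabs (y1 x) <= C * eps /\ Rabs (y2 x) <= C * eps /\ Rabs (y3 x) <= C * eps.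
Proof.
  intros HK HX.
  set (A := (3 + X) * exp ((6 * K + 3) * X)).
  assert (HA : 0 < A) by (apply Rmult_lt_0_compat; [lra|apply exp_pos]).
  exists (sqrt A). split; [now apply sqrt_lt_R0|].
  intros eps y1 y2 y3 d1 d2 d3 He H1 H2 H3 Hd I1 I2 I3 x Hx.
  pose proof (gronwall_sq K X eps y1 y2 y3 d1 d2 d3 HK H1 H2 H3 Hd x Hx) as G.
  assert (I : forall y, Rabs y <= eps -> y ^ 2 <= eps ^ 2).
  { intros y Hy. rewrite <- (pow2_abs y). apply pow_incr. split; [apply Rabs_pos|exact Hy]. }
  apply I in I1; apply I in I2; apply I in I3.
  assert (G' : y1 x ^ 2 + y2 x ^ 2 + y3 x ^ 2 <= (sqrt A * eps) ^ 2).
  { rewrite Rpow_mult_distr, <- (Rsqr_pow2 (sqrt A)), Rsqr_sqrt by lra.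
    eapply Rle_trans; [exact G|]. unfold A.
    replace ((3 + X) * exp ((6 * K + 3) * X) * eps ^ 2)
      with ((3 * eps ^ 2 + eps ^ 2 * X) * exp ((6 * K + 3) * X)) by ring.
    apply Rmult_le_compat_r; [left; apply exp_pos|lra]. }
  assert (0 <= sqrt A * eps) by (apply Rmult_le_pos; [apply sqrt_pos|lra]).
  repeat split; apply Rabs_le_of_sq; nra.
Qed.

(** The differential inequalities are invariant under [x |-> -x]. *)
Lemma gronwall3_zero (K : R) (y1 y2 y3 d1 d2 d3 : R -> R) : 0 <= K ->
  (forall x, is_derive y1 x (d1 x)) ->
  (forall x, is_derive y2 x (d2 x)) ->
  (forall x, is_derive y3 x (d3 x)) ->
  (forall x,
    Rabs (d1 x) <= K * (Rabs (y1 x) + Rabs (y2 x) + Rabs (y3 x)) /\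
    Rabs (d2 x) <= K * (Rabs (y1 x) + Rabs (y2 x) + Rabs (y3 x)) /\
    Rabs (d3 x) <= K * (Rabs (y1 x) + Rabs (y2 x) + Rabs (y3 x))) ->
  y1 0 = 0 -> y2 0 = 0 -> y3 0 = 0 ->
  forall x, y1 x = 0 /\ y2 x = 0 /\ y3 x = 0.
Proof.
  intros HK.
  assert (P : forall z1 z2 z3 e1 e2 e3 : R -> R,
    (forall x, is_derive z1 x (e1 x)) ->
    (forall x, is_derive z2 x (e2 x)) ->
    (forall x, is_derive z3 x (e3 x)) ->
    (forall x,
      Rabs (e1 x) <= K * (Rabs (z1 x) + Rabs (z2 x) + Rabs (z3 x)) /\
      Rabs (e2 x) <= K * (Rabs (z1 x) + Rabs (z2 x) + Rabs (z3 x)) /\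
      Rabs (e3 x) <= K * (Rabs (z1 x) + Rabs (z2 x) + Rabs (z3 x))) ->
    z1 0 = 0 -> z2 0 = 0 -> z3 0 = 0 ->
    forall x, 0 <= x -> z1 x = 0 /\ z2 x = 0 /\ z3 x = 0).
  { intros z1 z2 z3 e1 e2 e3 H1 H2 H3 Hd I1 I2 I3 x Hx.
    destruct (gronwall3 K x HK Hx) as [C [HC G]].
    assert (Z : forall y, Rabs y <= C * 0 -> y = 0).
    { intros y Hy. rewrite Rmult_0_r in Hy.
      destruct (Req_dec y 0) as [|N]; [assumption|].
      apply Rabs_pos_lt in N. lra. }
    destruct (G 0 z1 z2 z3 e1 e2 e3) with (x := x) as [A [B D]]; auto; try lra.
    - intros t _. destruct (Hd t) as [? [? ?]]. lra.
    - rewrite I1, Rabs_R0; lra.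
    - rewrite I2, Rabs_R0; lra.
    - rewrite I3, Rabs_R0; lra. }
  intros H1 H2 H3 Hd I1 I2 I3 x.
  destruct (Rle_dec 0 x) as [Hx|Hx].
  - now apply (P y1 y2 y3 d1 d2 d3).
  - assert (R : forall y d, (forall x, is_derive y x (d x)) ->
      forall x, is_derive (fun t : R => y (- t)) x (- d (- x))).
    { intros y d H t. solve_derive. }
    destruct (P (fun t => y1 (- t)) (fun t => y2 (- t)) (fun t => y3 (- t))
      (fun t => - d1 (- t)) (fun t => - d2 (- t)) (fun t => - d3 (- t))) with (x := - x) as [A B];
      try (now apply R); try (rewrite Ropp_0; assumption); try lra.
    + intros t. rewrite !Rabs_Ropp. apply Hd.
    + rewrite Ropp_involutive in A, B. auto.
Qed.

(** * Linear systems *)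

Lemma is_derive_continuous (g : R -> R) (x l : R) :
  is_derive g x l -> continuous g x.
Proof. intros H. apply (ex_derive_continuous (V := R_NormedModule)). now exists l. Qed.

Lemma ex_RInt_cont (h : R -> R) (x y : R) :
  (forall t, continuous h t) -> ex_RInt h x y.
Proof. intros H. apply (ex_RInt_continuous (V := R_CompleteNormedModule)). auto. Qed.

Lemma is_derive_primitive (h : R -> R) (x : R) :
  (forall t, continuous h t) -> is_derive (fun y => RInt h 0 y) x (h x).
Proof.
  intros H. apply (is_derive_RInt (V := R_NormedModule) h _ 0); [|apply H].
  apply filter_forall. intros y.
  apply (RInt_correct (V := R_CompleteNormedModule)), ex_RInt_cont, H.
Qed.

Lemma Rabs_le_exp_weight (L x c : R) : 0 <= L -> 0 <= c -> c <= c * exp (L * Rabs x).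
Proof.
  intros HL Hc. rewrite <- (Rmult_1_r c) at 1. apply Rmult_le_compat_l; [assumption|].
  rewrite <- exp_0. apply exp_le, Rmult_le_pos; [assumption|apply Rabs_pos].
Qed.

(** Integration from 0 gains a factor [1 / L] in the norm [sup |h(x)| exp(- L |x|)]. This weighted
    norm makes the Picard map a contraction on the whole line at once, with no continuation of local
    solutions. *)
Lemma primitive_exp_bound (L b : R) (H h : R -> R) : 1 <= L ->
  (forall x, is_derive H x (h x)) -> H 0 = 0 ->
  (forall x, Rabs (h x) <= b * exp (L * Rabs x)) ->
  forall x, Rabs (H x) <= b / L * exp (L * Rabs x).
Proof.
  intros HL.
  assert (P : forall G g : R -> R,
    (forall x, is_derive G x (g x)) -> G 0 = 0 ->
    (forall x, Rabs (g x) <= b * exp (L * Rabs x)) ->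
    forall x, 0 <= x -> G x <= b / L * exp (L * x)).
  { intros G g HG G0 Hg x Hx.
    assert (b0 : 0 <= b).
    { specialize (Hg 0). rewrite Rabs_R0, Rmult_0_r, exp_0 in Hg.
      pose proof (Rabs_pos (g 0)). lra. }
    assert (D : forall t, is_derive (fun t => G t - b / L * exp (L * t)) t
      (g t - b * exp (L * t))).
    { intros t. solve_derive. field. lra. }
    pose proof (is_derive_decr _ _ 0 x D) as M. cbv beta in M.
    rewrite G0, Rmult_0_r, exp_0 in M.
    assert (0 <= b / L) by (apply Rdiv_le_0_compat; lra).
    enough (G x - b / L * exp (L * x) <= 0 - b / L * 1) by lra.
    apply M; [|assumption]. intros t Ht. specialize (Hg t).
    rewrite (Rabs_pos_eq t) in Hg by lra.
    pose proof (Rle_abs (g t)). lra. }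
  assert (P2 : forall G g : R -> R,
    (forall x, is_derive G x (g x)) -> G 0 = 0 ->
    (forall x, Rabs (g x) <= b * exp (L * Rabs x)) ->
    forall x, 0 <= x -> Rabs (G x) <= b / L * exp (L * x)).
  { intros G g HG G0 Hg x Hx. apply Rabs_le. split.
    - enough (- G x <= b / L * exp (L * x)) by lra.
      apply (P (fun t => - G t) (fun t => - g t)); auto.
      + intros t. solve_derive.
      + rewrite G0; ring.
      + intros t. rewrite Rabs_Ropp; auto.
    - now apply (P G g). }
  intros HG H0 Hh x.
  destruct (Rle_dec 0 x) as [Hx|Hx].
  - rewrite (Rabs_pos_eq x Hx). now apply (P2 H h).
  - rewrite (Rabs_left x) by lra.
    rewrite <- (Ropp_involutive x) at 1.
    apply (P2 (fun t => H (- t)) (fun t => - h (- t))); try lra.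
    + intros t. solve_derive.
    + now rewrite Ropp_0.
    + intros t. rewrite Rabs_Ropp, <- (Rabs_Ropp t). apply Hh.
Qed.

Lemma geom_small (A C : R) : (forall n, Rabs A <= C * (/ 2) ^ n) -> A = 0.
Proof.
  intros H.
  assert (L : is_lim_seq (fun n => C * (/ 2) ^ n) 0).
  { replace (Finite 0) with (Rbar_mult C 0) by (simpl; f_equal; ring).
    apply is_lim_seq_scal_l, is_lim_seq_geom. rewrite Rabs_pos_eq; lra. }
  assert (B : Rbar_le (Rabs A) 0).
  { apply (is_lim_seq_le (fun _ => Rabs A) (fun n => C * (/ 2) ^ n));
      [assumption|apply is_lim_seq_const|assumption]. }
  simpl in B. destruct (Req_dec A 0) as [|N]; [assumption|].
  apply Rabs_pos_lt in N. lra.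
Qed.

(** * Global existence for the linear system by Picard iteration *)

Section Picard.

Variables (q r : R -> R) (Q B mu a0 b0 c0 : R).
Hypothesis (cq : forall x, continuous q x) (cr : forall x, continuous r x).
Hypothesis (bq : forall x, Rabs (q x) <= Q) (br : forall x, Rabs (r x) <= B).

(** In the system [y1' = y2], [y2' = y3 - q y1], [y3' = r - mu y1], the first component determines
    [y3], then [y2], then [y1] again. Solutions are therefore fixed points of a map on the single
    function [y1]. *)
Let picard3 (phi : R -> R) (x : R) : R := c0 + RInt (fun t => r t - mu * phi t) 0 x.
Let picard2 (phi : R -> R) (x : R) : R := b0 + RInt (fun t => picard3 phi t - q t * phi t) 0 x.
Let picard1 (phi : R -> R) (x : R) : R := a0 + RInt (picard2 phi) 0 x.

Let cont (phi : R -> R) := forall x, continuous phi x.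

Lemma picard3_derive phi : cont phi -> forall x, is_derive (picard3 phi) x (r x - mu * phi x).
Proof.
  intros H x. unfold picard3. evar_last.
  apply (is_derive_plus (V := R_NormedModule)); [apply is_derive_const|].
  apply (is_derive_primitive (fun t => r t - mu * phi t)).
  - intros t. apply (continuous_minus (V := R_NormedModule)); [apply cr|].
    now apply (continuous_scal_r (V := R_NormedModule)).
  - unfold plus, zero; simpl; ring.
Qed.

Lemma picard2_derive phi : cont phi -> forall x, is_derive (picard2 phi) x (picard3 phi x - q x * phi x).
Proof.
  intros H x. unfold picard2. evar_last.
  apply (is_derive_plus (V := R_NormedModule)); [apply is_derive_const|].
  apply (is_derive_primitive (fun t => picard3 phi t - q t * phi t)).
  - intros t. apply (continuous_minus (V := R_NormedModule)).
    + now apply (is_derive_continuous _ _ _ (picard3_derive phi H t)).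
    + now apply (continuous_mult (K := R_AbsRing)).
  - unfold plus, zero; simpl; ring.
Qed.

Lemma picard1_derive phi : cont phi -> forall x, is_derive (picard1 phi) x (picard2 phi x).
Proof.
  intros H x. unfold picard1. evar_last.
  apply (is_derive_plus (V := R_NormedModule)); [apply is_derive_const|].
  apply (is_derive_primitive (picard2 phi)).
  - intros t. now apply (is_derive_continuous _ _ _ (picard2_derive phi H t)).
  - unfold plus, zero; simpl; ring.
Qed.

(** Large enough that [(|mu| + Q) / L <= 1 / 2], the contraction factor, and at least 1, so that no
    integration increases the weighted norm. *)
Let L := 1 + 2 * (Rabs mu + Q).

Lemma picard_Q_pos : 0 <= Q.
Proof. eapply Rle_trans; [apply Rabs_pos|apply (bq 0)]. Qed.

Lemma picard_B_pos : 0 <= B.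
Proof. eapply Rle_trans; [apply Rabs_pos|apply (br 0)]. Qed.

Lemma picard_L_ge1 : 1 <= L.
Proof. unfold L. pose proof picard_Q_pos. pose proof (Rabs_pos mu). lra. Qed.

Lemma picard_div_L_le (b : R) : 0 <= b -> b / L <= b.
Proof.
  intros Hb. pose proof picard_L_ge1. apply Rle_div_l; [lra|].
  rewrite <- (Rmult_1_r b) at 1. now apply Rmult_le_compat_l.
Qed.

Lemma picard_primitive_bound (b : R) (H h : R -> R) :
  (forall x, is_derive H x (h x)) -> H 0 = 0 ->
  (forall x, Rabs (h x) <= b * exp (L * Rabs x)) ->
  forall x, Rabs (H x) <= b * exp (L * Rabs x).
Proof.
  intros HH H0 Hh x. eapply Rle_trans.
  - now apply (primitive_exp_bound L b H h picard_L_ge1).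
  - apply Rmult_le_compat_r; [left; apply exp_pos|].
    apply picard_div_L_le. specialize (Hh 0). rewrite Rabs_R0, Rmult_0_r, exp_0 in Hh.
    pose proof (Rabs_pos (h 0)). lra.
Qed.

(** The two inner integrations are only bounded by 1 and together produce the factor [|mu| + Q]; the
    gain [1 / L] of the outermost one brings this down to [1 / 2]. *)
Lemma picard1_contraction (phi phi' : R -> R) (b : R) : cont phi -> cont phi' ->
  (forall x, Rabs (phi x - phi' x) <= b * exp (L * Rabs x)) ->
  forall x, Rabs (picard1 phi x - picard1 phi' x) <= b / 2 * exp (L * Rabs x).
Proof.
  intros C C' Hb.
  assert (picard_b_pos : 0 <= b).
  { specialize (Hb 0). rewrite Rabs_R0, Rmult_0_r, exp_0 in Hb.
    pose proof (Rabs_pos (phi 0 - phi' 0)). lra. }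
  assert (H3 : forall x, Rabs (picard3 phi x - picard3 phi' x) <= Rabs mu * b * exp (L * Rabs x)).
  { apply picard_primitive_bound with (h := fun x => (r x - mu * phi x) - (r x - mu * phi' x)).
    - intros x. apply (is_derive_minus (V := R_NormedModule)); now apply picard3_derive.
    - unfold picard3. rewrite !(RInt_point (V := R_CompleteNormedModule)). apply Rminus_diag_eq; reflexivity.
    - intros x. replace (_ - _) with (- (mu * (phi x - phi' x))) by ring.
      rewrite Rabs_Ropp, Rabs_mult, Rmult_assoc.
      apply Rmult_le_compat_l; [apply Rabs_pos|apply Hb]. }
  assert (H2 : forall x, Rabs (picard2 phi x - picard2 phi' x) <= (Rabs mu + Q) * b * exp (L * Rabs x)).
  { apply picard_primitive_bound with
      (h := fun x => (picard3 phi x - q x * phi x) - (picard3 phi' x - q x * phi' x)).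
    - intros x. apply (is_derive_minus (V := R_NormedModule)); now apply picard2_derive.
    - unfold picard2. rewrite !(RInt_point (V := R_CompleteNormedModule)). apply Rminus_diag_eq; reflexivity.
    - intros x. replace (_ - _) with ((picard3 phi x - picard3 phi' x) + - (q x * (phi x - phi' x))) by ring.
      eapply Rle_trans; [apply Rabs_triang|]. rewrite Rabs_Ropp, Rabs_mult.
      specialize (H3 x). specialize (Hb x).
      assert (Rabs (q x) * Rabs (phi x - phi' x) <= Q * (b * exp (L * Rabs x)))
        by (apply Rmult_le_compat; auto using Rabs_pos).
      lra. }
  intros x. eapply Rle_trans.
  - apply (primitive_exp_bound L ((Rabs mu + Q) * b) (fun x => picard1 phi x - picard1 phi' x)
      (fun x => picard2 phi x - picard2 phi' x)).
    + apply picard_L_ge1.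
    + intros t. apply (is_derive_minus (V := R_NormedModule)); now apply picard1_derive.
    + unfold picard1. rewrite !(RInt_point (V := R_CompleteNormedModule)). apply Rminus_diag_eq; reflexivity.
    + assumption.
  - apply Rmult_le_compat_r; [left; apply exp_pos|].
    pose proof picard_L_ge1. apply Rle_div_l; [lra|]. unfold L. lra.
Qed.

Let iter (n : nat) : R -> R := Nat.iter n picard1 (fun _ => 0).

Lemma iterate_cont n : cont (iter n).
Proof.
  induction n as [|n IH]; intros x.
  - apply continuous_const.
  - exact (is_derive_continuous _ _ _ (picard1_derive (iter n) IH x)).
Qed.

Let b := Rabs a0 + Rabs b0 + Rabs c0 + B.

Lemma picard_b_pos : 0 <= b.
Proof.
  unfold b. pose proof picard_B_pos. pose proof (Rabs_pos a0).
  pose proof (Rabs_pos b0). pose proof (Rabs_pos c0). lra.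
Qed.

Lemma picard_affine_bound (k m : R) (H h : R -> R) : 0 <= m ->
  (forall x, is_derive H x (h x)) -> H 0 = k ->
  (forall x, Rabs (h x) <= m * exp (L * Rabs x)) ->
  forall x, Rabs (H x) <= (Rabs k + m) * exp (L * Rabs x).
Proof.
  intros Hm HH Hk Hh x.
  replace (H x) with (k + (H x - k)) by ring.
  eapply Rle_trans; [apply Rabs_triang|]. rewrite Rmult_plus_distr_r.
  apply Rplus_le_compat.
  - apply Rabs_le_exp_weight; [pose proof picard_L_ge1; lra|apply Rabs_pos].
  - apply (picard_primitive_bound m (fun x => H x - k) h).
    + intros t. solve_derive.
    + rewrite Hk; ring.
    + assumption.
Qed.

Lemma iterate_step n x : Rabs (iter (S n) x - iter n x) <= b * (/ 2) ^ n * exp (L * Rabs x).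
Proof.
  revert x. induction n as [|n IH]; intros x.
  - change (iter 0 x) with 0. rewrite Rminus_0_r, pow_O, Rmult_1_r.
    assert (C0 : cont (fun _ => 0)) by (intros t; apply continuous_const).
    pose proof picard_B_pos. pose proof (Rabs_pos a0). pose proof (Rabs_pos b0). pose proof (Rabs_pos c0).
    assert (E3 : forall x, Rabs (picard3 (fun _ => 0) x) <= (Rabs c0 + B) * exp (L * Rabs x)).
    { apply picard_affine_bound with (h := fun x => r x - mu * 0); [lra|now apply picard3_derive| |].
      - unfold picard3. rewrite (RInt_point (V := R_CompleteNormedModule)). apply Rplus_0_r.
      - intros t. rewrite Rmult_0_r, Rminus_0_r. eapply Rle_trans; [apply br|].
        apply Rabs_le_exp_weight; [pose proof picard_L_ge1; lra|lra]. }
    assert (E2 : forall x, Rabs (picard2 (fun _ => 0) x) <= (Rabs b0 + (Rabs c0 + B)) * exp (L * Rabs x)).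
    { apply picard_affine_bound with (h := fun x => picard3 (fun _ => 0) x - q x * 0); [lra|now apply picard2_derive| |].
      - unfold picard2. rewrite (RInt_point (V := R_CompleteNormedModule)). apply Rplus_0_r.
      - intros t. rewrite Rmult_0_r, Rminus_0_r. apply E3. }
    replace b with (Rabs a0 + (Rabs b0 + (Rabs c0 + B))) by (unfold b; ring).
    apply picard_affine_bound with (h := picard2 (fun _ => 0)); [lra|now apply picard1_derive| |].
    + unfold iter, picard1; simpl. rewrite (RInt_point (V := R_CompleteNormedModule)). apply Rplus_0_r.
    + assumption.
  - replace (b * (/ 2) ^ S n) with (b * (/ 2) ^ n / 2) by (simpl; field).
    apply (picard1_contraction (iter (S n)) (iter n)); auto using iterate_cont.
Qed.

Lemma iterate_tail n m x :
  Rabs (iter (m + n) x - iter n x) <= b * (/ 2) ^ n * exp (L * Rabs x) * 2 * (1 - (/ 2) ^ m).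
Proof.
  induction m as [|m IH].
  - simpl. rewrite Rminus_diag, Rabs_R0. lra.
  - replace (iter (S m + n) x - iter n x)
      with ((iter (S (m + n)) x - iter (m + n) x) + (iter (m + n) x - iter n x)) by (simpl; ring).
    eapply Rle_trans; [apply Rabs_triang|].
    pose proof (iterate_step (m + n) x) as St. rewrite pow_add in St.
    eapply Rle_trans; [apply Rplus_le_compat; [exact St|exact IH]|].
    right. simpl. field.
Qed.

(** The iterates are written as a telescoping series: the weighted bounds on its terms are uniform
    on every ball, so normal convergence yields a continuous limit. *)
Let incr (n : nat) (x : R) : R := iter (S n) x - iter n x.

Lemma SP_increment N x : SP incr N x = iter (S N) x.
Proof.
  unfold SP. induction N as [|N IH].
  - unfold incr; simpl. ring.
  - rewrite tech5, IH. unfold incr. ring.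
Qed.

Lemma increment_CVN : CVN_R incr.
Proof.
  intros [rho Hrho]. exists (fun n => b * exp (L * rho) * (/ 2) ^ n).
  exists (b * exp (L * rho) * / (1 - / 2)).
  assert (K : 0 <= b * exp (L * rho)) by (apply Rmult_le_pos; [apply picard_b_pos|left; apply exp_pos]).
  split.
  - apply is_series_Reals.
    apply is_series_ext with (fun n => b * exp (L * rho) * (/ 2) ^ n).
    + intros n. rewrite Rabs_pos_eq; [reflexivity|].
      apply Rmult_le_pos; [assumption|apply pow_le; lra].
    + apply (is_series_scal_l (b * exp (L * rho)) (fun n => (/ 2) ^ n)), is_series_geom.
      rewrite Rabs_pos_eq; lra.
  - intros n y Hy. unfold Boule in Hy; simpl in Hy. rewrite Rminus_0_r in Hy.
    eapply Rle_trans; [apply iterate_step|].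
    replace (b * exp (L * rho) * (/ 2) ^ n) with (b * (/ 2) ^ n * exp (L * rho)) by ring.
    apply Rmult_le_compat_l.
    + apply Rmult_le_pos; [apply picard_b_pos|apply pow_le; lra].
    + pose proof picard_L_ge1. apply exp_le, Rmult_le_compat_l; lra.
Qed.

Lemma picard_fixed_point : exists y, cont y /\ forall x, y x = picard1 y x.
Proof.
  set (cv := CVN_R_CVS incr increment_CVN).
  exists (SFL incr cv).
  assert (C : cont (SFL incr cv)).
  { intros x. apply continuity_pt_filterlim.
    apply SFL_continuity; [exact increment_CVN|].
    intros n t. apply continuity_pt_filterlim.
    apply (continuous_minus (V := R_NormedModule)); apply iterate_cont. }
  split; [assumption|].
  assert (T : forall n x, Rabs (SFL incr cv x - iter n x) <= b * 2 * (/ 2) ^ n * exp (L * Rabs x)).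
  { intros n x. unfold SFL. destruct (cv x) as [l Hl]. apply is_lim_seq_Reals in Hl.
    assert (H : is_lim_seq (fun N => iter (S N) x - iter n x) (l - iter n x)).
    { apply is_lim_seq_minus'; [|apply is_lim_seq_const].
      apply is_lim_seq_ext with (2 := Hl). intros N. apply SP_increment. }
    apply is_lim_seq_abs in H.
    refine (is_lim_seq_le_loc _ _ (Finite _) (Finite _) _ H (is_lim_seq_const _)).
    exists n. intros N HN. replace (S N) with ((S N - n) + n)%nat by lia.
    eapply Rle_trans; [apply iterate_tail|].
    assert (0 <= b * (/ 2) ^ n * exp (L * Rabs x)).
    { apply Rmult_le_pos; [|left; apply exp_pos].
      apply Rmult_le_pos; [apply picard_b_pos|apply pow_le; lra]. }
    assert (0 < (/ 2) ^ (S N - n)) by (apply pow_lt; lra).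
    assert (0 <= b * (/ 2) ^ n * exp (L * Rabs x) * (/ 2) ^ (S N - n))
      by (apply Rmult_le_pos; lra).
    lra. }
  intros x. apply Rminus_diag_uniq.
  (* The limit and its image are both within a multiple of [2^-n] of the same iterate. *)
  apply geom_small with (b * 2 * exp (L * Rabs x)). intros n.
  replace (SFL incr cv x - picard1 (SFL incr cv) x)
    with ((SFL incr cv x - iter (S n) x) + - (picard1 (SFL incr cv) x - iter (S n) x)) by ring.
  eapply Rle_trans; [apply Rabs_triang|]. rewrite Rabs_Ropp.
  assert (H : Rabs (picard1 (SFL incr cv) x - iter (S n) x) <= b * 2 * (/ 2) ^ n / 2 * exp (L * Rabs x))
    by (apply (picard1_contraction (SFL incr cv) (iter n)); auto using iterate_cont).
  pose proof (T (S n) x) as T'. rewrite <- tech_pow_Rmult in T'. lra.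
Qed.

(** Two uses determine the source [r]. With [r = 0] this is the spectral system. With [mu = 0] and
    [r = ga u'] the third component integrates to [al + ga u], and the first two equations become
    the equation for a variation of the profile. *)
Lemma linear_system_exists : exists y1 y2 y3 : R -> R,
  (forall x, is_derive y1 x (y2 x)) /\
  (forall x, is_derive y2 x (y3 x - q x * y1 x)) /\
  (forall x, is_derive y3 x (r x - mu * y1 x)) /\
  y1 0 = a0 /\ y2 0 = b0 /\ y3 0 = c0.
Proof.
  destruct picard_fixed_point as [y [C E]].
  exists y, (picard2 y), (picard3 y).
  refine (conj _ (conj _ (conj _ (conj _ (conj _ _))))).
  - intros x. apply (is_derive_ext (picard1 y)); [intros t; symmetry; apply E|now apply picard1_derive].
  - now apply picard2_derive.
  - now apply picard3_derive.
  - rewrite E. unfold picard1. rewrite (RInt_point (V := R_CompleteNormedModule)). apply Rplus_0_r.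
  - unfold picard2. rewrite (RInt_point (V := R_CompleteNormedModule)). apply Rplus_0_r.
  - unfold picard3. rewrite (RInt_point (V := R_CompleteNormedModule)). apply Rplus_0_r.
Qed.

End Picard.

(** * Limits and kernels of determinants *)

Section RealFilter.

Context {T : Type} {Fl : (T -> Prop) -> Prop} {FF : Filter Fl}.

Lemma filterlim_Rplus (g h : T -> R) (x y : R) :
  filterlim g Fl (locally x) -> filterlim h Fl (locally y) ->
  filterlim (fun t => g t + h t) Fl (locally (x + y)).
Proof.
  intros Hg Hh. eapply filterlim_comp_2; [exact Hg|exact Hh|].
  apply (filterlim_plus (V := R_NormedModule)).
Qed.

Lemma filterlim_Rmult (g h : T -> R) (x y : R) :
  filterlim g Fl (locally x) -> filterlim h Fl (locally y) ->
  filterlim (fun t => g t * h t) Fl (locally (x * y)).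
Proof.
  intros Hg Hh. eapply filterlim_comp_2; [exact Hg|exact Hh|].
  apply (filterlim_mult (K := R_AbsRing)).
Qed.

Lemma filterlim_Ropp (g : T -> R) (x : R) :
  filterlim g Fl (locally x) -> filterlim (fun t => - g t) Fl (locally (- x)).
Proof.
  intros Hg. eapply filterlim_comp; [exact Hg|].
  apply (filterlim_opp (V := R_NormedModule)).
Qed.

Lemma filterlim_det3 (m11 m12 m13 m21 m22 m23 m31 m32 m33 : T -> R)
  (l11 l12 l13 l21 l22 l23 l31 l32 l33 : R) :
  filterlim m11 Fl (locally l11) -> filterlim m12 Fl (locally l12) ->
  filterlim m13 Fl (locally l13) -> filterlim m21 Fl (locally l21) ->
  filterlim m22 Fl (locally l22) -> filterlim m23 Fl (locally l23) ->
  filterlim m31 Fl (locally l31) -> filterlim m32 Fl (locally l32) ->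
  filterlim m33 Fl (locally l33) ->
  filterlim (fun t => det3 (m11 t) (m12 t) (m13 t) (m21 t) (m22 t) (m23 t)
      (m31 t) (m32 t) (m33 t)) Fl
    (locally (det3 l11 l12 l13 l21 l22 l23 l31 l32 l33)).
Proof.
  intros. unfold det3, Rminus.
  repeat first [assumption | apply filterlim_Rplus | apply filterlim_Rmult | apply filterlim_Ropp].
Qed.

End RealFilter.

Lemma filterlim_locally_R {T : Type} {Fl : (T -> Prop) -> Prop} {FF : Filter Fl}
  (g : T -> R) (l : R) :
  filterlim g Fl (locally l) <-> forall eps : posreal, Fl (fun t => Rabs (g t - l) < eps).
Proof. exact (filterlim_locally (U := R_UniformSpace) g l). Qed.

(** The cofactors of any column annihilate the other two columns, and also their own because the
    determinant vanishes. If all cofactors are 0, the vector [(m2j, - m1j, 0)] works for any [j]; if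
    these vanish too, the first two rows are 0 and [(1, 0, 0)] works. *)
Lemma det3_kernel (m11 m12 m13 m21 m22 m23 m31 m32 m33 : R) :
  det3 m11 m12 m13 m21 m22 m23 m31 m32 m33 = 0 ->
  exists x y z, ~ (x = 0 /\ y = 0 /\ z = 0) /\
    x * m11 + y * m21 + z * m31 = 0 /\
    x * m12 + y * m22 + z * m32 = 0 /\
    x * m13 + y * m23 + z * m33 = 0.
Proof.
  intros D. unfold det3 in D.
  assert (C : forall x y z,
    x * m11 + y * m21 + z * m31 = 0 /\
    x * m12 + y * m22 + z * m32 = 0 /\
    x * m13 + y * m23 + z * m33 = 0 ->
    (x = 0 /\ y = 0 /\ z = 0) \/
    exists x y z, ~ (x = 0 /\ y = 0 /\ z = 0) /\
    x * m11 + y * m21 + z * m31 = 0 /\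
    x * m12 + y * m22 + z * m32 = 0 /\
    x * m13 + y * m23 + z * m33 = 0).
  { intros x y z H. destruct (Req_dec x 0), (Req_dec y 0), (Req_dec z 0); auto;
    right; exists x, y, z; tauto. }
  destruct (C (m22 * m33 - m23 * m32) (m13 * m32 - m12 * m33) (m12 * m23 - m13 * m22))
    as [[A1 [A2 A3]]|]; [repeat split; lra| |assumption].
  destruct (C (m23 * m31 - m21 * m33) (m11 * m33 - m13 * m31) (m13 * m21 - m11 * m23))
    as [[B1 [B2 B3]]|]; [repeat split; lra| |assumption].
  destruct (C (m21 * m32 - m22 * m31) (m12 * m31 - m11 * m32) (m11 * m22 - m12 * m21))
    as [[D1 [D2 D3]]|]; [repeat split; lra| |assumption].
  destruct (C m21 (- m11) 0) as [[E1 [E2 E3]]|]; [repeat split; lra| |assumption].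
  destruct (C m22 (- m12) 0) as [[F1 [F2 F3]]|]; [repeat split; lra| |assumption].
  destruct (C m23 (- m13) 0) as [[G1 [G2 G3]]|]; [repeat split; lra| |assumption].
  exists 1, 0, 0. repeat split; lra.
Qed.

(** * Solutions of the spectral system and their dependence on data *)

Lemma continuous_bounded (h : R -> R) (x y : R) :
  (forall t, continuous h t) ->
  exists B, 0 <= B /\ forall t, x <= t <= y -> Rabs (h t) <= B.
Proof.
  intros H.
  destruct (Rle_dec x y) as [Hxy|]; [|exists 0; split; [|intros]; lra].
  destruct (continuity_ab_maj (fun t => Rabs (h t)) x y Hxy) as [m [Hm _]].
  - intros c _. apply continuity_pt_filterlim.
    apply (continuous_comp h Rabs); [apply H|apply continuous_Rabs].
  - exists (Rabs (h m)). split; [apply Rabs_pos|assumption].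
Qed.

(** For [q = f'(u) - c] the third component is [y3 = - L[u] y1], so that these are the
    solutions of [d/dx (L[u] y1) = mu y1]. *)
Definition lin_sol (q : R -> R) (mu : R) (y1 y2 y3 : R -> R) : Prop :=
  (forall x, is_derive y1 x (y2 x)) /\
  (forall x, is_derive y2 x (y3 x - q x * y1 x)) /\
  (forall x, is_derive y3 x (- (mu * y1 x))).

Lemma lin_sol_exists (q : R -> R) (Q mu a b c : R) :
  (forall x, continuous q x) -> (forall x, Rabs (q x) <= Q) ->
  exists y1 y2 y3, lin_sol q mu y1 y2 y3 /\ y1 0 = a /\ y2 0 = b /\ y3 0 = c.
Proof.
  intros cq bq.
  destruct (linear_system_exists q (fun _ => 0) Q 0 mu a b c)
    as [y1 [y2 [y3 [H1 [H2 [H3 I]]]]]]; auto.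
  - intros x. apply continuous_const.
  - intros x. rewrite Rabs_R0. lra.
  - exists y1, y2, y3. split; [|exact I]. split; [|split]; auto.
    intros x. replace (- (mu * y1 x)) with (0 - mu * y1 x) by ring. apply H3.
Qed.

Lemma lin_sol_comb (q : R -> R) (mu a b c : R) (y1 y2 y3 z1 z2 z3 w1 w2 w3 : R -> R) :
  lin_sol q mu y1 y2 y3 -> lin_sol q mu z1 z2 z3 -> lin_sol q mu w1 w2 w3 ->
  lin_sol q mu (fun x => a * y1 x + b * z1 x + c * w1 x)
    (fun x => a * y2 x + b * z2 x + c * w2 x) (fun x => a * y3 x + b * z3 x + c * w3 x).
Proof.
  intros [Y1 [Y2 Y3]] [Z1 [Z2 Z3]] [W1 [W2 W3]].
  split; [|split]; intros x; solve_derive.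
Qed.

Lemma lin_sol_unique (q : R -> R) (Q mu : R) (y1 y2 y3 z1 z2 z3 : R -> R) :
  (forall x, Rabs (q x) <= Q) ->
  lin_sol q mu y1 y2 y3 -> lin_sol q mu z1 z2 z3 ->
  y1 0 = z1 0 -> y2 0 = z2 0 -> y3 0 = z3 0 ->
  forall x, y1 x = z1 x /\ y2 x = z2 x /\ y3 x = z3 x.
Proof.
  intros bq [Y1 [Y2 Y3]] [Z1 [Z2 Z3]] I1 I2 I3 x.
  assert (HQ : 0 <= Q) by (eapply Rle_trans; [apply Rabs_pos|apply (bq 0)]).
  pose proof (Rabs_pos mu) as Hmu.
  destruct (gronwall3_zero (1 + Q + Rabs mu)
    (fun x => y1 x - z1 x) (fun x => y2 x - z2 x) (fun x => y3 x - z3 x)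
    (fun x => y2 x - z2 x) (fun x => (y3 x - z3 x) - q x * (y1 x - z1 x))
    (fun x => - (mu * (y1 x - z1 x)))) with (x := x) as [A [B C]]; try (intros; solve_derive; fail); try lra.
  intros t. specialize (bq t).
  set (A := Rabs (y1 t - z1 t)). set (B := Rabs (y2 t - z2 t)). set (C := Rabs (y3 t - z3 t)).
  assert (0 <= A) by apply Rabs_pos. assert (0 <= B) by apply Rabs_pos.
  assert (0 <= C) by apply Rabs_pos.
  assert (0 <= (Q + Rabs mu) * (A + B + C)) by (apply Rmult_le_pos; lra).
  assert (0 <= Q * (B + C)) by (apply Rmult_le_pos; lra).
  assert (0 <= Rabs mu * (B + C)) by (apply Rmult_le_pos; lra).
  assert (0 <= Rabs mu * A) by (apply Rmult_le_pos; lra).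
  assert (0 <= Q * A) by (apply Rmult_le_pos; lra).
  repeat split.
  - lra.
  - eapply Rle_trans; [apply Rabs_triang|]. rewrite Rabs_Ropp, Rabs_mult. fold A C.
    assert (Rabs (q t) * A <= Q * A) by (apply Rmult_le_compat_r; assumption).
    lra.
  - rewrite Rabs_Ropp, Rabs_mult. fold A. lra.
Qed.

(** The difference from the fixed solution [y] solves the perturbed system with forcing
    [(tau - tau0) q y1] and [(mu - mu0) y1]. This is of order [eps] because [y1] is bounded on
    [[0, X]], while [eps <= 1] keeps the Groenwall constant independent of [tau] and [mu]. It serves
    both for the continuity of the determinant and for the limit of small [mu]. *)
Lemma lin_sol_perturb (q : R -> R) (Q X tau0 mu0 : R) (y1 y2 y3 : R -> R) :
  (forall x, Rabs (q x) <= Q) -> 0 <= X ->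
  lin_sol (fun x => tau0 * q x) mu0 y1 y2 y3 ->
  exists C, 0 <= C /\ forall eps tau mu z1 z2 z3, 0 <= eps <= 1 ->
    lin_sol (fun x => tau * q x) mu z1 z2 z3 ->
    Rabs (tau - tau0) <= eps -> Rabs (mu - mu0) <= eps ->
    Rabs (z1 0 - y1 0) <= eps -> Rabs (z2 0 - y2 0) <= eps -> Rabs (z3 0 - y3 0) <= eps ->
    forall x, 0 <= x <= X ->
    Rabs (z1 x - y1 x) <= C * eps /\ Rabs (z2 x - y2 x) <= C * eps /\
    Rabs (z3 x - y3 x) <= C * eps.
Proof.
  intros bq HX [Y1 [Y2 Y3]].
  assert (HQ : 0 <= Q) by (eapply Rle_trans; [apply Rabs_pos|apply (bq 0)]).
  destruct (continuous_bounded y1 0 X) as [B [HB Hy]].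
  { intros t. now apply (is_derive_continuous _ _ (y2 t)). }
  pose proof (Rabs_pos mu0) as Hmu0. pose proof (Rabs_pos tau0) as Htau0.
  set (K := 1 + (Rabs tau0 + 1) * Q + (Rabs mu0 + 1)).
  assert (HtQ : 0 <= (Rabs tau0 + 1) * Q) by (apply Rmult_le_pos; lra).
  destruct (gronwall3 K X) as [C [HC G]]; [unfold K; lra|assumption|].
  assert (HQB : 0 <= Q * B) by (apply Rmult_le_pos; lra).
  set (M := 1 + Q * B + B).
  exists (C * M). split; [apply Rmult_le_pos; unfold M; lra|].
  intros eps tau mu z1 z2 z3 He [Z1 [Z2 Z3]] Ht Hm I1 I2 I3 x Hx.
  rewrite Rmult_assoc.
  assert (eM : eps <= M * eps).
  { rewrite <- (Rmult_1_l eps) at 1. apply Rmult_le_compat_r; unfold M; lra. }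
  apply (G (M * eps) (fun x => z1 x - y1 x) (fun x => z2 x - y2 x) (fun x => z3 x - y3 x)
    (fun x => z2 x - y2 x)
    (fun x => (z3 x - y3 x) - tau * q x * (z1 x - y1 x) - (tau - tau0) * q x * y1 x)
    (fun x => - (mu * (z1 x - y1 x)) - (mu - mu0) * y1 x)); try lra;
    try (intros; solve_derive; fail).
  intros t Htx. specialize (bq t). specialize (Hy t Htx).
  set (A := Rabs (z1 t - y1 t)). set (A2 := Rabs (z2 t - y2 t)). set (A3 := Rabs (z3 t - y3 t)).
  assert (0 <= A) by apply Rabs_pos. assert (0 <= A2) by apply Rabs_pos.
  assert (0 <= A3) by apply Rabs_pos.
  assert (Tau : Rabs tau <= Rabs tau0 + 1).
  { replace tau with (tau0 + (tau - tau0)) by ring.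
    eapply Rle_trans; [apply Rabs_triang|lra]. }
  assert (Mu : Rabs mu <= Rabs mu0 + 1).
  { replace mu with (mu0 + (mu - mu0)) by ring.
    eapply Rle_trans; [apply Rabs_triang|lra]. }
  assert (N1 : (Rabs tau0 + 1) * Q * A <= (Rabs tau0 + 1) * Q * (A + A2 + A3))
    by (apply Rmult_le_compat_l; lra).
  assert (N2 : (Rabs mu0 + 1) * A <= (Rabs mu0 + 1) * (A + A2 + A3))
    by (apply Rmult_le_compat_l; lra).
  assert (N3 : 0 <= (Rabs tau0 + 1) * Q * (A + A2 + A3)) by (apply Rmult_le_pos; lra).
  assert (N4 : 0 <= (Rabs mu0 + 1) * (A + A2 + A3)) by (apply Rmult_le_pos; lra).
  assert (N5 : 0 <= Q * B * eps) by (apply Rmult_le_pos; lra).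
  assert (N6 : 0 <= B * eps) by (apply Rmult_le_pos; lra).
  unfold K. repeat split.
  - lra.
  - eapply Rle_trans; [apply Rabs_triang|]. rewrite Rabs_Ropp.
    eapply Rle_trans; [apply Rplus_le_compat_r, Rabs_triang|].
    rewrite Rabs_Ropp, !Rabs_mult. fold A A3.
    assert (Rabs tau * Rabs (q t) * A <= (Rabs tau0 + 1) * Q * A).
    { apply Rmult_le_compat_r; [assumption|]. apply Rmult_le_compat; auto using Rabs_pos. }
    assert (Rabs (tau - tau0) * Rabs (q t) * Rabs (y1 t) <= eps * Q * B).
    { apply Rmult_le_compat; auto using Rabs_pos.
      - apply Rmult_le_pos; apply Rabs_pos.
      - apply Rmult_le_compat; auto using Rabs_pos. }
    unfold M. lra.
  - eapply Rle_trans; [apply Rabs_triang|]. rewrite !Rabs_Ropp, !Rabs_mult. fold A.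
    assert (Rabs mu * A <= (Rabs mu0 + 1) * A) by (apply Rmult_le_compat_r; assumption).
    assert (Rabs (mu - mu0) * Rabs (y1 t) <= eps * B) by (apply Rmult_le_compat; auto using Rabs_pos).
    unfold M. lra.
Qed.

Lemma lipschitz_at_continuous (g : R -> R) (s0 C : R) :
  (forall s, Rabs (s - s0) <= 1 -> Rabs (g s - g s0) <= C * Rabs (s - s0)) ->
  continuous g s0.
Proof.
  intros H. apply filterlim_locally_R. intros eps.
  assert (HC : 0 < Rabs C + 1) by (pose proof (Rabs_pos C); lra).
  assert (Hd : 0 < Rmin 1 (eps / (Rabs C + 1))).
  { apply Rmin_glb_lt; [lra|]. apply Rdiv_lt_0_compat; [apply cond_pos|lra]. }
  exists (mkposreal _ Hd). intros s Hs.
  change (Rabs (s - s0) < Rmin 1 (eps / (Rabs C + 1))) in Hs.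
  pose proof (Rmin_l 1 (eps / (Rabs C + 1))). pose proof (Rmin_r 1 (eps / (Rabs C + 1))).
  eapply Rle_lt_trans; [apply H; lra|].
  apply Rle_lt_trans with ((Rabs C + 1) * Rabs (s - s0)).
  - apply Rmult_le_compat_r; [apply Rabs_pos|]. pose proof (Rle_abs C). lra.
  - rewrite Rmult_comm. apply Rlt_div_r; lra.
Qed.

(** * The Floquet determinant *)

(** [D] is the determinant of the period map minus the identity in the basis of unit initial data.
    The increments of three solutions form their initial matrix times this one, so the first clause
    is multiplicativity of the determinant. It allows [D] to be computed from whichever solutions
    are convenient: exponentials for constant coefficients, perturbed variations for small [mu]. *)
Lemma floquet_det (q : R -> R) (Q T : R) :
  (forall x, continuous q x) -> (forall x, Rabs (q x) <= Q) -> 0 <= T ->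
  exists D : R -> R -> R,
  (forall tau mu y1 y2 y3 z1 z2 z3 w1 w2 w3,
    lin_sol (fun x => tau * q x) mu y1 y2 y3 ->
    lin_sol (fun x => tau * q x) mu z1 z2 z3 ->
    lin_sol (fun x => tau * q x) mu w1 w2 w3 ->
    det3 (y1 T - y1 0) (y2 T - y2 0) (y3 T - y3 0)
         (z1 T - z1 0) (z2 T - z2 0) (z3 T - z3 0)
         (w1 T - w1 0) (w2 T - w2 0) (w3 T - w3 0) =
    D tau mu * det3 (y1 0) (y2 0) (y3 0) (z1 0) (z2 0) (z3 0) (w1 0) (w2 0) (w3 0)) /\
  (forall tau mu, D tau mu = 0 -> exists y1 y2 y3,
    lin_sol (fun x => tau * q x) mu y1 y2 y3 /\
    y1 T = y1 0 /\ y2 T = y2 0 /\ y3 T = y3 0 /\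
    ~ (y1 0 = 0 /\ y2 0 = 0 /\ y3 0 = 0)) /\
  (forall mu tau, continuous (fun tau => D tau mu) tau) /\
  (forall tau mu, continuous (fun mu => D tau mu) mu).
Proof.
  intros cq bq HT.
  assert (HQ : 0 <= Q) by (eapply Rle_trans; [apply Rabs_pos|apply (bq 0)]).
  assert (bt : forall tau x, Rabs (tau * q x) <= Rabs tau * Q).
  { intros tau x. rewrite Rabs_mult. apply Rmult_le_compat_l; auto using Rabs_pos. }
  (* Choosing one solution for every [tau], [mu] and initial value makes [D] a genuine function of
     [tau] and [mu]. *)
  assert (Ex : forall tau mu a b c, {Y : (R -> R) * (R -> R) * (R -> R) |
    lin_sol (fun x => tau * q x) mu (fst (fst Y)) (snd (fst Y)) (snd Y) /\
    fst (fst Y) 0 = a /\ snd (fst Y) 0 = b /\ snd Y 0 = c}).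
  { intros tau mu a b c. apply constructive_indefinite_description.
    destruct (lin_sol_exists (fun x => tau * q x) (Rabs tau * Q) mu a b c)
      as [y1 [y2 [y3 H]]]; auto.
    - intros x. now apply (continuous_scal_r (V := R_NormedModule)).
    - now exists (y1, y2, y3). }
  set (Y := fun a b c tau mu => proj1_sig (Ex tau mu a b c)).
  set (Y1 := fun a b c tau mu => fst (fst (Y a b c tau mu))).
  set (Y2 := fun a b c tau mu => snd (fst (Y a b c tau mu))).
  set (Y3 := fun a b c tau mu => snd (Y a b c tau mu)).
  assert (HY : forall a b c tau mu,
    lin_sol (fun x => tau * q x) mu (Y1 a b c tau mu) (Y2 a b c tau mu) (Y3 a b c tau mu) /\
    Y1 a b c tau mu 0 = a /\ Y2 a b c tau mu 0 = b /\ Y3 a b c tau mu 0 = c).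
  { intros. exact (proj2_sig (Ex tau mu a b c)). }
  clearbody Y1 Y2 Y3. clear Y.
  assert (Lip : forall a b c tau0 mu0, exists C, 0 <= C /\ forall tau mu eps,
    0 <= eps <= 1 -> Rabs (tau - tau0) <= eps -> Rabs (mu - mu0) <= eps ->
    Rabs (Y1 a b c tau mu T - Y1 a b c tau0 mu0 T) <= C * eps /\
    Rabs (Y2 a b c tau mu T - Y2 a b c tau0 mu0 T) <= C * eps /\
    Rabs (Y3 a b c tau mu T - Y3 a b c tau0 mu0 T) <= C * eps).
  { intros a b c tau0 mu0. destruct (HY a b c tau0 mu0) as [S0 [I1 [I2 I3]]].
    destruct (lin_sol_perturb q Q T tau0 mu0 _ _ _ bq HT S0) as [C [HC H]].
    exists C. split; [assumption|]. intros tau mu eps He Ht Hm.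
    destruct (HY a b c tau mu) as [S [J1 [J2 J3]]].
    apply (H eps tau mu); auto; try lra;
      rewrite ?I1, ?I2, ?I3, ?J1, ?J2, ?J3, Rminus_diag, Rabs_R0; lra. }
  set (D := fun tau mu => det3
    (Y1 1 0 0 tau mu T - 1) (Y2 1 0 0 tau mu T) (Y3 1 0 0 tau mu T)
    (Y1 0 1 0 tau mu T) (Y2 0 1 0 tau mu T - 1) (Y3 0 1 0 tau mu T)
    (Y1 0 0 1 tau mu T) (Y2 0 0 1 tau mu T) (Y3 0 0 1 tau mu T - 1)).
  exists D.
  assert (Span : forall tau mu y1 y2 y3, lin_sol (fun x => tau * q x) mu y1 y2 y3 ->
    y1 T = y1 0 * Y1 1 0 0 tau mu T + y2 0 * Y1 0 1 0 tau mu T + y3 0 * Y1 0 0 1 tau mu T /\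
    y2 T = y1 0 * Y2 1 0 0 tau mu T + y2 0 * Y2 0 1 0 tau mu T + y3 0 * Y2 0 0 1 tau mu T /\
    y3 T = y1 0 * Y3 1 0 0 tau mu T + y2 0 * Y3 0 1 0 tau mu T + y3 0 * Y3 0 0 1 tau mu T).
  { intros tau mu y1 y2 y3 Hy.
    destruct (HY 1 0 0 tau mu) as [S1 [A1 [A2 A3]]].
    destruct (HY 0 1 0 tau mu) as [S2 [B1 [B2 B3]]].
    destruct (HY 0 0 1 tau mu) as [S3 [C1 [C2 C3]]].
    apply (lin_sol_unique (fun x => tau * q x) (Rabs tau * Q) mu y1 y2 y3 _ _ _ (bt tau) Hy
      (lin_sol_comb _ _ (y1 0) (y2 0) (y3 0) _ _ _ _ _ _ _ _ _ S1 S2 S3));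
      rewrite ?A1, ?A2, ?A3, ?B1, ?B2, ?B3, ?C1, ?C2, ?C3; ring. }
  refine (conj _ (conj _ (conj _ _))).
  - intros tau mu y1 y2 y3 z1 z2 z3 w1 w2 w3 Hy Hz Hw.
    destruct (Span _ _ _ _ _ Hy) as [-> [-> ->]].
    destruct (Span _ _ _ _ _ Hz) as [-> [-> ->]].
    destruct (Span _ _ _ _ _ Hw) as [-> [-> ->]].
    unfold D, det3. ring.
  (* A kernel vector of the period map minus the identity is the initial value of a periodic
     solution. *)
  - intros tau mu HD. destruct (det3_kernel _ _ _ _ _ _ _ _ _ HD) as [a [b [c [N [E1 [E2 E3]]]]]].
    destruct (HY a b c tau mu) as [S [I1 [I2 I3]]].
    exists (Y1 a b c tau mu), (Y2 a b c tau mu), (Y3 a b c tau mu).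
    destruct (Span _ _ _ _ _ S) as [F1 [F2 F3]].
    rewrite I1, I2, I3 in *. split; [assumption|]. repeat split; auto; lra.
  - assert (C : forall a b c tau mu,
      continuous (fun t => Y1 a b c t mu T) tau /\
      continuous (fun t => Y2 a b c t mu T) tau /\
      continuous (fun t => Y3 a b c t mu T) tau).
    { intros a b c tau mu. destruct (Lip a b c tau mu) as [C [HC H]].
      split; [|split];
      [ apply (lipschitz_at_continuous (fun t => Y1 a b c t mu T) _ C)
      | apply (lipschitz_at_continuous (fun t => Y2 a b c t mu T) _ C)
      | apply (lipschitz_at_continuous (fun t => Y3 a b c t mu T) _ C) ];
      intros s Hs; apply H; rewrite ?Rminus_diag, ?Rabs_R0; pose proof (Rabs_pos (s - tau)); lra. }
    intros mu tau. unfold D. apply filterlim_det3; unfold Rminus;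
      try match goal with |- filterlim (fun t => _ + _) _ _ =>
        apply filterlim_Rplus; [|apply filterlim_const] end; apply C.
  - assert (C : forall a b c tau mu,
      continuous (fun t => Y1 a b c tau t T) mu /\
      continuous (fun t => Y2 a b c tau t T) mu /\
      continuous (fun t => Y3 a b c tau t T) mu).
    { intros a b c tau mu. destruct (Lip a b c tau mu) as [C [HC H]].
      split; [|split];
      [ apply (lipschitz_at_continuous (fun t => Y1 a b c tau t T) _ C)
      | apply (lipschitz_at_continuous (fun t => Y2 a b c tau t T) _ C)
      | apply (lipschitz_at_continuous (fun t => Y3 a b c tau t T) _ C) ];
      intros s Hs; apply H; rewrite ?Rminus_diag, ?Rabs_R0; pose proof (Rabs_pos (s - mu)); lra. }
    intros tau mu. unfold D. apply filterlim_det3; unfold Rminus;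
      try match goal with |- filterlim (fun t => _ + _) _ _ =>
        apply filterlim_Rplus; [|apply filterlim_const] end; apply C.
Qed.

(** * Sign of the determinant for large [mu] *)

Lemma is_derive_locally_const (g : R -> R) (x d k a b : R) :
  is_derive g x d -> (forall t, a < t < b -> g t = k) -> a < x < b -> d = 0.
Proof.
  intros H E Hx.
  apply is_derive_unique in H. rewrite <- H.
  rewrite (Derive_ext_loc g (fun _ => k)); [apply Derive_const|].
  apply (locally_interval _ x a b); simpl; try lra.
  intros t Ht1 Ht2. apply E. simpl in *. lra.
Qed.

Lemma continuous_zero_left (g : R -> R) (T : R) :
  continuous g 0 -> 0 < T -> (forall t, 0 < t < T -> g t = 0) -> g 0 = 0.
Proof.
  intros C HT H.
  destruct (Req_dec (g 0) 0) as [|N]; [assumption|exfalso].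
  apply Rabs_pos_lt in N.
  destruct (proj1 (filterlim_locally_R g (g 0)) C (mkposreal _ N)) as [d Hd].
  pose proof (cond_pos d) as Hdp.
  set (t := Rmin (d / 2) (T / 2)).
  assert (Ht : 0 < t) by (apply Rmin_glb_lt; lra).
  assert (t <= d / 2) by apply Rmin_l. assert (t <= T / 2) by apply Rmin_r.
  specialize (Hd t). simpl in Hd. rewrite (H t) in Hd by lra.
  assert (Hb : ball 0 d t).
  { change (Rabs (t - 0) < d). rewrite Rabs_pos_eq; lra. }
  specialize (Hd Hb). rewrite Rminus_0_l, Rabs_Ropp in Hd. lra.
Qed.

(** A periodic solution conserves [E = y3 y1 - y2^2/2 - tau q y1^2/2] over a period, while
    [E' = - (mu + tau q'/2) y1^2]. *)
Lemma lin_sol_periodic_zero (q q' : R -> R) (Q1 tau mu T : R) (y1 y2 y3 : R -> R) :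
  (forall x, is_derive q x (q' x)) -> (forall x, Rabs (q' x) <= Q1) ->
  q T = q 0 -> 0 <= tau <= 1 -> Q1 < 2 * mu -> 0 < T ->
  lin_sol (fun x => tau * q x) mu y1 y2 y3 ->
  y1 T = y1 0 -> y2 T = y2 0 -> y3 T = y3 0 ->
  y1 0 = 0 /\ y2 0 = 0 /\ y3 0 = 0.
Proof.
  intros Hq bq PT Ht Hmu HT [Y1 [Y2 Y3]] P1 P2 P3.
  set (E := fun x => y3 x * y1 x - y2 x ^ 2 / 2 - tau * q x * y1 x ^ 2 / 2).
  assert (HE : forall x, is_derive E x (- (mu + tau * q' x / 2) * y1 x ^ 2)).
  { intros x. unfold E. solve_derive. field. }
  assert (pos : forall x, 0 < mu + tau * q' x / 2).
  { intros x. specialize (bq x).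
    assert (Rabs (tau * q' x) <= 1 * Q1).
    { rewrite Rabs_mult. apply Rmult_le_compat; auto using Rabs_pos.
      apply Rabs_le; lra. }
    pose proof (Rle_abs (- (tau * q' x))). rewrite Rabs_Ropp in *. lra. }
  assert (neg : forall x, - (mu + tau * q' x / 2) * y1 x ^ 2 <= 0).
  { intros x. pose proof (pos x). pose proof (pow2_ge_0 (y1 x)).
    assert (0 <= (mu + tau * q' x / 2) * y1 x ^ 2) by (apply Rmult_le_pos; lra). lra. }
  assert (EE : E T = E 0) by (unfold E; now rewrite P1, P2, P3, PT).
  assert (Ec : forall x, 0 < x < T -> E x = E 0).
  { intros x Hx.
    assert (E x <= E 0) by (apply (is_derive_decr E _ 0 x HE); auto; lra).
    assert (E T <= E x) by (apply (is_derive_decr E _ x T HE); auto; lra). lra. }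
  assert (Z1 : forall x, 0 < x < T -> y1 x = 0).
  { intros x Hx.
    pose proof (is_derive_locally_const E x _ (E 0) 0 T (HE x) Ec Hx) as Z.
    apply Rmult_integral in Z. destruct Z as [Z|Z].
    - pose proof (pos x). lra.
    - apply Rsqr_0_uniq. now rewrite Rsqr_pow2. }
  assert (Z2 : forall x, 0 < x < T -> y2 x = 0).
  { intros x Hx. exact (is_derive_locally_const y1 x _ 0 0 T (Y1 x) Z1 Hx). }
  assert (Z3 : forall x, 0 < x < T -> y3 x = 0).
  { intros x Hx. pose proof (is_derive_locally_const y2 x _ 0 0 T (Y2 x) Z2 Hx) as Z.
    rewrite (Z1 x Hx) in Z. lra. }
  split; [|split];
    [ apply (continuous_zero_left y1 T) | apply (continuous_zero_left y2 T)
    | apply (continuous_zero_left y3 T) ]; auto; eapply is_derive_continuous; auto.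
Qed.

(** For [q = 0] the system is [y''' = - 8 k^3 y], with characteristic roots [-2 k] and [k + i w],
    [k - i w]. The increments have determinant [(exp(-2 k T) - 1) |exp((k + i w) T) - 1|^2] times
    the initial determinant [12 k^2 w], and only the first factor is negative. *)
Lemma det3_const_coef_neg (k T w : R) :
  0 < k -> 0 < T -> 0 < w -> w ^ 2 = 3 * k ^ 2 ->
  exists y1 y2 y3 z1 z2 z3 w1 w2 w3,
  lin_sol (fun _ => 0) (8 * k ^ 3) y1 y2 y3 /\
  lin_sol (fun _ => 0) (8 * k ^ 3) z1 z2 z3 /\
  lin_sol (fun _ => 0) (8 * k ^ 3) w1 w2 w3 /\
  0 < det3 (y1 0) (y2 0) (y3 0) (z1 0) (z2 0) (z3 0) (w1 0) (w2 0) (w3 0) /\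
  det3 (y1 T - y1 0) (y2 T - y2 0) (y3 T - y3 0)
       (z1 T - z1 0) (z2 T - z2 0) (z3 T - z3 0)
       (w1 T - w1 0) (w2 T - w2 0) (w3 T - w3 0) < 0.
Proof.
  intros Hk HT Hw Ew.
  exists (fun x => exp (-2 * k * x)), (fun x => -2 * k * exp (-2 * k * x)),
    (fun x => 4 * k ^ 2 * exp (-2 * k * x)).
  exists (fun x => exp (k * x) * cos (w * x)),
    (fun x => exp (k * x) * (k * cos (w * x) - w * sin (w * x))),
    (fun x => exp (k * x) * (-2 * k ^ 2 * cos (w * x) - 2 * k * w * sin (w * x))).
  exists (fun x => exp (k * x) * sin (w * x)),
    (fun x => exp (k * x) * (k * sin (w * x) + w * cos (w * x))),
    (fun x => exp (k * x) * (-2 * k ^ 2 * sin (w * x) + 2 * k * w * cos (w * x))).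
  assert (Ew' : w * w = 3 * k ^ 2) by (rewrite <- Ew; ring).
  refine (conj _ (conj _ (conj _ (conj _ _)))).
  - split; [|split]; intros x; auto_derive; auto; ring.
  - split; [|split]; intros x; auto_derive; auto; ring [Ew].
  - split; [|split]; intros x; auto_derive; auto; ring [Ew].
  - rewrite !Rmult_0_r, exp_0, cos_0, sin_0.
    replace (det3 _ _ _ _ _ _ _ _ _) with (12 * k ^ 2 * w) by (unfold det3; ring).
    apply Rmult_lt_0_compat; [|assumption].
    apply Rmult_lt_0_compat; [lra|apply pow_lt; assumption].
  - rewrite !Rmult_0_r, exp_0, cos_0, sin_0.
    assert (He : exp (-2 * k * T) < 1).
    { rewrite <- exp_0. apply exp_increasing.
      assert (0 < k * T) by (apply Rmult_lt_0_compat; assumption). lra. }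
    assert (Hp : 1 < exp (k * T)).
    { rewrite <- exp_0. apply exp_increasing, Rmult_lt_0_compat; assumption. }
    pose proof (sin2_cos2 (w * T)) as SC. unfold Rsqr in SC.
    set (e := exp (-2 * k * T)) in *. set (g := exp (k * T)) in *.
    set (s := sin (w * T)) in *. set (c := cos (w * T)) in *.
    replace (det3 _ _ _ _ _ _ _ _ _)
      with ((e - 1) * ((g * c - 1) ^ 2 + (g * s) ^ 2) * (12 * k ^ 2 * w))
      by (unfold det3; ring).
    (* The complex exponential has modulus [g > 1], hence differs from 1. *)
    assert (P : 0 < (g * c - 1) ^ 2 + (g * s) ^ 2).
    { pose proof (pow2_ge_0 (g * c - 1)). pose proof (pow2_ge_0 (g * s)).
      destruct (Req_dec (g * s) 0) as [Z|Z].
      - assert (s0 : s = 0) by (apply Rmult_integral in Z; lra).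
        assert (g * c - 1 <> 0).
        { intros Z'. assert (gc : g * c = 1) by lra. rewrite s0 in SC.
          assert (cc : c * c = 1) by lra.
          assert (g * g = 1) by (replace (g * g) with ((g * c) * (g * c)) by (transitivity (g * g * (c * c)); [ring|rewrite cc; ring]); rewrite gc; ring).
          nra. }
        assert (0 < (g * c - 1) ^ 2) by (rewrite <- Rsqr_pow2; now apply Rlt_0_sqr). lra.
      - assert (0 < (g * s) ^ 2) by (rewrite <- Rsqr_pow2; now apply Rlt_0_sqr). lra. }
    assert (0 < 12 * k ^ 2 * w).
    { apply Rmult_lt_0_compat; [|assumption].
      apply Rmult_lt_0_compat; [lra|apply pow_lt; assumption]. }
    assert (0 < (1 - e) * ((g * c - 1) ^ 2 + (g * s) ^ 2) * (12 * k ^ 2 * w))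
      by (repeat apply Rmult_lt_0_compat; lra).
    lra.
Qed.

Lemma continuous_root (g : R -> R) (a b : R) :
  (forall t, continuous g t) -> a <= b -> g a * g b <= 0 ->
  exists t, a <= t <= b /\ g t = 0.
Proof.
  intros C Hab Hg.
  destruct (IVT_gen g a b 0) as [t [Ht E]].
  - intros t. apply continuity_pt_filterlim, C.
  - unfold Rmin, Rmax. destruct (Rle_dec (g a) (g b)); nra.
  - exists t. rewrite Rmin_left, Rmax_right in Ht by assumption. auto.
Qed.

(** A homotopy to constant coefficients keeps the sign of the determinant for large [mu]. *)
Lemma floquet_root (q q' : R -> R) (Q Q1 T : R) :
  (forall x, is_derive q x (q' x)) -> (forall x, Rabs (q x) <= Q) ->
  (forall x, Rabs (q' x) <= Q1) -> q T = q 0 -> 0 < T ->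
  (exists mu0, 0 < mu0 /\ forall mu, 0 < mu < mu0 ->
    exists y1 y2 y3 z1 z2 z3 w1 w2 w3,
    lin_sol q mu y1 y2 y3 /\ lin_sol q mu z1 z2 z3 /\ lin_sol q mu w1 w2 w3 /\
    det3 (y1 T - y1 0) (y2 T - y2 0) (y3 T - y3 0)
         (z1 T - z1 0) (z2 T - z2 0) (z3 T - z3 0)
         (w1 T - w1 0) (w2 T - w2 0) (w3 T - w3 0) *
    det3 (y1 0) (y2 0) (y3 0) (z1 0) (z2 0) (z3 0) (w1 0) (w2 0) (w3 0) > 0) ->
  exists mu y1 y2 y3, 0 < mu /\ lin_sol q mu y1 y2 y3 /\
    y1 T = y1 0 /\ y2 T = y2 0 /\ y3 T = y3 0 /\
    ~ (y1 0 = 0 /\ y2 0 = 0 /\ y3 0 = 0).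
Proof.
  intros Hq bq bq' PT HT [mu0 [Hmu0 Small]].
  assert (L1 : forall mu y1 y2 y3,
    lin_sol (fun x => 1 * q x) mu y1 y2 y3 <-> lin_sol q mu y1 y2 y3).
  { intros mu y1 y2 y3. unfold lin_sol.
    split; intros [A [B D]]; split; auto; split; auto; intros x; specialize (B x);
      rewrite Rmult_1_l in *; assumption. }
  assert (L0 : forall mu y1 y2 y3,
    lin_sol (fun _ => 0) mu y1 y2 y3 -> lin_sol (fun x => 0 * q x) mu y1 y2 y3).
  { intros mu y1 y2 y3 [A [B D]]; split; auto; split; auto; intros x; specialize (B x).
    replace (0 * q x) with 0 by ring. assumption. }
  destruct (floquet_det q Q T) as [D [Hdet [Hker [Ctau Cmu]]]]; auto; try lra.
  { intros x. exact (is_derive_continuous q x _ (Hq x)). }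
  assert (HQ1 : 0 <= Q1) by (eapply Rle_trans; [apply Rabs_pos|apply (bq' 0)]).
  (* Since [k >= 1], the value [mu1 = 8 k^3 >= 8 k] satisfies [Q1 < 2 mu1], as the energy identity
     requires, and lies beyond [mu0]; the cube is the form for which the constant-coefficient roots
     are explicit. *)
  set (k := 1 + Q1 + mu0).
  assert (Hk : 1 <= k) by (unfold k; lra).
  assert (Hk2 : 1 <= k ^ 2) by (rewrite <- (pow1 2); apply pow_incr; lra).
  set (mu1 := 8 * k ^ 3).
  assert (Hmu1 : 8 * k <= mu1).
  { unfold mu1. replace (k ^ 3) with (k * k ^ 2) by ring.
    assert (k * 1 <= k * k ^ 2) by (apply Rmult_le_compat_l; lra). lra. }
  assert (Hmu1' : Q1 < 2 * mu1) by (unfold k in *; lra).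
  assert (D0 : D 0 mu1 < 0).
  { destruct (det3_const_coef_neg k T (sqrt 3 * k))
      as [y1 [y2 [y3 [z1 [z2 [z3 [w1 [w2 [w3 [Y [Z [W [P N]]]]]]]]]]]]]; auto; try lra.
    - apply Rmult_lt_0_compat; [apply sqrt_lt_R0|]; lra.
    - rewrite Rpow_mult_distr, <- (Rsqr_pow2 (sqrt 3)), Rsqr_sqrt by lra. ring.
    - rewrite (Hdet 0 mu1) in N by auto.
      destruct (Rlt_dec (D 0 mu1) 0); [assumption|exfalso].
      assert (0 <= D 0 mu1 * det3 (y1 0) (y2 0) (y3 0) (z1 0) (z2 0) (z3 0) (w1 0) (w2 0) (w3 0))
        by (apply Rmult_le_pos; lra).
      lra. }
  assert (Dn : forall tau, 0 <= tau <= 1 -> D tau mu1 <> 0).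
  { intros tau Htau Z. destruct (Hker tau mu1 Z) as [y1 [y2 [y3 [S [E1 [E2 [E3 N]]]]]]].
    apply N. exact (lin_sol_periodic_zero q q' Q1 tau mu1 T y1 y2 y3 Hq bq' PT Htau Hmu1' HT S E1 E2 E3). }
  assert (D1 : D 1 mu1 < 0).
  { destruct (Rlt_dec (D 1 mu1) 0); [assumption|exfalso].
    destruct (continuous_root (fun tau => D tau mu1) 0 1) as [t [Ht Z]]; auto; try lra.
    - nra.
    - now apply (Dn t). }
  assert (Hm : 0 < mu0 / 2 < mu0) by lra.
  assert (Ds : 0 < D 1 (mu0 / 2)).
  { destruct (Small _ Hm) as [y1 [y2 [y3 [z1 [z2 [z3 [w1 [w2 [w3 [Y [Z [W P]]]]]]]]]]]].
    apply L1 in Y; apply L1 in Z; apply L1 in W.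
    rewrite (Hdet 1 (mu0 / 2)) in P by assumption.
    (* The product of the two determinants is [D d^2], so its sign is that of [D] whatever the
       orientation of the initial data. *)
    set (d := det3 (y1 0) (y2 0) (y3 0) (z1 0) (z2 0) (z3 0) (w1 0) (w2 0) (w3 0)) in P.
    rewrite Rmult_assoc in P.
    assert (0 <= d * d) by apply Rle_0_sqr.
    destruct (Rlt_dec 0 (D 1 (mu0 / 2))); [assumption|exfalso].
    assert (0 <= - D 1 (mu0 / 2) * (d * d)) by (apply Rmult_le_pos; lra). lra. }
  destruct (continuous_root (fun mu => D 1 mu) (mu0 / 2) mu1) as [mu [Hmu Z]]; auto.
  - unfold k in *; lra.
  - nra.
  - destruct (Hker 1 mu Z) as [y1 [y2 [y3 [S P]]]].
    exists mu, y1, y2, y3. split; [lra|]. split; [now apply L1|assumption].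
Qed.

(** * The profile *)

Lemma is_derive_pos_sign (g : R -> R) (x d : R) : is_derive g x d -> 0 < d ->
  exists delta, 0 < delta /\
    (forall t, x < t < x + delta -> g x < g t) /\
    (forall t, x - delta < t < x -> g t < g x).
Proof.
  intros H Hd. apply is_derive_Reals in H.
  destruct (H d Hd) as [[delta Hdelta] Q]. simpl in Q.
  assert (S : forall t, t <> x -> Rabs (t - x) < delta -> 0 < (g t - g x) / (t - x)).
  { intros t N B. specialize (Q (t - x) ltac:(lra) B).
    replace (x + (t - x)) with t in Q by ring.
    pose proof (Rle_abs (- ((g t - g x) / (t - x) - d))) as A. rewrite Rabs_Ropp in A. lra. }
  exists delta. split; [assumption|]. split; intros t Ht.
  - specialize (S t ltac:(lra) ltac:(rewrite Rabs_pos_eq; lra)).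
    assert (0 < (g t - g x) / (t - x) * (t - x)) by (apply Rmult_lt_0_compat; lra).
    replace ((g t - g x) / (t - x) * (t - x)) with (g t - g x) in H0 by (field; lra). lra.
  - specialize (S t ltac:(lra) ltac:(rewrite Rabs_left; lra)).
    assert (0 < (g t - g x) / (t - x) * (x - t)) by (apply Rmult_lt_0_compat; lra).
    replace ((g t - g x) / (t - x) * (x - t)) with (g x - g t) in H0 by (field; lra). lra.
Qed.

Lemma continuous_value (g : R -> R) (x y k : R) :
  (forall t, continuous g t) -> g x <= k <= g y -> exists t, g t = k.
Proof.
  intros C Hk.
  destruct (IVT_gen g x y k) as [t [_ E]].
  - intros t. apply continuity_pt_filterlim, C.
  - unfold Rmin, Rmax. destruct (Rle_dec (g x) (g y)); lra.
  - now exists t.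
Qed.

Lemma is_derive_incr_strict (g dg : R -> R) (x y : R) :
  (forall t, is_derive g t (dg t)) -> (forall t, x < t < y -> 0 < dg t) ->
  x < y -> g x < g y.
Proof.
  intros Hg Hd Hxy.
  destruct (MVT_cor2 g dg x y Hxy) as [m [Em Hm]].
  - intros t _. apply is_derive_Reals, Hg.
  - specialize (Hd m Hm).
    assert (0 < dg m * (y - x)) by (apply Rmult_lt_0_compat; lra). lra.
Qed.

(** [h] is the supremum of the lengths of intervals [(0, x)] on which [g] is positive. The separate
    [delta] allows [g 0 = 0], as happens for the velocity of an orbit released at rest. *)
Lemma first_zero (g : R -> R) (delta xi : R) :
  (forall t, continuous g t) -> 0 < delta -> (forall t, 0 < t < delta -> 0 < g t) ->
  0 < xi -> g xi = 0 ->
  exists h, 0 < h /\ g h = 0 /\ forall t, 0 < t < h -> 0 < g t.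
Proof.
  intros C Hd Hg Hxi Z.
  set (A := fun x => forall t, 0 < t < x -> 0 < g t).
  destruct (completeness A) as [h [Hub Hlub]].
  - exists xi. intros x Hx. destruct (Rle_dec x xi); [assumption|].
    specialize (Hx xi ltac:(lra)). lra.
  - exists delta. exact Hg.
  - assert (Hdh : delta <= h) by (apply Hub; exact Hg).
    assert (P : forall t, 0 < t < h -> 0 < g t).
    { intros t Ht. destruct (Rlt_dec 0 (g t)); [assumption|exfalso].
      assert (h <= t); [|lra]. apply Hlub. intros x Hx.
      destruct (Rle_dec x t); [assumption|]. specialize (Hx t ltac:(lra)). lra. }
    exists h. split; [lra|]. split; [|assumption].
    destruct (Req_dec (g h) 0) as [|N]; [assumption|exfalso].
    pose proof (Rabs_pos_lt _ N) as Np.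
    destruct (proj1 (filterlim_locally_R g (g h)) (C h) (mkposreal _ Np)) as [e He].
    pose proof (cond_pos e) as Hep. simpl in He.
    assert (S : forall t, Rabs (t - h) < e -> Rabs (g t - g h) < Rabs (g h)) by exact He.
    destruct (Rlt_dec 0 (g h)) as [Hp|Hn].
    + assert (h + e / 2 <= h); [|lra]. apply Hub. intros t Ht.
      destruct (Rlt_dec t h); [apply P; lra|].
      specialize (S t ltac:(rewrite Rabs_pos_eq; lra)).
      rewrite (Rabs_pos_eq (g h)) in S by lra. apply Rabs_def2 in S. lra.
    + set (t := Rmax (h / 2) (h - e / 2)).
      assert (h / 2 <= t) by apply Rmax_l. assert (h - e / 2 <= t) by apply Rmax_r.
      assert (t < h) by (apply Rmax_lub_lt; lra).
      specialize (S t ltac:(rewrite Rabs_left; lra)).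
      rewrite (Rabs_left (g h)) in S by lra. apply Rabs_def2 in S.
      specialize (P t ltac:(lra)). lra.
Qed.

Lemma C1_lipschitz (g dg : R -> R) (x y : R) :
  (forall t, is_derive g t (dg t)) -> (forall t, continuous dg t) ->
  exists L, 0 <= L /\ forall s t, x <= s <= y -> x <= t <= y ->
    Rabs (g s - g t) <= L * Rabs (s - t).
Proof.
  intros Hg C. destruct (continuous_bounded dg x y C) as [L [HL B]].
  exists L. split; [assumption|]. intros s t Hs Ht.
  destruct (MVT_gen g t s dg) as [m [Hm E]].
  - intros; apply Hg.
  - intros u _. exact (is_derive_continuity_pt g u _ (Hg u)).
  - rewrite E, Rabs_mult. apply Rmult_le_compat_r; [apply Rabs_pos|]. apply B.
    unfold Rmin, Rmax in Hm. destruct (Rle_dec t s); lra.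
Qed.

(** The profile equation as a first-order system. The velocity is an argument rather than
    [Derive w], so that reflected and shifted orbits carry theirs explicitly. *)
Definition newton (f : R -> R) (a c : R) (w w' : R -> R) : Prop :=
  (forall x, is_derive w x (w' x)) /\
  (forall x, is_derive w' x (a + c * w x - f (w x))).

(** [f] is Lipschitz on compact intervals only, hence the common range [[l, r]]. The third component
    of the Groenwall estimate is filled with 0. *)
Lemma newton_unique (f : R -> R) (a c l r : R) (w w' z z' : R -> R) :
  is_C2 f -> newton f a c w w' -> newton f a c z z' ->
  (forall x, l <= w x <= r) -> (forall x, l <= z x <= r) ->
  w 0 = z 0 -> w' 0 = z' 0 -> forall x, w x = z x /\ w' x = z' x.
Proof.
  intros [Df [Df' _]] [W1 W2] [Z1 Z2] Bw Bz I1 I2 x.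
  destruct (C1_lipschitz f (Derive f) l r) as [L [HL Lip]].
  { intros t. apply Derive_correct, Df. }
  { intros t. apply (ex_derive_continuous (V := R_NormedModule)), Df'. }
  pose proof (Rabs_pos c) as Hc.
  destruct (gronwall3_zero (1 + Rabs c + L)
    (fun x => w x - z x) (fun x => w' x - z' x) (fun _ => 0)
    (fun x => w' x - z' x) (fun x => c * (w x - z x) - (f (w x) - f (z x)))
    (fun _ => 0)) with (x := x) as [A [B _]]; try lra.
  - intros t. solve_derive.
  - intros t. solve_derive.
  - intros t. auto_derive; auto.
  - intros t. rewrite !Rabs_R0, Rplus_0_r.
    specialize (Lip (w t) (z t) (Bw t) (Bz t)).
    set (A := Rabs (w t - z t)) in *. set (B := Rabs (w' t - z' t)).
    assert (0 <= A) by apply Rabs_pos. assert (0 <= B) by apply Rabs_pos.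
    assert (0 <= (Rabs c + L) * (A + B)) by (apply Rmult_le_pos; lra).
    assert (0 <= (Rabs c + L) * B) by (apply Rmult_le_pos; lra).
    repeat split; try lra.
    eapply Rle_trans; [apply Rabs_triang|]. rewrite Rabs_Ropp, Rabs_mult. fold A. lra.
Qed.

Lemma newton_reflect (f : R -> R) (a c m : R) (w w' : R -> R) :
  newton f a c w w' -> newton f a c (fun x => w (m - x)) (fun x => - w' (m - x)).
Proof.
  intros [W1 W2]. split; intros x; solve_derive; unfold Rminus; ring.
Qed.

Lemma newton_shift (f : R -> R) (a c m : R) (w w' : R -> R) :
  newton f a c w w' -> newton f a c (fun x => w (m + x)) (fun x => w' (m + x)).
Proof. intros [W1 W2]. split; intros x; solve_derive. Qed.

Lemma Veff_derive (f F : R -> R) (a c v : R) : (forall v, is_derive F v (f v)) ->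
  is_derive (Veff F a c) v (f v - c * v - a).
Proof. intros hF. unfold Veff. solve_derive. field. Qed.

Section Profile.

Variables (f F : R -> R) (a E c l r : R) (w : R -> R).
Hypothesis (hf : is_C2 f) (hF : forall v, is_derive F v (f v)).
Hypothesis (hwell : is_well F (a, E, c) l r) (hprof : is_profile f F (a, E, c) l w).

Let V := Veff F a c.

(** The expressions are [- V'] at the two turning points. They are nonzero because the roots are
    simple, and a wrong sign would make [V] exceed [E] just inside the well. The force thus points
    inwards; its value at [l] is the positive acceleration by which later formulas divide. *)
Lemma well_slope : 0 < a + c * l - f l /\ a + c * r - f r < 0.
Proof.
  destruct hwell as [_ [Hlr [El [Dl [Er [Dr Hin]]]]]].
  unfold pa, pE, pc in El, Dl, Er, Dr, Hin; simpl in El, Dl, Er, Dr, Hin.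
  fold V in El, Dl, Er, Dr, Hin.
  pose proof (fun v => Veff_derive f F a c v hF) as HV. fold V in HV.
  rewrite (is_derive_unique _ _ _ (HV l)) in Dl.
  rewrite (is_derive_unique _ _ _ (HV r)) in Dr.
  split.
  - destruct (Rlt_dec 0 (a + c * l - f l)); [assumption|exfalso].
    destruct (is_derive_pos_sign V l _ (HV l) ltac:(lra)) as [d [Hd [P _]]].
    set (t := Rmin (l + d / 2) ((l + r) / 2)).
    assert (t <= l + d / 2) by apply Rmin_l. assert (t <= (l + r) / 2) by apply Rmin_r.
    assert (l < t) by (apply Rmin_glb_lt; lra).
    specialize (P t ltac:(lra)). specialize (Hin t ltac:(lra)). lra.
  - destruct (Rlt_dec (a + c * r - f r) 0); [assumption|exfalso].
    assert (HV' : is_derive (fun v => - V v) r (- (f r - c * r - a)))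
      by (apply (is_derive_opp (V := R_NormedModule)), HV).
    destruct (is_derive_pos_sign _ r _ HV' ltac:(lra)) as [d [Hd [_ P]]].
    set (t := Rmax (r - d / 2) ((l + r) / 2)).
    assert (r - d / 2 <= t) by apply Rmax_l. assert ((l + r) / 2 <= t) by apply Rmax_r.
    assert (t < r) by (apply Rmax_lub_lt; lra).
    specialize (P t ltac:(lra)). specialize (Hin t ltac:(lra)). lra.
Qed.

Lemma profile_newton : newton f a c w (Derive w).
Proof.
  destruct hprof as [_ [_ [D1 [_ [D2 [Eq _]]]]]]. unfold pa, pc in Eq; simpl in Eq.
  split; intros x.
  - apply Derive_correct, D1.
  - replace (a + c * w x - f (w x)) with (Derive (Derive w) x) by (specialize (Eq x); lra).
    apply Derive_correct, D2.
Qed.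

Lemma profile_energy x : Derive w x ^ 2 = 2 * (E - V (w x)).
Proof.
  destruct hprof as [_ [_ [_ [En _]]]]. specialize (En x).
  unfold pa, pE, pc in En; simpl in En. fold V in En. simpl. lra.
Qed.

Lemma profile_start : w 0 = l /\ Derive w 0 = 0.
Proof. destruct hprof as [_ [_ [_ [_ [_ [_ H]]]]]]. exact H. Qed.

Lemma profile_continuous x : continuous w x.
Proof. exact (is_derive_continuous _ _ _ (proj1 profile_newton x)). Qed.

(** To leave [[l, r]] the orbit would have to take values just beyond a turning point. There
    [V > E], since the root is simple, against the energy equation. *)
Lemma profile_range x : l <= w x <= r.
Proof.
  destruct hwell as [_ [Hlr [El [_ [Er _]]]]].
  unfold pa, pE, pc in El, Er; simpl in El, Er. fold V in El, Er.
  pose proof (fun v => Veff_derive f F a c v hF) as HV. fold V in HV.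
  destruct well_slope as [Sl Sr]. destruct profile_start as [I0 _].
  assert (B : forall v t, w t = v -> V v <= E).
  { intros v t <-. pose proof (profile_energy t). pose proof (pow2_ge_0 (Derive w t)). lra. }
  split.
  - destruct (Rle_dec l (w x)); [assumption|exfalso].
    assert (HV' : is_derive (fun v => - V v) l (- (f l - c * l - a)))
      by (apply (is_derive_opp (V := R_NormedModule)), HV).
    destruct (is_derive_pos_sign _ l _ HV' ltac:(lra)) as [d [Hd [_ P]]].
    set (v := Rmax (l - d / 2) (w x)).
    assert (l - d / 2 <= v) by apply Rmax_l. assert (w x <= v) by apply Rmax_r.
    assert (v < l) by (apply Rmax_lub_lt; lra).
    destruct (continuous_value w x 0 v profile_continuous) as [t Ht]; [lra|].
    specialize (B v t Ht). specialize (P v ltac:(lra)). lra.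
  - destruct (Rle_dec (w x) r); [assumption|exfalso].
    destruct (is_derive_pos_sign V r _ (HV r) ltac:(lra)) as [d [Hd [P _]]].
    set (v := Rmin (r + d / 2) (w x)).
    assert (v <= r + d / 2) by apply Rmin_l. assert (v <= w x) by apply Rmin_r.
    assert (r < v) by (apply Rmin_glb_lt; lra).
    destruct (continuous_value w 0 x v profile_continuous) as [t Ht]; [lra|].
    specialize (B v t Ht). specialize (P v ltac:(lra)). lra.
Qed.

(** The orbit leaves [l] with positive acceleration, and Rolle's theorem over any period gives a
    later instant of rest. At the first such instant [V = E]; as [w] has increased from [l] and
    [V < E] inside the well, it has reached [r]. *)
Lemma profile_half_period : exists h, 0 < h /\ w h = r /\ Derive w h = 0 /\
  forall t, 0 < t < h -> 0 < Derive w t.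
Proof.
  destruct profile_newton as [W1 W2]. destruct profile_start as [I0 I1].
  destruct well_slope as [Sl _].
  pose proof (W2 0) as D0. rewrite I0 in D0.
  destruct (is_derive_pos_sign _ 0 _ D0 Sl) as [d [Hd [P _]]].
  rewrite I1 in P.
  destruct hprof as [[S [HS Per]] _].
  assert (exists xi, 0 < xi /\ Derive w xi = 0) as [xi [Hxi Z]].
  { destruct (MVT_cor2 w (Derive w) 0 S HS) as [m [Em Hm]].
    - intros t _. apply is_derive_Reals, W1.
    - exists m. split; [lra|]. specialize (Per 0). rewrite Rplus_0_l in Per.
      assert (Z : Derive w m * (S - 0) = 0) by lra.
      apply Rmult_integral in Z. destruct Z; [assumption|lra]. }
  destruct (first_zero (Derive w) d xi) as [h [Hh [Zh Ph]]]; auto.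
  { intros t. exact (is_derive_continuous _ _ _ (W2 t)). }
  { intros t Ht. apply P. lra. }
  exists h. split; [assumption|]. split; [|split; assumption].
  destruct (profile_range h) as [Bl Br].
  destruct (Rle_lt_or_eq_dec _ _ Br) as [Hlt|]; [exfalso|assumption].
  destruct hwell as [_ [_ [_ [_ [_ [_ Hin]]]]]].
  unfold pa, pE, pc in Hin; simpl in Hin. fold V in Hin.
  pose proof (profile_energy h) as En. rewrite Zh in En.
  assert (w 0 < w h) by (now apply (is_derive_incr_strict w (Derive w))).
  specialize (Hin (w h) ltac:(lra)). lra.
Qed.

(** Newton's equation is reversible: reflecting time about an instant of rest gives an orbit with
    the same data there. *)
Lemma profile_symmetric (m : R) : Derive w m = 0 ->
  forall x, w (m + x) = w (m - x) /\ Derive w (m + x) = - Derive w (m - x).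
Proof.
  intros Z.
  apply (newton_unique f a c l r (fun x => w (m + x)) (fun x => Derive w (m + x))
    (fun x => w (m - x)) (fun x => - Derive w (m - x))); auto.
  - apply newton_shift, profile_newton.
  - apply newton_reflect, profile_newton.
  - intros x; apply profile_range.
  - intros x; apply profile_range.
  - f_equal; ring.
  - rewrite Rplus_0_r, Rminus_0_r, Z. ring.
Qed.

(** The reflections about the rest instants 0 and [h] compose to the translation by [2 h]. This
    identifies twice the travel time from [l] to [r] with a period of [w]. *)
Lemma profile_periodic (h : R) : Derive w h = 0 ->
  forall x, w (x + 2 * h) = w x /\ Derive w (x + 2 * h) = Derive w x.
Proof.
  intros Z x.
  destruct (profile_symmetric h Z (h + x)) as [A A'].
  destruct (profile_symmetric 0 (proj2 profile_start) x) as [B B'].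
  replace (h + (h + x)) with (x + 2 * h) in * by ring.
  replace (h - (h + x)) with (0 - x) in * by ring.
  rewrite A, A', <- B, Rplus_0_l in *. split; [reflexivity|lra].
Qed.

(** Substituting [v = w x] turns the integrand into [1]. *)
Lemma profile_time (h : R) : 0 < h -> w h = r ->
  (forall t, 0 < t < h -> 0 < Derive w t) ->
  is_RInt_gen (fun v => / sqrt (2 * (E - Veff F a c v))) (at_right l) (at_left r) h.
Proof.
  intros Hh Eh Ph. fold V.
  destruct profile_newton as [W1 W2]. destruct profile_start as [I0 _].
  assert (Inc : forall x y, 0 <= x -> x < y -> y <= h -> w x < w y).
  { intros x y H0 Hxy Hy. apply (is_derive_incr_strict w (Derive w)); auto.
    intros t Ht. apply Ph. lra. }
  assert (Val : forall x y v, 0 <= x -> x < y -> y <= h -> w x < v < w y ->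
    exists t, x < t < y /\ w t = v).
  { intros x y v H0 Hxy Hy Hv.
    destruct (IVT_gen w x y v) as [t [Ht Et]].
    - intros t. exact (is_derive_continuity_pt w t _ (W1 t)).
    - rewrite Rmin_left, Rmax_right; lra.
    - rewrite Rmin_left, Rmax_right in Ht by lra.
      exists t. split; [|assumption].
      split.
      + destruct (Req_dec t x) as [->|]; lra.
      + destruct (Req_dec t y) as [->|]; lra. }
  destruct hwell as [_ [_ [_ [_ [_ [_ Hin]]]]]].
  unfold pa, pE, pc in Hin; simpl in Hin. fold V in Hin.
  set (g := fun v => / sqrt (2 * (E - V v))).
  assert (Cg : forall v, l < v < r -> continuous g v).
  { intros v Hv. apply (ex_derive_continuous (V := R_NormedModule)).
    specialize (Hin v Hv).
    assert (HV : ex_derive V v) by (eexists; apply (Veff_derive f F a c v hF)).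
    unfold g. auto_derive. repeat split; auto; [lra|].
    apply Rgt_not_eq, sqrt_lt_R0. lra. }
  assert (Int : forall x y, 0 < x -> x < y -> y < h -> is_RInt g (w x) (w y) (y - x)).
  { intros x y Hx Hxy Hy.
    assert (In : forall t, x <= t <= y -> l < w t < r).
    { intros t Ht. rewrite <- I0, <- Eh. split; apply Inc; lra. }
    assert (EqI : is_RInt (fun t => scal (Derive w t) (g (w t))) x y (RInt g (w x) (w y))).
    { apply (is_RInt_comp (V := R_CompleteNormedModule)).
      - intros t Ht. rewrite Rmin_left, Rmax_right in Ht by lra. apply Cg, In, Ht.
      - intros t _. split; [apply W1|]. exact (is_derive_continuous _ _ _ (W2 t)). }
    assert (One : is_RInt (fun _ => 1) x y (RInt g (w x) (w y))).
    { apply (is_RInt_ext (V := R_NormedModule)) with (2 := EqI). intros t Ht.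
      rewrite Rmin_left, Rmax_right in Ht by lra.
      assert (Pt : 0 < Derive w t) by (apply Ph; lra).
      unfold g, scal; simpl; unfold mult; simpl.
      rewrite <- (profile_energy t).
      replace (Derive w t ^ 2) with (Rsqr (Derive w t)) by apply Rsqr_pow2.
      rewrite sqrt_Rsqr by lra. field. lra. }
    apply (is_RInt_unique (V := R_CompleteNormedModule)) in One.
    rewrite (RInt_const (V := R_CompleteNormedModule)) in One.
    unfold scal in One; simpl in One; unfold mult in One; simpl in One. rewrite Rmult_1_r in One.
    rewrite One.
    apply (RInt_correct (V := R_CompleteNormedModule)).
    apply (ex_RInt_continuous (V := R_CompleteNormedModule)). intros v Hv. apply Cg.
    assert (w x < w y) by (apply Inc; lra).
    rewrite Rmin_left, Rmax_right in Hv by lra.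
    pose proof (In x ltac:(lra)). pose proof (In y ltac:(lra)). lra. }
  intros P [e HP].
  pose proof (cond_pos e) as He.
  (* [n <= e / 2] makes the two truncated end pieces cost less than [e] together, and [n <= h / 3]
     keeps them apart. *)
  set (n := Rmin (e / 2) (h / 3)).
  assert (n <= e / 2) by apply Rmin_l. assert (n <= h / 3) by apply Rmin_r.
  assert (0 < n) by (apply Rmin_glb_lt; lra).
  assert (In1 : l < w n) by (rewrite <- I0; apply Inc; lra).
  assert (In2 : w (h - n) < r) by (rewrite <- Eh; apply Inc; lra).
  apply (Filter_prod _ _ _ (fun v => l < v < w n) (fun v => w (h - n) < v < r)).
  - exists (mkposreal (w n - l) ltac:(lra)). intros v Hv Hlv.
    change (Rabs (v - l) < w n - l) in Hv. apply Rabs_def2 in Hv. lra.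
  - exists (mkposreal (r - w (h - n)) ltac:(lra)). intros v Hv Hrv.
    change (Rabs (v - r) < r - w (h - n)) in Hv. apply Rabs_def2 in Hv. lra.
  - intros v1 v2 Hv1 Hv2. simpl.
    destruct (Val 0 n v1) as [x [Hx <-]]; try lra.
    destruct (Val (h - n) h v2) as [y [Hy <-]]; try lra.
    exists (y - x). split; [apply Int; lra|].
    apply HP. change (Rabs (y - x - h) < e). apply Rabs_def1; lra.
Qed.

End Profile.

Lemma profile_period (f F : R -> R) (um up : param -> R) (a E c : R) (w : R -> R) :
  is_C2 f -> (forall v, is_derive F v (f v)) ->
  is_well F (a, E, c) (um (a, E, c)) (up (a, E, c)) ->
  is_profile f F (a, E, c) (um (a, E, c)) w ->
  exists h, 0 < h /\ period F um up (a, E, c) = 2 * h /\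
    w h = up (a, E, c) /\ Derive w h = 0 /\ (forall t, 0 < t < h -> 0 < Derive w t).
Proof.
  intros hf hF hwell hprof.
  destruct (profile_half_period f F a E c _ _ w hF hwell hprof) as [h [Hh [Eh [Zh Ph]]]].
  exists h. repeat split; auto.
  unfold period. f_equal.
  apply (is_RInt_gen_unique (V := R_CompleteNormedModule)).
  now apply (profile_time f F a E c _ _ w hF hwell hprof).
Qed.

(** * Differentiation at a point: slopes, implicit functions, integrals *)

Lemma locally_Rabs_lt (d : R) : 0 < d -> locally 0 (fun s : R => Rabs s < d).
Proof.
  intros Hd. exists (mkposreal d Hd). intros s Hs.
  change (Rabs (s - 0) < d) in Hs. now rewrite Rminus_0_r in Hs.
Qed.

Lemma locally_Rabs_mult_le (A e : R) : 0 <= A -> 0 < e ->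
  locally 0 (fun s : R => A * Rabs s <= e).
Proof.
  intros HA He.
  assert (Hd : 0 < e / (A + 1)) by (apply Rdiv_lt_0_compat; lra).
  generalize (locally_Rabs_lt _ Hd). apply filter_imp. intros s Hs.
  apply Rle_trans with ((A + 1) * (e / (A + 1))).
  - apply Rmult_le_compat; auto using Rabs_pos; lra.
  - right. field. lra.
Qed.

(** Caratheodory's form of differentiability: the difference quotient becomes a continuous factor
    [phi], defined also at [x], which can be composed and inverted without separate limits. *)
Lemma caratheodory (g : R -> R) (x d : R) : is_derive g x d ->
  exists phi : R -> R, continuous phi x /\ phi x = d /\ forall y, g y - g x = phi y * (y - x).
Proof.
  intros H. apply is_derive_Reals in H.
  exists (fun y => match Req_dec_T y x with left _ => d | right _ => (g y - g x) / (y - x) end).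
  split; [|split].
  - apply filterlim_locally_R. intros eps.
    destruct (H eps (cond_pos eps)) as [delta Hd].
    exists delta. intros y Hy. change (Rabs (y - x) < delta) in Hy.
    destruct (Req_dec_T x x) as [_|N]; [|contradiction].
    destruct (Req_dec_T y x) as [->|N].
    + rewrite Rminus_diag, Rabs_R0. apply cond_pos.
    + specialize (Hd (y - x) ltac:(lra) Hy). rewrite Rplus_minus in Hd; exact Hd.
  - destruct (Req_dec_T x x); [reflexivity|contradiction].
  - intros y. destruct (Req_dec_T y x) as [->|N]; [ring|field; lra].
Qed.

Lemma caratheodory_inv (g phi : R -> R) (x : R) : continuous phi x ->
  locally x (fun y => g y - g x = phi y * (y - x)) -> is_derive g x (phi x).
Proof.
  intros C [e1 E]. apply is_derive_Reals. intros eps Heps.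
  destruct (proj1 (filterlim_locally_R phi (phi x)) C (mkposreal eps Heps)) as [e2 D].
  assert (Hm : 0 < Rmin e1 e2) by (apply Rmin_glb_lt; apply cond_pos).
  exists (mkposreal _ Hm). intros h Hh Hb. simpl in Hb, D.
  pose proof (Rmin_l e1 e2). pose proof (Rmin_r e1 e2).
  assert (B : forall e : posreal, Rmin e1 e2 <= e -> ball x e (x + h)).
  { intros e He. change (Rabs (x + h - x) < e). replace (x + h - x) with h by ring. lra. }
  rewrite (E (x + h) (B e1 ltac:(lra))).
  replace (phi (x + h) * (x + h - x) / h) with (phi (x + h)) by (field; assumption).
  apply D, B. lra.
Qed.

Lemma is_derive_small (g : R -> R) (d e : R) : is_derive g 0 d -> 0 < e ->
  locally 0 (fun s => Rabs (g s - g 0 - s * d) <= e * Rabs s).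
Proof.
  intros H He. destruct (caratheodory g 0 d H) as [phi [C [<- E]]].
  generalize (proj1 (filterlim_locally_R phi (phi 0)) C (mkposreal e He)).
  apply filter_imp. intros s Hs. simpl in Hs.
  rewrite E. replace (phi s * (s - 0) - s * phi 0) with ((phi s - phi 0) * s) by ring.
  rewrite Rabs_mult. apply Rmult_le_compat_r; [apply Rabs_pos|lra].
Qed.

Lemma is_derive_locally_lipschitz (g : R -> R) (d : R) : is_derive g 0 d ->
  locally 0 (fun s => Rabs (g s - g 0) <= (Rabs d + 1) * Rabs s).
Proof.
  intros H. generalize (is_derive_small g d 1 H Rlt_0_1). apply filter_imp. intros s Hs.
  replace (g s - g 0) with ((g s - g 0 - s * d) + s * d) by ring.
  eapply Rle_trans; [apply Rabs_triang|]. rewrite Rabs_mult. lra.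
Qed.

(** Differentiability of [t] is a conclusion, continuity being enough. Writing
    [G (t s) = phi (t s) (t s - t 0)], the equation reads [t s - t 0 = - s rho s / phi (t s)], and
    the factor of [s] is continuous. The lemma is applied to the turning point and to the period. *)
Lemma implicit_derive (G t rho : R -> R) (k : R) :
  is_derive G (t 0) k -> k <> 0 -> G (t 0) = 0 -> continuous t 0 -> continuous rho 0 ->
  locally 0 (fun s => G (t s) + s * rho s = 0) ->
  is_derive t 0 (- rho 0 / k).
Proof.
  intros HG Hk Z Ct Cr L.
  destruct (caratheodory G (t 0) k HG) as [phi [Cphi [Ek Ephi]]].
  assert (Cc : continuous (fun s => phi (t s)) 0) by (apply continuous_comp; assumption).
  rewrite <- Ek. apply (caratheodory_inv t (fun s => - rho s * / phi (t s)) 0).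
  - apply (continuous_mult (K := R_AbsRing)).
    + now apply (continuous_opp (V := R_NormedModule)).
    + apply (continuous_comp (fun s => phi (t s)) Rinv); [assumption|].
      apply continuous_Rinv. now rewrite Ek.
  - assert (N : locally 0 (fun s => phi (t s) <> 0)).
    { assert (Hp : 0 < Rabs k) by now apply Rabs_pos_lt.
      generalize (proj1 (filterlim_locally_R _ _) Cc (mkposreal _ Hp)).
      apply filter_imp. intros s Hs H0. simpl in Hs.
      rewrite H0, Ek, Rminus_0_l, Rabs_Ropp in Hs. lra. }
    generalize (filter_and _ _ L N). apply filter_imp. intros s [Hs Hn].
    specialize (Ephi (t s)). rewrite Z, Rminus_0_r in Ephi. rewrite Ephi in Hs.
    apply (Rmult_eq_reg_l (phi (t s))); [|assumption].
    replace (phi (t s) * (- rho s * / phi (t s) * (s - 0))) with (- (s * rho s)) by (field; assumption).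
    lra.
Qed.

Lemma continuous_quotient_zero (e : R -> R) : e 0 = 0 ->
  (forall eps, 0 < eps -> locally 0 (fun s => Rabs (e s) <= eps * Rabs s)) ->
  continuous (fun s => e s / s) 0.
Proof.
  intros Z H. apply filterlim_locally_R. intros eps.
  assert (He : 0 < eps / 2) by (pose proof (cond_pos eps); lra).
  generalize (H _ He). apply filter_imp. intros s Hs.
  (* The value of the quotient at 0 is [0 * / 0 = 0], which agrees with the limit. *)
  replace (e 0 / 0) with 0 by (rewrite Z; unfold Rdiv; ring). rewrite Rminus_0_r.
  pose proof (cond_pos eps).
  destruct (Req_dec s 0) as [->|N].
  - rewrite Z. unfold Rdiv. rewrite Rmult_0_l, Rabs_R0. lra.
  - unfold Rdiv. rewrite Rabs_mult, Rabs_inv.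
    apply Rle_lt_trans with (eps / 2 * Rabs s * / Rabs s).
    + apply Rmult_le_compat_r; [|assumption].
      left. now apply Rinv_0_lt_compat, Rabs_pos_lt.
    + rewrite Rmult_assoc, Rinv_r; [lra|now apply Rabs_no_R0].
Qed.

Lemma RInt_zero (h : R -> R) (x y : R) : (forall t, h t = 0) -> RInt h x y = 0.
Proof.
  intros H. rewrite (RInt_ext (V := R_CompleteNormedModule) h (fun _ => 0)) by auto.
  rewrite (RInt_const (V := R_CompleteNormedModule)). apply Rmult_0_r.
Qed.

(** The change of integrand is taken over the moving interval [[0, T s]], where it equals
    [s sigma(s)] with [sigma] continuous at 0. The motion of the endpoint is left to the fixed
    integrand [g 0], to which the chain rule applies. *)
Lemma integral_param_derive (g : R -> R -> R) (dg T : R -> R) (T' X : R) :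
  is_derive T 0 T' -> 0 < T 0 < X ->
  locally 0 (fun s => forall x, continuous (g s) x) ->
  (forall x, continuous dg x) ->
  (forall e, 0 < e -> locally 0 (fun s => forall x, 0 <= x <= X ->
    Rabs (g s x - g 0 x - s * dg x) <= e * Rabs s)) ->
  is_derive (fun s => RInt (g s) 0 (T s)) 0 (RInt dg 0 (T 0) + g 0 (T 0) * T').
Proof.
  intros HT HX Cg Cd Hg.
  pose proof (locally_singleton _ _ Cg) as C0.
  assert (CT : continuous T 0) by exact (is_derive_continuous _ _ _ HT).
  assert (RT : locally 0 (fun s => 0 <= T s <= X)).
  { assert (Hm : 0 < Rmin (T 0) (X - T 0)) by (apply Rmin_glb_lt; lra).
    generalize (proj1 (filterlim_locally_R _ _) CT (mkposreal _ Hm)).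
    apply filter_imp. intros s Hs. simpl in Hs. apply Rabs_def2 in Hs.
    pose proof (Rmin_l (T 0) (X - T 0)). pose proof (Rmin_r (T 0) (X - T 0)). lra. }
  set (rem := fun s => RInt (fun x => g s x - g 0 x - s * dg x) 0 (T s)).
  set (sigma := fun s => RInt dg 0 (T s) + rem s / s).
  assert (Csig : continuous sigma 0).
  { apply (continuous_plus (V := R_NormedModule)).
    - apply (continuous_comp T (fun y => RInt dg 0 y)); [assumption|].
      exact (is_derive_continuous _ _ _ (is_derive_primitive dg (T 0) Cd)).
    - apply continuous_quotient_zero.
      + unfold rem. apply RInt_zero. intros; ring.
      + intros e He. assert (He' : 0 < e / X) by (apply Rdiv_lt_0_compat; lra).
        generalize (filter_and _ _ RT (filter_and _ _ Cg (Hg _ He'))).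
        apply filter_imp. intros s [HTs [Cs Hs]]. unfold rem.
        eapply Rle_trans; [apply (abs_RInt_le_const _ 0 (T s) (e / X * Rabs s))|].
        * lra.
        * apply ex_RInt_cont. intros t.
          apply (continuous_minus (V := R_NormedModule)).
          { apply (continuous_minus (V := R_NormedModule)); auto. }
          now apply (continuous_scal_r (V := R_NormedModule)).
        * intros t Ht. apply Hs. lra.
        * rewrite Rminus_0_r.
          apply Rle_trans with (X * (e / X * Rabs s)); [|right; field; lra].
          apply Rmult_le_compat_r; [|lra].
          apply Rmult_le_pos; [lra|apply Rabs_pos]. }
  assert (HA : is_derive (fun s => RInt (g s) 0 (T s) - RInt (g 0) 0 (T s)) 0 (sigma 0)).
  { apply caratheodory_inv; [assumption|].
    generalize Cg. apply filter_imp. intros s Cs.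
    assert (Es : rem s = RInt (g s) 0 (T s) - RInt (g 0) 0 (T s) - s * RInt dg 0 (T s)).
    { unfold rem. apply (is_RInt_unique (V := R_CompleteNormedModule)).
      apply (is_RInt_minus (V := R_NormedModule)).
      - apply (is_RInt_minus (V := R_NormedModule));
          apply (RInt_correct (V := R_CompleteNormedModule)), ex_RInt_cont; auto.
      - apply (is_RInt_scal (V := R_NormedModule)).
        apply (RInt_correct (V := R_CompleteNormedModule)), ex_RInt_cont; auto. }
    unfold sigma. destruct (Req_dec s 0) as [->|N].
    - ring.
    - rewrite Es. field. assumption. }
  assert (HB : is_derive (fun s => RInt (g 0) 0 (T s)) 0 (T' * g 0 (T 0))).
  { apply (is_derive_comp (V := R_NormedModule) (fun y => RInt (g 0) 0 y) T); [|assumption].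
    now apply is_derive_primitive. }
  replace (RInt dg 0 (T 0) + g 0 (T 0) * T') with (plus (sigma 0) (T' * g 0 (T 0))).
  - apply is_derive_ext with (fun s => plus (RInt (g s) 0 (T s) - RInt (g 0) 0 (T s)) (RInt (g 0) 0 (T s))).
    + intros s. unfold plus; simpl. ring.
    + now apply (is_derive_plus (V := R_NormedModule)).
  - unfold plus, sigma; simpl. replace (rem 0 / 0) with 0; [ring|].
    unfold rem. rewrite RInt_zero; [unfold Rdiv; ring|intros; ring].
Qed.

(** * Differentiability in the parameters *)

(** What later arguments use of the profile once the improper integral is eliminated: [T] is twice
    the travel time [h] from [l] to [r], and the velocity vanishes at [T], the equation from which
    [T] is differentiated. *)
Definition orbit (f F : R -> R) (a E c l r T : R) (w : R -> R) : Prop :=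
  newton f a c w (Derive w) /\ (forall x, l <= w x <= r) /\
  w 0 = l /\ Derive w 0 = 0 /\ Veff F a c l = E /\
  (forall x, w (x + T) = w x) /\ Derive w T = 0 /\
  exists h, T = 2 * h /\ 0 < h /\ w h = r /\ Derive w h = 0 /\
    forall t, 0 < t < h -> 0 < Derive w t.

Lemma profile_orbit (f F : R -> R) (um up : param -> R) (a E c : R) (w : R -> R) :
  is_C2 f -> (forall v, is_derive F v (f v)) ->
  is_well F (a, E, c) (um (a, E, c)) (up (a, E, c)) ->
  is_profile f F (a, E, c) (um (a, E, c)) w ->
  orbit f F a E c (um (a, E, c)) (up (a, E, c)) (period F um up (a, E, c)) w.
Proof.
  intros hf hF hwell hprof.
  destruct (profile_period f F um up a E c w hf hF hwell hprof) as [h [Hh [HT [Eh [Zh Ph]]]]].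
  pose proof (profile_periodic f F a E c _ _ w hf hF hwell hprof h Zh) as Per.
  destruct (profile_start f F a E c _ w hprof) as [I0 I1].
  split; [exact (profile_newton f F a E c _ w hprof)|].
  split; [exact (profile_range f F a E c _ _ w hF hwell hprof)|].
  split; [assumption|]. split; [assumption|].
  split; [destruct hwell as [_ [_ [El _]]]; exact El|].
  rewrite HT. split; [intros x; apply Per|]. split.
  - rewrite <- (Rplus_0_l (2 * h)), (proj2 (Per 0)). assumption.
  - exists h. auto.
Qed.

Lemma C2_taylor (f : R -> R) (x y : R) : is_C2 f ->
  exists K, 0 <= K /\ forall s t, x <= s <= y -> x <= t <= y ->
    Rabs (f s - f t - Derive f t * (s - t)) <= K * (s - t) ^ 2.
Proof.
  intros [Df [Df' Cf]].
  destruct (C1_lipschitz (Derive f) (Derive (Derive f)) x y) as [K [HK Lip]].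
  { intros t. apply Derive_correct, Df'. } { exact Cf. }
  exists K. split; [assumption|]. intros s t Hs Ht.
  destruct (MVT_gen f t s (Derive f)) as [m [Hm Em]].
  - intros. apply Derive_correct, Df.
  - intros u _. exact (is_derive_continuity_pt f u _ (Derive_correct _ _ (Df u))).
  - rewrite Em. replace (Derive f m * (s - t) - Derive f t * (s - t))
      with ((Derive f m - Derive f t) * (s - t)) by ring.
    rewrite Rabs_mult, <- pow2_abs.
    assert (Hm' : x <= m <= y /\ Rabs (m - t) <= Rabs (s - t)).
    { unfold Rmin, Rmax in Hm. destruct (Rle_dec t s); split; try lra.
      - rewrite !Rabs_pos_eq; lra.
      - rewrite (Rabs_left1 (m - t)), (Rabs_left1 (s - t)); lra. }
    replace (K * Rabs (s - t) ^ 2) with (K * Rabs (s - t) * Rabs (s - t)) by ring.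
    apply Rmult_le_compat_r; [apply Rabs_pos|].
    eapply Rle_trans; [apply Lip; tauto|]. apply Rmult_le_compat_l; tauto.
Qed.

(** * Variations along a line of parameters *)

Section Direction.

Variables (f F : R -> R) (a E c al be ga : R) (l r T : R -> R) (w : R -> R -> R).
Variables (v v' : R -> R).
Hypothesis (hf : is_C2 f) (hF : forall x, is_derive F x (f x)).
Hypothesis (HG : locally 0 (fun s =>
  orbit f F (a + s * al) (E + s * be) (c + s * ga) (l s) (r s) (T s) (w s))).
Hypothesis (H0 : orbit f F a E c (l 0) (r 0) (T 0) (w 0)).
Hypothesis (Cl : continuous l 0) (Cr : continuous r 0).

Let k := a + c * l 0 - f (l 0).

Hypothesis (Hk : 0 < k) (Hkr : a + c * r 0 - f (r 0) < 0).

(** Obtained by differentiating [V(l; a, c) = E] along the line, where [V'(l) = - k]. It is the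
    initial value which the variation [v] must have. *)
Let l' := - (be + al * l 0 + ga * (l 0) ^ 2 / 2) / k.

Hypothesis (Hv : forall x, is_derive v x (v' x)).
Hypothesis (Hv' : forall x, is_derive v' x (al + ga * w 0 x - (Derive f (w 0 x) - c) * v x)).
Hypothesis (v0 : v 0 = l') (v'0 : v' 0 = 0).

(** [V] is affine in [a] and [c], so the energy relation at [l s] is exactly of the form
    [G (l s) + s rho s = 0], without remainder. *)
Lemma turning_point_derive : is_derive l 0 l'.
Proof.
  destruct H0 as [_ [_ [_ [_ [El _]]]]].
  set (rho := fun s => - (be + al * l s + ga * (l s) ^ 2 / 2)).
  replace l' with (- rho 0 / - k) by (unfold rho, l'; field; lra).
  apply (implicit_derive (fun y => Veff F a c y - E) l rho); auto.
  - replace (- k) with (f (l 0) - c * l 0 - a) by (unfold k; ring).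
    pose proof (fun y => Veff_derive f F a c y hF) as HV. solve_derive.
  - lra.
  - rewrite El; ring.
  - apply (continuous_comp l (fun y => - (be + al * y + ga * y ^ 2 / 2))); [assumption|].
    apply (ex_derive_continuous (V := R_NormedModule)). auto_derive. auto.
  - generalize HG. apply filter_imp. intros s [_ [_ [_ [_ [Es _]]]]].
    unfold Veff, rho in *. lra.
Qed.

Lemma newton_diff (s x : R) :
  orbit f F (a + s * al) (E + s * be) (c + s * ga) (l s) (r s) (T s) (w s) ->
  is_derive (fun x => w s x - w 0 x) x (Derive (w s) x - Derive (w 0) x) /\
  is_derive (fun x => Derive (w s) x - Derive (w 0) x) x
    (s * (al + ga * w s x) + c * (w s x - w 0 x) - (f (w s x) - f (w 0 x))).
Proof.
  intros [[W1 W2] _]. destruct H0 as [[Z1 Z2] _].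
  split; solve_derive.
Qed.

Lemma range_near : exists x y, locally 0 (fun s => forall t, x <= w s t <= y) /\
  forall t, x <= w 0 t <= y.
Proof.
  destruct H0 as [_ [B0 _]].
  exists (l 0 - 1), (r 0 + 1). split.
  - generalize (filter_and _ _ HG (filter_and _ _
      (proj1 (filterlim_locally_R _ _) Cl (mkposreal 1 Rlt_0_1))
      (proj1 (filterlim_locally_R _ _) Cr (mkposreal 1 Rlt_0_1)))).
    apply filter_imp. intros s [[_ [B _]] [Hl Hr]] t. simpl in Hl, Hr.
    apply Rabs_def2 in Hl. apply Rabs_def2 in Hr. specialize (B t). lra.
  - intros t. specialize (B0 t). lra.
Qed.

(** The a priori bound for the linearization: it makes the Taylor remainder of [f] along the orbits
    quadratic in [s]. *)
Lemma family_lipschitz (X : R) : 0 <= X ->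
  exists C, 0 <= C /\ locally 0 (fun s => forall x, 0 <= x <= X ->
    Rabs (w s x - w 0 x) <= C * Rabs s /\
    Rabs (Derive (w s) x - Derive (w 0) x) <= C * Rabs s).
Proof.
  intros HX.
  destruct range_near as [x0 [y0 [Rng Rng0]]].
  destruct (C1_lipschitz f (Derive f) x0 y0) as [L [HL Lip]].
  { intros t. apply Derive_correct, hf. }
  { intros t. apply (ex_derive_continuous (V := R_NormedModule)), hf. }
  pose proof (Rabs_pos c) as Hc.
  destruct (gronwall3 (1 + Rabs c + L) X) as [C [HC G]]; [lra|assumption|].
  set (B := Rabs x0 + Rabs y0).
  assert (Bnd : forall z, x0 <= z <= y0 -> Rabs z <= B).
  { intros z Hz. unfold B. apply Rabs_le.
    pose proof (Rle_abs (- x0)). rewrite Rabs_Ropp in *. pose proof (Rle_abs y0).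
    pose proof (Rabs_pos x0). pose proof (Rabs_pos y0). lra. }
  set (M := Rabs l' + 1 + (Rabs al + Rabs ga * B)).
  assert (HB : 0 <= B) by (apply Rplus_le_le_0_compat; apply Rabs_pos).
  assert (HgB : 0 <= Rabs ga * B) by (apply Rmult_le_pos; auto using Rabs_pos).
  pose proof (Rabs_pos al). pose proof (Rabs_pos l').
  exists (C * M). split; [apply Rmult_le_pos; unfold M; lra|].
  generalize (filter_and _ _ HG (filter_and _ _ Rng
    (is_derive_locally_lipschitz l l' turning_point_derive))).
  apply filter_imp. intros s [Gs [Rs Ls]] x Hx.
  pose proof (Rabs_pos s) as Hs.
  assert (HMs : (Rabs l' + 1) * Rabs s <= M * Rabs s)
    by (apply Rmult_le_compat_r; unfold M; lra).
  assert (HMs2 : (Rabs al + Rabs ga * B) * Rabs s <= M * Rabs s)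
    by (apply Rmult_le_compat_r; unfold M; lra).
  assert (HM : 0 <= M * Rabs s) by (apply Rmult_le_pos; unfold M; lra).
  rewrite Rmult_assoc.
  destruct (G (M * Rabs s) (fun x => w s x - w 0 x) (fun x => Derive (w s) x - Derive (w 0) x)
    (fun _ => 0) (fun x => Derive (w s) x - Derive (w 0) x)
    (fun x => s * (al + ga * w s x) + c * (w s x - w 0 x) - (f (w s x) - f (w 0 x)))
    (fun _ => 0)) with (x := x) as [A1 [A2 _]]; auto.
  - intros t. now apply newton_diff.
  - intros t. now apply newton_diff.
  - intros t. apply (is_derive_const (V := R_NormedModule)).
  - intros t _. rewrite Rabs_R0, Rplus_0_r.
    specialize (Lip (w s t) (w 0 t) (Rs t) (Rng0 t)).
    specialize (Bnd (w s t) (Rs t)).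
    set (A := Rabs (w s t - w 0 t)) in *.
    set (A' := Rabs (Derive (w s) t - Derive (w 0) t)).
    assert (0 <= A) by apply Rabs_pos. assert (0 <= A') by apply Rabs_pos.
    assert (0 <= (Rabs c + L) * (A + A')) by (apply Rmult_le_pos; lra).
    assert (0 <= (Rabs c + L) * A') by (apply Rmult_le_pos; lra).
    repeat split; try lra.
    eapply Rle_trans; [apply Rabs_triang|]. rewrite Rabs_Ropp.
    eapply Rle_trans; [apply Rplus_le_compat_r, Rabs_triang|]. rewrite !Rabs_mult. fold A.
    assert (Rabs (al + ga * w s t) <= Rabs al + Rabs ga * B).
    { eapply Rle_trans; [apply Rabs_triang|]. rewrite Rabs_mult.
      apply Rplus_le_compat_l, Rmult_le_compat_l; [apply Rabs_pos|assumption]. }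
    assert (Rabs s * Rabs (al + ga * w s t) <= Rabs s * (Rabs al + Rabs ga * B))
      by (apply Rmult_le_compat_l; assumption).
    lra.
  - destruct Gs as [_ [_ [-> _]]]. destruct H0 as [_ [_ [-> _]]]. lra.
  - destruct Gs as [_ [_ [_ [-> _]]]]. destruct H0 as [_ [_ [_ [-> _]]]].
    rewrite Rminus_diag, Rabs_R0. assumption.
  - rewrite Rabs_R0. assumption.
Qed.

(** The remainder [w s - w 0 - s v] solves the linearized equation with forcing [s ga (w s - w 0)]
    minus the Taylor remainder of [f]. Both are of order [s^2], and the initial error is [o(s)] by
    the derivative of the turning point, so Groenwall gives [o(s)] uniformly on [[0, X]]. *)
Lemma family_derive (X e : R) : 0 <= X -> 0 < e ->
  locally 0 (fun s => forall x, 0 <= x <= X ->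
    Rabs (w s x - w 0 x - s * v x) <= e * Rabs s /\
    Rabs (Derive (w s) x - Derive (w 0) x - s * v' x) <= e * Rabs s).
Proof.
  intros HX He.
  destruct range_near as [x0 [y0 [Rng Rng0]]].
  destruct (C2_taylor f x0 y0 hf) as [K [HK Tay]].
  destruct (family_lipschitz X HX) as [C [HC Lip]].
  assert (Cq : forall t, continuous (fun x => Derive f (w 0 x) - c) t).
  { intros t. apply (continuous_minus (V := R_NormedModule)); [|apply continuous_const].
    apply (continuous_comp (w 0) (Derive f)).
    - destruct H0 as [[W1 _] _]. exact (is_derive_continuous _ _ _ (W1 t)).
    - apply (ex_derive_continuous (V := R_NormedModule)), hf. }
  destruct (continuous_bounded _ 0 X Cq) as [Q [HQ Bq]].
  destruct (gronwall3 (1 + Q) X) as [D [HD G]]; [lra|assumption|].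
  assert (He1 : 0 < e / D) by now apply Rdiv_lt_0_compat.
  assert (HgC : 0 <= Rabs ga * C) by (apply Rmult_le_pos; auto using Rabs_pos).
  assert (HKC : 0 <= K * C ^ 2) by (apply Rmult_le_pos; [assumption|apply pow2_ge_0]).
  assert (HA : 0 <= Rabs ga * C + K * C ^ 2) by lra.
  generalize (filter_and _ _ HG (filter_and _ _ Rng (filter_and _ _ Lip (filter_and _ _
    (is_derive_small l l' (e / D) turning_point_derive He1)
    (locally_Rabs_mult_le _ _ HA He1))))).
  apply filter_imp. intros s [Gs [Rs [Lips [Ls Ss]]]] x Hx.
  pose proof (Rabs_pos s) as Hs.
  assert (Hes : 0 <= e / D * Rabs s) by (apply Rmult_le_pos; lra).
  replace (e * Rabs s) with (D * (e / D * Rabs s)) by (field; lra).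
  destruct (G (e / D * Rabs s) (fun x => w s x - w 0 x - s * v x)
    (fun x => Derive (w s) x - Derive (w 0) x - s * v' x)
    (fun _ => 0) (fun x => Derive (w s) x - Derive (w 0) x - s * v' x)
    (fun x => s * ga * (w s x - w 0 x)
      - (Derive f (w 0 x) - c) * (w s x - w 0 x - s * v x)
      - (f (w s x) - f (w 0 x) - Derive f (w 0 x) * (w s x - w 0 x)))
    (fun _ => 0)) with (x := x) as [A1 [A2 _]]; auto.
  - intros t. apply (is_derive_minus (V := R_NormedModule)).
    + now apply newton_diff.
    + apply is_derive_scal, Hv.
  - intros t. evar_last.
    + apply (is_derive_minus (V := R_NormedModule)).
      * now apply newton_diff.
      * apply is_derive_scal, Hv'.
    + unfold minus, plus, opp; simpl. ring.
  - intros t. apply (is_derive_const (V := R_NormedModule)).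
  - intros t Ht. rewrite Rabs_R0, Rplus_0_r.
    specialize (Tay (w s t) (w 0 t) (Rs t) (Rng0 t)).
    specialize (Bq t Ht). destruct (Lips t Ht) as [Z _].
    set (A := Rabs (w s t - w 0 t - s * v t)).
    set (A' := Rabs (Derive (w s) t - Derive (w 0) t - s * v' t)).
    assert (0 <= A) by apply Rabs_pos. assert (0 <= A') by apply Rabs_pos.
    assert (0 <= Q * (A + A')) by (apply Rmult_le_pos; lra).
    assert (0 <= Q * A') by (apply Rmult_le_pos; lra).
    repeat split; try lra.
    eapply Rle_trans; [apply Rabs_triang|]. rewrite Rabs_Ropp.
    eapply Rle_trans; [apply Rplus_le_compat_r, Rabs_triang|].
    rewrite Rabs_Ropp, !Rabs_mult. fold A.
    assert (Rabs (Derive f (w 0 t) - c) * A <= Q * A) by (apply Rmult_le_compat_r; assumption).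
    assert (Rabs s * Rabs ga * Rabs (w s t - w 0 t) <= Rabs s * Rabs ga * (C * Rabs s)).
    { apply Rmult_le_compat_l; [|assumption]. apply Rmult_le_pos; [assumption|apply Rabs_pos]. }
    assert (K * (w s t - w 0 t) ^ 2 <= K * (C * Rabs s) ^ 2).
    { apply Rmult_le_compat_l; [assumption|]. rewrite <- pow2_abs.
      apply pow_incr. split; [apply Rabs_pos|assumption]. }
    assert ((Rabs ga * C + K * C ^ 2) * Rabs s * Rabs s <= e / D * Rabs s)
      by (apply Rmult_le_compat_r; assumption).
    lra.
  - destruct Gs as [_ [_ [-> _]]]. destruct H0 as [_ [_ [-> _]]]. rewrite v0. assumption.
  - destruct Gs as [_ [_ [_ [-> _]]]]. destruct H0 as [_ [_ [_ [-> _]]]].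
    rewrite v'0, Rminus_diag, Rmult_0_r, Rminus_diag, Rabs_R0. assumption.
  - rewrite Rabs_R0. assumption.
Qed.

(** The half period [hs] is trapped near [h]. If [hs <= h - e], the nearby orbit would be at its
    maximum [r s] while [w 0] is still well below [r 0]. If [hs > t1], with [t1] slightly after [h],
    it would still be rising at [t1], where [w 0] already falls at a definite rate. *)
Lemma period_continuous : continuous T 0.
Proof.
  destruct H0 as [[W1 W2] [_ [I0 [I1 [_ [_ [_ [h [HT [Hh [Eh [Zh Ph]]]]]]]]]]]].
  destruct (family_lipschitz (T 0)) as [C [HC Lip]]; [lra|].
  apply filterlim_locally_R. intros eps. pose proof (cond_pos eps) as Heps.
  set (e := Rmin (eps / 4) (h / 2)).
  assert (e1 : e <= eps / 4) by apply Rmin_l. assert (e2 : e <= h / 2) by apply Rmin_r.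
  assert (He : 0 < e) by (apply Rmin_glb_lt; lra).
  assert (m1 : w 0 (h - e) < r 0).
  { rewrite <- Eh. apply (is_derive_incr_strict (w 0) (Derive (w 0))); [assumption| |lra].
    intros t Ht. apply Ph. lra. }
  assert (exists t1, h < t1 < h + e /\ Derive (w 0) t1 < 0) as [t1 [Ht1 m2]].
  { pose proof (W2 h) as D. rewrite Eh in D.
    assert (D' : is_derive (fun x => - Derive (w 0) x) h (- (a + c * r 0 - f (r 0))))
      by now apply (is_derive_opp (V := R_NormedModule)).
    destruct (is_derive_pos_sign _ h _ D' ltac:(lra)) as [d [Hd [P _]]].
    rewrite Zh in P. exists (h + Rmin (d / 2) (e / 2)).
    pose proof (Rmin_l (d / 2) (e / 2)). pose proof (Rmin_r (d / 2) (e / 2)).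
    assert (0 < Rmin (d / 2) (e / 2)) by (apply Rmin_glb_lt; lra).
    split; [lra|]. specialize (P (h + Rmin (d / 2) (e / 2)) ltac:(lra)). lra. }
  assert (Hd1 : 0 < (r 0 - w 0 (h - e)) / 2) by lra.
  assert (Hd2 : 0 < - Derive (w 0) t1 / 2) by lra.
  generalize (filter_and _ _ HG (filter_and _ _ Lip (filter_and _ _
    (proj1 (filterlim_locally_R _ _) Cr (mkposreal _ Hd1)) (filter_and _ _
    (locally_Rabs_mult_le C _ HC Hd1) (locally_Rabs_mult_le C _ HC Hd2))))).
  apply filter_imp. intros s [Gs [Ls [Rs [S1 S2]]]]. simpl in Rs. apply Rabs_def2 in Rs.
  destruct Gs as [_ [_ [_ [_ [_ [_ [_ [hs [HTs [Hhs [Ehs [Zhs Phs]]]]]]]]]]]].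
  assert (Low : h - e < hs).
  { destruct (Rlt_dec (h - e) hs); [assumption|exfalso].
    destruct (Ls hs ltac:(lra)) as [B _]. rewrite Ehs in B.
    pose proof (Rle_abs (r s - w 0 hs)).
    assert (w 0 hs <= w 0 (h - e)); [|lra].
    destruct (Req_dec hs (h - e)) as [->|]; [lra|left].
    apply (is_derive_incr_strict (w 0) (Derive (w 0))); [assumption| |lra].
    intros t Ht. apply Ph. lra. }
  assert (Up : hs <= t1).
  { destruct (Rle_dec hs t1); [assumption|exfalso].
    destruct (Ls t1 ltac:(lra)) as [_ B].
    pose proof (Rle_abs (Derive (w s) t1 - Derive (w 0) t1)).
    specialize (Phs t1 ltac:(lra)). lra. }
  rewrite HTs, HT. apply Rabs_def1; lra.
Qed.

(** The rest condition of the orbit [w s] at [T s], expanded in [s], is an implicit equation whose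
    leading part is the velocity of [w 0]. The slope of that velocity at [T 0] is the acceleration
    [k] at the turning point. *)
Lemma period_derive : is_derive T 0 (- v' (T 0) / k).
Proof.
  destruct H0 as [[W1 W2] [_ [I0 [I1 [_ [PT [ZT [h [HT [Hh _]]]]]]]]]].
  assert (WT : w 0 (T 0) = l 0) by (rewrite <- (Rplus_0_l (T 0)), PT; assumption).
  set (e := fun s => Derive (w s) (T s) - Derive (w 0) (T s) - s * v' (T s)).
  (* At [s = 0] the quotient is [0 / 0 = 0], so [rho 0 = v' (T 0)]. *)
  set (rho := fun s => v' (T s) + e s / s).
  pose proof period_continuous as CT.
  assert (e0 : e 0 = 0) by (unfold e; ring).
  replace (- v' (T 0)) with (- rho 0) by (unfold rho; rewrite e0; unfold Rdiv; ring).
  apply (implicit_derive (Derive (w 0)) T rho).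
  - replace k with (a + c * w 0 (T 0) - f (w 0 (T 0))) by (rewrite WT; reflexivity). apply W2.
  - lra.
  - assumption.
  - assumption.
  - apply (continuous_plus (V := R_NormedModule)).
    + apply (continuous_comp T v'); [assumption|]. exact (is_derive_continuous _ _ _ (Hv' (T 0))).
    + apply continuous_quotient_zero; [assumption|]. intros eps Heps.
      assert (HX : 0 <= T 0 + 1) by lra.
      generalize (filter_and _ _ HG (filter_and _ _ (family_derive (T 0 + 1) eps HX Heps)
        (proj1 (filterlim_locally_R _ _) CT (mkposreal 1 Rlt_0_1)))).
      apply filter_imp. intros s [Gs [Ds Ts]]. simpl in Ts. apply Rabs_def2 in Ts.
      destruct Gs as [_ [_ [_ [_ [_ [_ [_ [hs [HTs [Hhs _]]]]]]]]]].
      apply Ds. lra.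
  - generalize HG. apply filter_imp. intros s Gs.
    destruct Gs as [_ [_ [_ [_ [_ [_ [ZTs _]]]]]]].
    unfold rho. destruct (Req_dec s 0) as [->|N].
    + rewrite ZT. ring.
    + replace (s * (v' (T s) + e s / s)) with (s * v' (T s) + e s) by (field; assumption).
      unfold e. rewrite ZTs. ring.
Qed.

Let T' := - v' (T 0) / k.

Lemma orbit_continuous : locally 0 (fun s => forall x, continuous (w s) x).
Proof.
  generalize HG. apply filter_imp. intros s [[W1 _] _] x.
  exact (is_derive_continuous _ _ _ (W1 x)).
Qed.

Lemma mass_derive : is_derive (fun s => RInt (w s) 0 (T s)) 0 (RInt v 0 (T 0) + l 0 * T').
Proof.
  destruct H0 as [_ [_ [I0 [_ [_ [PT [_ [h [HT [Hh _]]]]]]]]]].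
  assert (WT : w 0 (T 0) = l 0) by (rewrite <- (Rplus_0_l (T 0)), PT; assumption).
  rewrite <- WT.
  apply (integral_param_derive w v T T' (T 0 + 1)).
  - apply period_derive.
  - lra.
  - apply orbit_continuous.
  - intros x. exact (is_derive_continuous _ _ _ (Hv x)).
  - intros e He. generalize (family_derive (T 0 + 1) e ltac:(lra) He).
    apply filter_imp. intros s Hs x Hx. now apply Hs.
Qed.

Lemma momentum_derive : is_derive (fun s => RInt (fun x => w s x ^ 2) 0 (T s)) 0
  (2 * RInt (fun x => w 0 x * v x) 0 (T 0) + l 0 ^ 2 * T').
Proof.
  destruct H0 as [[W1 _] [_ [I0 [_ [_ [PT [_ [h [HT [Hh _]]]]]]]]]].
  assert (WT : w 0 (T 0) = l 0) by (rewrite <- (Rplus_0_l (T 0)), PT; assumption).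
  assert (C0 : forall x, continuous (w 0) x)
    by (intros x; exact (is_derive_continuous _ _ _ (W1 x))).
  assert (C2 : forall x, continuous (fun x => w 0 x * v x) x).
  { intros x. apply (continuous_mult (K := R_AbsRing)); [apply C0|].
    exact (is_derive_continuous _ _ _ (Hv x)). }
  rewrite <- WT.
  replace (2 * RInt (fun x => w 0 x * v x) 0 (T 0))
    with (RInt (fun x => 2 * (w 0 x * v x)) 0 (T 0)).
  2: { apply (is_RInt_unique (V := R_CompleteNormedModule)).
       apply (is_RInt_scal (V := R_NormedModule)).
       apply (RInt_correct (V := R_CompleteNormedModule)), ex_RInt_cont, C2. }
  assert (HX : 0 <= T 0 + 1) by lra.
  apply (integral_param_derive (fun s x => w s x ^ 2) (fun x => 2 * (w 0 x * v x)) T T' (T 0 + 1)).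
  - apply period_derive.
  - lra.
  - generalize orbit_continuous. apply filter_imp. intros s Hs x.
    apply (continuous_comp (w s) (fun y => y ^ 2)); [apply Hs|].
    apply (ex_derive_continuous (V := R_NormedModule)). auto_derive. auto.
  - intros x. now apply (continuous_scal_r (V := R_NormedModule)).
  - intros e He.
    destruct (family_lipschitz (T 0 + 1) HX) as [C [HC Lip]].
    destruct (continuous_bounded (w 0) 0 (T 0 + 1) C0) as [B [HB Bw]].
    assert (He1 : 0 < e / (4 * (B + 1))) by (apply Rdiv_lt_0_compat; lra).
    assert (He2 : 0 < e / 2) by lra.
    generalize (filter_and _ _ Lip (filter_and _ _ (family_derive _ _ HX He1)
      (locally_Rabs_mult_le _ _ (pow2_ge_0 C) He2))).
    apply filter_imp. intros s [L [D S]] x Hx.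
    destruct (L x Hx) as [L1 _]. destruct (D x Hx) as [D1 _]. specialize (Bw x Hx).
    pose proof (Rabs_pos s) as Hs.
    replace (w s x ^ 2 - w 0 x ^ 2 - s * (2 * (w 0 x * v x)))
      with (2 * w 0 x * (w s x - w 0 x - s * v x) + (w s x - w 0 x) ^ 2) by ring.
    eapply Rle_trans; [apply Rabs_triang|].
    rewrite !Rabs_mult, (Rabs_pos_eq 2), <- RPow_abs by lra.
    assert (A1 : Rabs (w 0 x) * Rabs (w s x - w 0 x - s * v x) <=
      (B + 1) * (e / (4 * (B + 1)) * Rabs s))
      by (apply Rmult_le_compat; auto using Rabs_pos; lra).
    replace ((B + 1) * (e / (4 * (B + 1)) * Rabs s)) with (e / 4 * Rabs s) in A1 by (field; lra).
    assert (A2 : Rabs (w s x - w 0 x) ^ 2 <= (C * Rabs s) ^ 2)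
      by (apply pow_incr; split; [apply Rabs_pos|assumption]).
    assert (A3 : C ^ 2 * Rabs s * Rabs s <= e / 2 * Rabs s)
      by (apply Rmult_le_compat_r; assumption).
    lra.
Qed.

End Direction.

(** * The linearization about the profile *)

Lemma is_derive_zero_const (g : R -> R) : (forall x, is_derive g x 0) ->
  forall x, g x = g 0.
Proof.
  intros H x. destruct (MVT_gen g 0 x (fun _ => 0)) as [m [_ Em]].
  - intros; apply H.
  - intros t _. exact (is_derive_continuity_pt g t 0 (H t)).
  - lra.
Qed.

Lemma periodic_IZR (g : R -> R) (T : R) : (forall x, g (x + T) = g x) ->
  forall (n : Z) x, g (x + IZR n * T) = g x.
Proof.
  intros P n. induction n as [|n IH|n IH] using Z.peano_ind; intros x.
  - rewrite Rmult_0_l, Rplus_0_r. reflexivity.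
  - rewrite succ_IZR. replace (x + (IZR n + 1) * T) with (x + IZR n * T + T) by ring.
    now rewrite P.
  - rewrite <- Z.sub_1_r, minus_IZR. rewrite <- P.
    replace (x + (IZR n - 1) * T + T) with (x + IZR n * T) by ring. apply IH.
Qed.

Lemma periodic_bounded (g : R -> R) (T : R) : (forall x, continuous g x) -> 0 < T ->
  (forall x, g (x + T) = g x) -> exists B, forall x, Rabs (g x) <= B.
Proof.
  intros C HT P. destruct (continuous_bounded g 0 T C) as [B [_ HB]].
  exists B. intros x.
  destruct (archimed (x / T)) as [A1 A2].
  rewrite <- (periodic_IZR g T P (- up (x / T) + 1) x). apply HB.
  rewrite plus_IZR, opp_IZR.
  assert (E : x = x / T * T) by (field; lra).
  split.
  - assert (0 <= (x / T - IZR (up (x / T)) + 1) * T) by (apply Rmult_le_pos; lra). lra.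
  - assert (0 <= (IZR (up (x / T)) - x / T) * T) by (apply Rmult_le_pos; lra). lra.
Qed.

(** The points of [nat -> R] carry the uniform structure, which makes [det3] a function of
    finitely many coordinates. *)
Lemma det3_neg_open (l11 l12 l13 l21 l22 l23 l31 l32 l33 : R) :
  det3 l11 l12 l13 l21 l22 l23 l31 l32 l33 < 0 ->
  exists eta, 0 < eta /\ forall m11 m12 m13 m21 m22 m23 m31 m32 m33,
    Rabs (m11 - l11) < eta -> Rabs (m12 - l12) < eta -> Rabs (m13 - l13) < eta ->
    Rabs (m21 - l21) < eta -> Rabs (m22 - l22) < eta -> Rabs (m23 - l23) < eta ->
    Rabs (m31 - l31) < eta -> Rabs (m32 - l32) < eta -> Rabs (m33 - l33) < eta ->
    det3 m11 m12 m13 m21 m22 m23 m31 m32 m33 < 0.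
Proof.
  intros H.
  set (pt := fun m11 m12 m13 m21 m22 m23 m31 m32 m33 : R => fun n : nat => match n with
    | 0 => m11 | 1 => m12 | 2 => m13 | 3 => m21 | 4 => m22 | 5 => m23
    | 6 => m31 | 7 => m32 | _ => m33 end%nat).
  set (p := pt l11 l12 l13 l21 l22 l23 l31 l32 l33).
  assert (ev : forall n : nat, filterlim (fun t : nat -> R => t n)
    (locally (T := fct_UniformSpace nat R_UniformSpace) p) (locally (p n))).
  { intros n. apply filterlim_locally_R. intros eps. exists eps. intros t Ht. exact (Ht n). }
  pose proof (filterlim_det3 _ _ _ _ _ _ _ _ _ _ _ _ _ _ _ _ _ _
    (ev 0%nat) (ev 1%nat) (ev 2%nat) (ev 3%nat) (ev 4%nat) (ev 5%nat) (ev 6%nat)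
    (ev 7%nat) (ev 8%nat)) as L.
  destruct (proj1 (filterlim_locally_R _ _) L (mkposreal _ (Ropp_0_gt_lt_contravar _ H)))
    as [eta Heta].
  exists eta. split; [apply cond_pos|]. intros m11 m12 m13 m21 m22 m23 m31 m32 m33 ? ? ? ? ? ? ? ? ?.
  specialize (Heta (pt m11 m12 m13 m21 m22 m23 m31 m32 m33)).
  simpl in Heta.
  assert (B : ball (M := fct_UniformSpace nat R_UniformSpace) p eta
    (pt m11 m12 m13 m21 m22 m23 m31 m32 m33)).
  { intros n. do 8 (destruct n as [|n]; [assumption|]). assumption. }
  specialize (Heta B). apply Rabs_def2 in Heta. lra.
Qed.

Lemma RInt_close (y z w : R -> R) (T B e : R) : 0 <= T -> 0 <= e ->
  (forall x, continuous y x) -> (forall x, continuous z x) -> (forall x, continuous w x) ->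
  (forall x, Rabs (w x) <= B) -> (forall x, 0 <= x <= T -> Rabs (y x - z x) <= e) ->
  Rabs (RInt y 0 T - RInt z 0 T) <= T * e /\
  Rabs (RInt (fun x => w x * y x) 0 T - RInt (fun x => w x * z x) 0 T) <= T * B * e.
Proof.
  intros HT He Cy Cz Cw Bw H.
  assert (Cwy : forall g, (forall x, continuous g x) -> forall x, continuous (fun x => w x * g x) x)
    by (intros g Cg x; now apply (continuous_mult (K := R_AbsRing))).
  assert (D : forall g h e', (forall x, continuous g x) -> (forall x, continuous h x) ->
    (forall x, 0 <= x <= T -> Rabs (g x - h x) <= e') ->
    Rabs (RInt g 0 T - RInt h 0 T) <= T * e').
  { intros g h e' Cg Ch Hgh.
    replace (RInt g 0 T - RInt h 0 T) with (RInt (fun x => g x - h x) 0 T).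
    - rewrite <- (Rminus_0_r T) at 2. apply abs_RInt_le_const; auto.
      apply ex_RInt_cont. intros t. now apply (continuous_minus (V := R_NormedModule)).
    - apply (is_RInt_unique (V := R_CompleteNormedModule)).
      apply (is_RInt_minus (V := R_NormedModule));
        apply (RInt_correct (V := R_CompleteNormedModule)), ex_RInt_cont; assumption. }
  split; [now apply D|]. rewrite Rmult_assoc. apply D; auto.
  intros x Hx. replace (w x * y x - w x * z x) with (w x * (y x - z x)) by ring.
  rewrite Rabs_mult. apply Rmult_le_compat; auto using Rabs_pos.
Qed.

Lemma lin_sol_one (q : R -> R) (mu : R) (y1 y2 y3 : R -> R) :
  lin_sol q mu y1 y2 y3 -> lin_sol (fun x => 1 * q x) mu y1 y2 y3.
Proof.
  intros [A [B D]]; split; auto; split; auto; intros x; specialize (B x).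
  now rewrite Rmult_1_l.
Qed.

(** * Expansion of the determinant for small [mu], and eigenfunctions *)

Section Spectrum.

Variables (f F : R -> R) (a E c l r T : R) (w : R -> R).
Hypothesis (hf : is_C2 f) (O : orbit f F a E c l r T w).

Let k := a + c * l - f l.
Hypothesis (Hk : 0 < k).

Let w' := Derive w.
Let w'' (x : R) := a + c * w x - f (w x).
Let q (x : R) := Derive f (w x) - c.

Lemma orbit_derive x : is_derive w x (w' x).
Proof. apply O. Qed.

Lemma orbit_derive2 x : is_derive w' x (w'' x).
Proof. apply O. Qed.

Lemma orbit_derive3 x : is_derive w'' x (- (q x * w' x)).
Proof.
  assert (Hf : forall y, is_derive f y (Derive f y)) by (intros y; apply Derive_correct, hf).
  pose proof orbit_derive. unfold w'', q. solve_derive.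
Qed.

Lemma orbit_period_pos : 0 < T.
Proof. destruct O as [_ [_ [_ [_ [_ [_ [_ [h [HT [Hh _]]]]]]]]]]. lra. Qed.

Lemma orbit_periodic x : w (x + T) = w x.
Proof. apply O. Qed.

Lemma orbit_derive_periodic x : w' (x + T) = w' x.
Proof.
  assert (H : is_derive w x (w' (x + T))).
  { apply (is_derive_ext (fun t => w (t + T))); [apply orbit_periodic|].
    pose proof orbit_derive. solve_derive. }
  apply is_derive_unique in H. now rewrite <- H.
Qed.

Lemma orbit_values : w 0 = l /\ w' 0 = 0 /\ w'' 0 = k /\ w T = l /\ w' T = 0 /\ w'' T = k.
Proof.
  destruct O as [_ [_ [I0 [I1 _]]]].
  assert (IT : w T = l) by (rewrite <- (Rplus_0_l T), orbit_periodic; assumption).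
  assert (IT' : w' T = 0) by (rewrite <- (Rplus_0_l T), orbit_derive_periodic; assumption).
  unfold w'', k. rewrite I0, IT. repeat split; auto.
Qed.

Lemma orbit_bounded : exists B, forall x, Rabs (w x) <= B.
Proof.
  apply (periodic_bounded w T); auto using orbit_period_pos, orbit_periodic.
  intros x. exact (is_derive_continuous _ _ _ (orbit_derive x)).
Qed.

Lemma orbit_derive_bounded : exists B, forall x, Rabs (w' x) <= B.
Proof.
  apply (periodic_bounded w' T); auto using orbit_period_pos, orbit_derive_periodic.
  intros x. exact (is_derive_continuous _ _ _ (orbit_derive2 x)).
Qed.

Lemma coef_periodic x : q (x + T) = q x.
Proof. unfold q. now rewrite orbit_periodic. Qed.

Let q' (x : R) := Derive (Derive f) (w x) * w' x.

Lemma coef_derive x : is_derive q x (q' x).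
Proof.
  assert (Hf : forall y, is_derive (Derive f) y (Derive (Derive f) y))
    by (intros y; apply Derive_correct, hf).
  pose proof orbit_derive. unfold q, q'. solve_derive.
Qed.

Lemma coef_continuous x : continuous q x.
Proof. exact (is_derive_continuous _ _ _ (coef_derive x)). Qed.

Lemma coef_bounded : exists Q, forall x, Rabs (q x) <= Q.
Proof. apply (periodic_bounded q T); auto using orbit_period_pos, coef_periodic, coef_continuous. Qed.

Lemma coef_derive_bounded : exists Q, forall x, Rabs (q' x) <= Q.
Proof.
  apply (periodic_bounded q' T); auto using orbit_period_pos.
  - intros x. apply (continuous_mult (K := R_AbsRing)).
    + apply (continuous_comp w (Derive (Derive f))); [|apply hf].
      exact (is_derive_continuous _ _ _ (orbit_derive x)).
    + exact (is_derive_continuous _ _ _ (orbit_derive2 x)).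
  - intros x. unfold q'. now rewrite orbit_periodic, orbit_derive_periodic.
Qed.

(** With source [ga w'] and [mu = 0], the third component differs from [ga w] by a constant, so the
    variational equation is an instance of the linear system. *)
Lemma variation_exists (al ga v0 : R) : exists v v' : R -> R,
  (forall x, is_derive v x (v' x)) /\
  (forall x, is_derive v' x (al + ga * w x - q x * v x)) /\ v 0 = v0 /\ v' 0 = 0.
Proof.
  destruct coef_bounded as [Q HQ]. destruct orbit_derive_bounded as [B HB].
  destruct (linear_system_exists q (fun x => ga * w' x) Q (Rabs ga * B) 0 v0 0 (al + ga * l))
    as [v [v' [y [Hv [Hv' [Hy [I0 [I1 I2]]]]]]]]; auto using coef_continuous.
  - intros x. apply (continuous_scal_r (V := R_NormedModule)).
    exact (is_derive_continuous _ _ _ (orbit_derive2 x)).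
  - intros x. rewrite Rabs_mult. apply Rmult_le_compat_l; auto using Rabs_pos.
  - assert (Ey : forall x, y x = al + ga * w x).
    { intros x. destruct orbit_values as [W0 _].
      assert (Z : forall t, is_derive (fun t => y t - ga * w t) t 0).
      { intros t. pose proof orbit_derive. solve_derive. }
      pose proof (is_derive_zero_const _ Z x) as Ec. simpl in Ec. rewrite I2, W0 in Ec. lra. }
    exists v, v'. split; [assumption|]. split; [|auto].
    intros x. rewrite <- Ey. apply Hv'.
Qed.

(** Pairing [d/dx (L y1) = mu y1] with [1] and with [w], using [L w' = 0]. *)
Lemma lin_sol_moments (mu : R) (y1 y2 y3 : R -> R) : lin_sol q mu y1 y2 y3 ->
  y3 T - y3 0 = - mu * RInt y1 0 T /\
  y1 T - y1 0 = mu / k * (l * RInt y1 0 T - RInt (fun x => w x * y1 x) 0 T).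
Proof.
  intros [Y1 [Y2 Y3]].
  assert (C1 : forall x, continuous y1 x)
    by (intros x; exact (is_derive_continuous _ _ _ (Y1 x))).
  assert (Cw1 : forall x, continuous (fun x => w x * y1 x) x).
  { intros x. apply (continuous_mult (K := R_AbsRing)); [|apply C1].
    exact (is_derive_continuous _ _ _ (orbit_derive x)). }
  set (A := fun x => RInt y1 0 x).
  set (B := fun x => RInt (fun x => w x * y1 x) 0 x).
  assert (P1 : forall x, is_derive A x (y1 x))
    by (intros x; exact (is_derive_primitive _ x C1)).
  assert (P2 : forall x, is_derive B x (w x * y1 x))
    by (intros x; exact (is_derive_primitive _ x Cw1)).
  assert (A0 : A 0 = 0) by apply (RInt_point (V := R_CompleteNormedModule)).
  assert (B0 : B 0 = 0) by apply (RInt_point (V := R_CompleteNormedModule)).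
  change (RInt y1 0 T) with (A T). change (RInt (fun x => w x * y1 x) 0 T) with (B T).
  destruct orbit_values as [V0 [V1 [V2 [V3 [V4 V5]]]]].
  pose proof orbit_derive as W1. pose proof orbit_derive2 as W2. pose proof orbit_derive3 as W3.
  assert (Z1 : forall x, is_derive (fun x => y3 x + mu * A x) x 0).
  { clearbody A B. intros x. solve_derive. }
  assert (Z2 : forall x,
    is_derive (fun x => w x * y3 x - w' x * y2 x + w'' x * y1 x + mu * B x) x 0).
  { clearbody A B w' w'' q. intros x. solve_derive. }
  pose proof (is_derive_zero_const _ Z1 T) as E1. pose proof (is_derive_zero_const _ Z2 T) as E2.
  cbv beta in E1, E2. rewrite V0, V1, V2, V3, V4, V5, B0 in E2. rewrite A0 in E1.
  assert (E3 : y3 T - y3 0 = - mu * A T) by lra.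
  split; [assumption|].
  apply (Rmult_eq_reg_l k); [|lra].
  replace (k * (mu / k * (l * A T - B T))) with (l * (mu * A T) - mu * B T) by (field; lra).
  replace (mu * A T) with (- (y3 T - y3 0)) by lra. lra.
Qed.

(** The variations in [a] and [E] satisfy [- L v = al] with [al] constant, hence solve the spectral
    system at [mu = 0]. The variation in [c] has [- L v = w], which is not constant, and enters
    instead as the first-order correction to [w']. *)
Lemma variation_lin_sol (al : R) (v v' : R -> R) :
  (forall x, is_derive v x (v' x)) -> (forall x, is_derive v' x (al + 0 * w x - q x * v x)) ->
  lin_sol q 0 v v' (fun _ => al).
Proof.
  intros H1 H2. split; [assumption|]. split; intros x.
  - replace (al - q x * v x) with (al + 0 * w x - q x * v x) by ring. apply H2.
  - replace (- (0 * v x)) with 0 by ring. apply (is_derive_const (V := R_NormedModule)).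
Qed.

Lemma lin_sol_close (v1 v2 v3 : R -> R) : lin_sol q 0 v1 v2 v3 ->
  exists C, 0 <= C /\ forall mu e y1 y2 y3, 0 <= mu <= e -> e <= 1 -> lin_sol q mu y1 y2 y3 ->
    Rabs (y1 0 - v1 0) <= e -> Rabs (y2 0 - v2 0) <= e -> Rabs (y3 0 - v3 0) <= e ->
    forall x, 0 <= x <= T ->
    Rabs (y1 x - v1 x) <= C * e /\ Rabs (y2 x - v2 x) <= C * e.
Proof.
  intros S. destruct coef_bounded as [Q HQ]. pose proof orbit_period_pos.
  destruct (lin_sol_perturb q Q T 1 0 v1 v2 v3 HQ) as [C [HC G]];
    [lra|now apply lin_sol_one|].
  exists C. split; [assumption|]. intros mu e y1 y2 y3 He He1 Sy I1 I2 I3 x Hx.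
  destruct (G e 1 mu y1 y2 y3) with (x := x) as [A [B _]]; auto; try lra.
  - now apply lin_sol_one.
  - rewrite Rminus_diag, Rabs_R0. lra.
  - rewrite Rminus_0_r, Rabs_pos_eq; lra.
Qed.

(** Second order in [mu] near [w']: the solution is [w' - mu v + O(mu^2)]. *)
Lemma translation_mode_expansion (v v' : R -> R) :
  (forall x, is_derive v x (v' x)) -> (forall x, is_derive v' x (0 + 1 * w x - q x * v x)) ->
  v' 0 = 0 ->
  exists C d, 0 <= C /\ 0 < d /\ forall mu y1 y2 y3, 0 < mu < d -> lin_sol q mu y1 y2 y3 ->
    y1 0 = - mu * v 0 -> y2 0 = k -> y3 0 = - mu * l ->
    forall x, 0 <= x <= T ->
    Rabs ((y1 x - w' x) / mu - - v x) <= C * mu /\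
    Rabs ((y2 x - w'' x) / mu - - v' x) <= C * mu.
Proof.
  intros Hv Hv' v'0.
  pose proof orbit_derive as W1. pose proof orbit_derive2 as W2. pose proof orbit_derive3 as W3.
  destruct orbit_values as [V0 [V1 [V2 _]]].
  assert (S : lin_sol q 0 w' w'' (fun _ => 0)).
  { split; [assumption|]. split; intros x.
    - rewrite Rminus_0_l. apply W3.
    - replace (- (0 * w' x)) with 0 by ring. apply (is_derive_const (V := R_NormedModule)). }
  destruct (lin_sol_close _ _ _ S) as [C1 [HC1 G1]].
  destruct coef_bounded as [Q HQ]. pose proof orbit_period_pos as HT.
  assert (HQ0 : 0 <= Q) by (eapply Rle_trans; [apply Rabs_pos|apply (HQ 0)]).
  destruct (gronwall3 (1 + Q) T) as [C2 [HC2 G2]]; try lra.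
  (* [m mu] bounds both [mu] and the deviation of the initial data from those of [w']. *)
  set (m := 1 + Rabs (v 0) + Rabs l).
  pose proof (Rabs_pos (v 0)). pose proof (Rabs_pos l).
  assert (Hm : 1 <= m) by (unfold m; lra).
  assert (Hmi : 0 < / m) by (apply Rinv_0_lt_compat; lra).
  exists (C2 * (C1 * m)), (/ m).
  split; [apply Rmult_le_pos; [lra|apply Rmult_le_pos; lra]|]. split; [assumption|].
  intros mu y1 y2 y3 Hmu [Y1 [Y2 Y3]] I1 I2 I3 x Hx.
  assert (Hmm : m * mu <= 1).
  { apply Rle_trans with (m * / m); [apply Rmult_le_compat_l; lra|right; field; lra]. }
  assert (Hmm' : 0 <= Rabs (v 0) * mu) by (apply Rmult_le_pos; lra).
  assert (Hmm2 : 0 <= Rabs l * mu) by (apply Rmult_le_pos; lra).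
  assert (Hmm3 : mu <= m * mu) by (unfold m; lra).
  assert (B1 : forall t, 0 <= t <= T -> Rabs (y1 t - w' t) <= C1 * (m * mu)).
  { intros t Ht. apply (G1 mu (m * mu) y1 y2 y3); auto; try lra.
    - split; [assumption|split; assumption].
    - rewrite I1, V1, Rminus_0_r, Rabs_mult, Rabs_Ropp, Rabs_pos_eq by lra. unfold m; lra.
    - rewrite I2, V2, Rminus_diag, Rabs_R0. lra.
    - rewrite I3, Rminus_0_r, Rabs_mult, Rabs_Ropp, Rabs_pos_eq by lra. unfold m; lra. }
  assert (Heps : 0 <= C1 * (m * mu)) by (apply Rmult_le_pos; lra).
  replace (C2 * (C1 * m) * mu) with (C2 * (C1 * (m * mu))) by ring.
  (* After subtracting [w'] and dividing by [mu], the only forcing is [- (y1 - w')] in the third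
     equation, already of order [mu] by [B1]; a second Groenwall estimate therefore loses no power
     of [mu]. *)
  destruct (G2 (C1 * (m * mu)) (fun t => (y1 t - w' t) / mu - - v t)
    (fun t => (y2 t - w'' t) / mu - - v' t) (fun t => y3 t / mu + w t)
    (fun t => (y2 t - w'' t) / mu - - v' t)
    (fun t => (y3 t / mu + w t) - q t * ((y1 t - w' t) / mu - - v t))
    (fun t => - (y1 t - w' t))) with (x := x) as [R1 [R2 _]]; auto.
  - clearbody w' w'' q. intros t. solve_derive. field. lra.
  - clearbody w' w'' q. intros t. solve_derive. field. lra.
  - clearbody w' w'' q. intros t. solve_derive. field. lra.
  - intros t Ht. specialize (B1 t Ht). specialize (HQ t).
    set (A1 := Rabs ((y1 t - w' t) / mu - - v t)). set (A2 := Rabs ((y2 t - w'' t) / mu - - v' t)).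
    set (A3 := Rabs (y3 t / mu + w t)).
    assert (0 <= A1) by apply Rabs_pos. assert (0 <= A2) by apply Rabs_pos.
    assert (0 <= A3) by apply Rabs_pos.
    assert (0 <= Q * A1) by (apply Rmult_le_pos; lra).
    assert (0 <= Q * (A2 + A3)) by (apply Rmult_le_pos; lra).
    split; [lra|split].
    + eapply Rle_trans; [apply Rabs_triang|]. rewrite Rabs_Ropp, Rabs_mult. fold A1 A3.
      assert (Rabs (q t) * A1 <= Q * A1) by (apply Rmult_le_compat_r; assumption). lra.
    + rewrite Rabs_Ropp. lra.
  - rewrite I1, V1. replace ((- mu * v 0 - 0) / mu - - v 0) with 0 by (field; lra).
    rewrite Rabs_R0. assumption.
  - rewrite I2, V2, v'0. replace ((k - k) / mu - - 0) with 0 by (field; lra).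
    rewrite Rabs_R0. assumption.
  - rewrite I3, V0. replace (- mu * l / mu + l) with 0 by (field; lra).
    rewrite Rabs_R0. assumption.
Qed.

(** The three solutions start near [w'], [u_a] and [u_E]. After the powers of [mu] are extracted,
    the entries of their increment matrix tend to [(v'(T), int v, int w v)] with [v] equal to
    [- u_c], [u_a] and [u_E], and a negative determinant persists under small changes of the
    entries. *)
Lemma small_mu_det (va va' ve ve' vc vc' : R -> R) :
  (forall x, is_derive va x (va' x)) -> (forall x, is_derive va' x (1 + 0 * w x - q x * va x)) ->
  (forall x, is_derive ve x (ve' x)) -> (forall x, is_derive ve' x (0 + 0 * w x - q x * ve x)) ->
  (forall x, is_derive vc x (vc' x)) -> (forall x, is_derive vc' x (0 + 1 * w x - q x * vc x)) ->
  va' 0 = 0 -> ve' 0 = 0 -> vc' 0 = 0 -> ve 0 = - 1 / k ->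
  det3 (- vc' T) (RInt (fun x => - vc x) 0 T) (RInt (fun x => w x * - vc x) 0 T)
       (va' T) (RInt va 0 T) (RInt (fun x => w x * va x) 0 T)
       (ve' T) (RInt ve 0 T) (RInt (fun x => w x * ve x) 0 T) < 0 ->
  exists mu0, 0 < mu0 /\ forall mu, 0 < mu < mu0 ->
    exists y1 y2 y3 z1 z2 z3 w1 w2 w3,
    lin_sol q mu y1 y2 y3 /\ lin_sol q mu z1 z2 z3 /\ lin_sol q mu w1 w2 w3 /\
    det3 (y1 T - y1 0) (y2 T - y2 0) (y3 T - y3 0)
         (z1 T - z1 0) (z2 T - z2 0) (z3 T - z3 0)
         (w1 T - w1 0) (w2 T - w2 0) (w3 T - w3 0) *
    det3 (y1 0) (y2 0) (y3 0) (z1 0) (z2 0) (z3 0) (w1 0) (w2 0) (w3 0) > 0.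
Proof.
  intros Ha Ha' He He' Hc Hc' a0 e0 c0 Ie Hdet.
  destruct (det3_neg_open _ _ _ _ _ _ _ _ _ Hdet) as [eta [Heta Open]].
  destruct (translation_mode_expansion vc vc' Hc Hc' c0) as [C1 [d [HC1 [Hd G1]]]].
  destruct (lin_sol_close _ _ _ (variation_lin_sol 1 va va' Ha Ha')) as [C2 [HC2 G2]].
  destruct (lin_sol_close _ _ _ (variation_lin_sol 0 ve ve' He He')) as [C3 [HC3 G3]].
  destruct coef_bounded as [Q HQ]. destruct orbit_bounded as [B HB].
  pose proof orbit_period_pos as HT.
  assert (HB0 : 0 <= B) by (eapply Rle_trans; [apply Rabs_pos|apply (HB 0)]).
  (* [N] collects the factors 1, [T] and [T B] with which a pointwise error passes to the endpoint
     value and the two integrals; [mu < eta / M] then puts all nine entries within [eta]. *)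
  set (C := C1 + C2 + C3). set (N := 1 + T + T * B). set (M := C * N + 1).
  assert (HTB : 0 <= T * B) by (apply Rmult_le_pos; lra).
  assert (HCN : 0 <= C * N) by (apply Rmult_le_pos; unfold C, N; lra).
  assert (HeM : 0 < eta / M) by (apply Rdiv_lt_0_compat; unfold M; lra).
  exists (Rmin d (Rmin 1 (eta / M))).
  split; [repeat apply Rmin_glb_lt; lra|].
  intros mu [Hmu Hmu0].
  assert (mud : mu < d) by (eapply Rlt_le_trans; [exact Hmu0|apply Rmin_l]).
  assert (mur : mu < Rmin 1 (eta / M)) by (eapply Rlt_le_trans; [exact Hmu0|apply Rmin_r]).
  assert (mu1 : mu < 1) by (eapply Rlt_le_trans; [exact mur|apply Rmin_l]).
  assert (muM : mu < eta / M) by (eapply Rlt_le_trans; [exact mur|apply Rmin_r]).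
  assert (Hsmall : C * mu * N < eta).
  { apply Rlt_le_trans with (M * mu); [unfold M; lra|].
    apply Rle_trans with (M * (eta / M)).
    - apply Rmult_le_compat_l; [unfold M; lra|lra].
    - right. field. unfold M. lra. }
  assert (Cw : forall x, continuous w x)
    by (intros x; exact (is_derive_continuous _ _ _ (orbit_derive x))).
  assert (Row : forall D z1 z2 v v', (forall x, continuous z1 x) -> (forall x, continuous v x) ->
    0 <= D <= C -> z2 0 = 0 -> (forall x, 0 <= x <= T ->
    Rabs (z1 x - v x) <= D * mu /\ Rabs (z2 x - v' x) <= D * mu) ->
    Rabs (z2 T - z2 0 - v' T) < eta /\ Rabs (RInt z1 0 T - RInt v 0 T) < eta /\
    Rabs (RInt (fun x => w x * z1 x) 0 T - RInt (fun x => w x * v x) 0 T) < eta).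
  { intros D z1 z2 v v' Cz Cv HD I H.
    assert (HDm : D * mu <= C * mu) by (apply Rmult_le_compat_r; lra).
    assert (HDm0 : 0 <= D * mu) by (apply Rmult_le_pos; lra).
    assert (P0 : 0 <= C * mu) by lra.
    assert (P1 : 0 <= C * mu * T) by (apply Rmult_le_pos; lra).
    assert (P2 : 0 <= C * mu * (T * B)) by (apply Rmult_le_pos; lra).
    assert (P3 : T * (D * mu) <= T * (C * mu)) by (apply Rmult_le_compat_l; lra).
    assert (P4 : T * B * (D * mu) <= T * B * (C * mu)) by (apply Rmult_le_compat_l; lra).
    unfold N in Hsmall.
    destruct (RInt_close z1 v w T B (D * mu)) as [A1 A2]; auto; try lra.
    { intros x Hx. now apply H. }
    split; [|split; lra].
    rewrite I, Rminus_0_r. destruct (H T ltac:(lra)). lra. }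
  (* The data of [w' - mu u_c] at 0, with third component [- mu w(0)]. *)
  destruct (lin_sol_exists q Q mu (- mu * vc 0) k (- mu * l) coef_continuous HQ)
    as [y1 [y2 [y3 [Y [Y1 [Y2 Y3]]]]]].
  destruct (lin_sol_exists q Q mu (va 0) 0 1 coef_continuous HQ)
    as [z1 [z2 [z3 [Z [Z1 [Z2 Z3]]]]]].
  destruct (lin_sol_exists q Q mu (ve 0) 0 0 coef_continuous HQ)
    as [w1 [w2 [w3 [W [W1 [W2 W3]]]]]].
  exists y1, y2, y3, z1, z2, z3, w1, w2, w3.
  split; [assumption|]. split; [assumption|]. split; [assumption|].
  destruct orbit_values as [V0 [V1 [V2 [V3 [V4 V5]]]]].
  set (x1 := fun x => (y1 x - w' x) / mu). set (x2 := fun x => (y2 x - w'' x) / mu).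
  assert (Cy1 : forall x, continuous y1 x)
    by (intros x; exact (is_derive_continuous _ _ _ (proj1 Y x))).
  assert (Cw' : forall x, continuous w' x)
    by (intros x; exact (is_derive_continuous _ _ _ (orbit_derive2 x))).
  assert (Cx1 : forall x, continuous x1 x).
  { intros x. apply (continuous_mult (K := R_AbsRing)); [|apply continuous_const].
    now apply (continuous_minus (V := R_NormedModule)). }
  destruct (Row C1 x1 x2 (fun x => - vc x) (fun x => - vc' x)) as [R11 [R12 R13]]; auto.
  { intros x. apply (continuous_opp (V := R_NormedModule)).
    exact (is_derive_continuous _ _ _ (Hc x)). }
  { unfold C; lra. }
  { unfold x2. rewrite Y2, V2. field. lra. }
  { intros x Hx. apply (G1 mu y1 y2 y3); auto. }
  destruct (Row C2 z1 z2 va va') as [R21 [R22 R23]]; auto.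
  { intros x. exact (is_derive_continuous _ _ _ (proj1 Z x)). }
  { intros x. exact (is_derive_continuous _ _ _ (Ha x)). }
  { unfold C; lra. }
  { apply (G2 mu mu z1 z2 z3); auto; try lra;
      rewrite ?Z1, ?Z2, ?Z3, ?a0, Rminus_diag, Rabs_R0; lra. }
  destruct (Row C3 w1 w2 ve ve') as [R31 [R32 R33]]; auto.
  { intros x. exact (is_derive_continuous _ _ _ (proj1 W x)). }
  { intros x. exact (is_derive_continuous _ _ _ (He x)). }
  { unfold C; lra. }
  { apply (G3 mu mu w1 w2 w3); auto; try lra;
      rewrite ?W1, ?W2, ?W3, ?e0, Rminus_diag, Rabs_R0; lra. }
  pose proof (Open _ _ _ _ _ _ _ _ _ R11 R12 R13 R21 R22 R23 R31 R32 R33) as Neg.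
  destruct (lin_sol_moments mu y1 y2 y3 Y) as [My3 My1].
  destruct (lin_sol_moments mu z1 z2 z3 Z) as [Mz3 Mz1].
  destruct (lin_sol_moments mu w1 w2 w3 W) as [Mw3 Mw1].
  assert (Ey2 : y2 T - y2 0 = mu * (x2 T - x2 0)).
  { unfold x2. rewrite V2, V5. field. lra. }
  (* The leading term [w'] has zero mean over a period, so the integral already carries a factor
     [mu]; likewise [w w'] below. *)
  assert (Ey1 : RInt y1 0 T = mu * RInt x1 0 T).
  { replace (mu * RInt x1 0 T) with ((w T - w 0) + mu * RInt x1 0 T) by (rewrite V0, V3; ring).
    apply (is_RInt_unique (V := R_CompleteNormedModule)).
    apply (is_RInt_ext (V := R_NormedModule) (fun x => plus (w' x) (scal mu (x1 x)))).
    - intros x _. unfold x1, plus, scal; simpl; unfold mult; simpl. field. lra.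
    - apply (is_RInt_plus (V := R_NormedModule)).
      + apply (is_RInt_derive (V := R_CompleteNormedModule)); intros; [apply orbit_derive|apply Cw'].
      + apply (is_RInt_scal (V := R_NormedModule)).
        now apply (RInt_correct (V := R_CompleteNormedModule)), ex_RInt_cont. }
  assert (Ewy1 : RInt (fun x => w x * y1 x) 0 T = mu * RInt (fun x => w x * x1 x) 0 T).
  { replace (mu * RInt (fun x => w x * x1 x) 0 T)
      with ((w T ^ 2 / 2 - w 0 ^ 2 / 2) + mu * RInt (fun x => w x * x1 x) 0 T)
      by (rewrite V0, V3; ring).
    apply (is_RInt_unique (V := R_CompleteNormedModule)).
    apply (is_RInt_ext (V := R_NormedModule)
      (fun x => plus (w x * w' x) (scal mu (w x * x1 x)))).
    - intros x _. unfold x1, plus, scal; simpl; unfold mult; simpl. field. lra.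
    - apply (is_RInt_plus (V := R_NormedModule)).
      + apply (is_RInt_derive (V := R_CompleteNormedModule) (fun x => w x ^ 2 / 2)); intros x _.
        * pose proof orbit_derive as D1. clearbody w'. solve_derive. field.
        * now apply (continuous_mult (K := R_AbsRing)).
      + apply (is_RInt_scal (V := R_NormedModule)).
        apply (RInt_correct (V := R_CompleteNormedModule)), ex_RInt_cont.
        intros x. now apply (continuous_mult (K := R_AbsRing)). }
  rewrite My1, My3, Mz1, Mz3, Mw1, Mw3, Ey2, Ey1, Ewy1, Y1, Y2, Y3, Z1, W1, W3, Z3, Ie.
  rewrite Z2 in *. rewrite W2 in *.
  revert Neg.
  generalize (x2 T - x2 0) (RInt x1 0 T) (RInt (fun x => w x * x1 x) 0 T) (z2 T - 0)
    (RInt z1 0 T) (RInt (fun x => w x * z1 x) 0 T) (w2 T - 0) (RInt w1 0 T)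
    (RInt (fun x => w x * w1 x) 0 T).
  intros m11 m12 m13 m21 m22 m23 m31 m32 m33 Neg.
  (* The increments of [y1] and [y3] and the row near [w'] give [mu^3]; the terms with [l] drop out
     by a column operation. The initial determinant is [k] times [- 1 / k], that is [- 1], which
     accounts for the sign. *)
  match goal with |- ?X > 0 =>
    replace X with (mu ^ 3 / k * - det3 m11 m12 m13 m21 m22 m23 m31 m32 m33)
      by (unfold det3; field; lra) end.
  apply Rlt_gt, Rmult_lt_0_compat; [|lra].
  apply Rdiv_lt_0_compat; [apply pow_lt|]; assumption.
Qed.

(** Equal data at 0 and [T] extend to periodicity by uniqueness, since [q] is periodic, and a
    continuous periodic function is bounded. The first component is not identically 0: otherwise
    [y2] and then [y3 = y2' + q y1] would vanish as well. *)
Lemma eigenfunction (mu : R) (y1 y2 y3 : R -> R) : lin_sol q mu y1 y2 y3 ->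
  y1 T = y1 0 -> y2 T = y2 0 -> y3 T = y3 0 -> ~ (y1 0 = 0 /\ y2 0 = 0 /\ y3 0 = 0) ->
  spec_dxL f c w (RtoC mu).
Proof.
  intros Y P1 P2 P3 Nz.
  destruct coef_bounded as [Q HQ].
  assert (Per : forall x, y1 (x + T) = y1 x).
  { intros x. apply (lin_sol_unique q Q mu (fun x => y1 (x + T)) (fun x => y2 (x + T))
      (fun x => y3 (x + T)) y1 y2 y3 HQ); rewrite ?Rplus_0_l; auto.
    destruct Y as [Y1 [Y2 Y3]]. split; [|split]; intros t.
    - solve_derive.
    - rewrite <- (coef_periodic t). solve_derive.
    - solve_derive. }
  assert (Cd : forall (g g' : R -> R), (forall x, is_derive g x (g' x)) ->
    (forall x, ex_CDerive (fun t => RtoC (g t)) x) /\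
    CDerive (fun t => RtoC (g t)) = (fun t => RtoC (g' t))).
  { intros g g' Hg. split.
    - intros x. unfold ex_CDerive.
      (* A real function is viewed as a real multiple of the fixed vector 1 of the normed module. *)
      apply (ex_derive_ext (V := C_R_NormedModule)
        (fun t => scal (V := C_R_NormedModule) (g t) (RtoC 1))).
      + intros t. unfold scal; simpl. unfold prod_scal, scal; simpl; unfold mult; simpl.
        unfold RtoC. f_equal; ring.
      + eexists. apply (is_derive_scal_l (V := C_R_NormedModule)), Hg.
    - apply functional_extensionality. intros x. unfold CDerive, RtoC; simpl.
      f_equal; [apply is_derive_unique, Hg|apply Derive_const]. }
  destruct Y as [Y1 [Y2 Y3]].
  destruct (Cd y1 y2 Y1) as [E1 D1].
  destruct (Cd y2 _ Y2) as [E2 D2].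
  assert (Ly : Lop f c w (fun t => RtoC (y1 t)) = fun t => RtoC (- y3 t)).
  { apply functional_extensionality. intros x. unfold Lop. rewrite D1, D2.
    rewrite <- !RtoC_mult, <- RtoC_opp, <- RtoC_minus, <- RtoC_plus. unfold q. f_equal. ring. }
  assert (Y3' : forall x, is_derive (fun t => - y3 t) x (mu * y1 x)) by (intros x; solve_derive).
  destruct (Cd _ _ Y3') as [E3 D3].
  exists (fun t => RtoC (y1 t)).
  split; [assumption|]. rewrite D1, Ly. split; [assumption|]. split; [assumption|].
  rewrite D3. split; [intros x; apply RtoC_mult|]. split.
  - destruct (periodic_bounded y1 T) as [B HB]; auto using orbit_period_pos.
    + intros x. exact (is_derive_continuous _ _ _ (Y1 x)).
    + exists B. intros x. rewrite Cmod_R. apply HB.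
  - apply Classical_Pred_Type.not_all_not_ex. intros H. apply Nz.
    assert (Z1 : forall x, y1 x = 0).
    { intros x. destruct (Req_dec (y1 x) 0) as [|N]; [assumption|exfalso].
      apply (H x). intros Z. apply N. exact (f_equal fst Z). }
    assert (Z2 : forall x, y2 x = 0).
    { intros x. apply (is_derive_locally_const y1 x _ 0 (x - 1) (x + 1) (Y1 x)); auto. lra. }
    split; [apply Z1|]. split; [apply Z2|].
    pose proof (is_derive_locally_const y2 0 _ 0 (-1) 1 (Y2 0) ltac:(auto) ltac:(lra)) as Z.
    rewrite Z1 in Z. lra.
Qed.

End Spectrum.

(** * From parameter lines to partial derivatives *)

Lemma locally_line (a E c al be ga : R) (P : param -> Prop) : locally ((a, E, c) : param) P ->
  locally 0 (fun s => P (a + s * al, E + s * be, c + s * ga)).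
Proof.
  intros [eps H].
  assert (L : forall x d : R, locally 0 (fun s => ball x eps (x + s * d))).
  { intros x d.
    assert (C : continuous (fun s => x + s * d) 0).
    { apply (ex_derive_continuous (V := R_NormedModule)). auto_derive. auto. }
    generalize (proj1 (filterlim_locally_R _ _) C eps). apply filter_imp. intros s Hs.
    rewrite Rmult_0_l, Rplus_0_r in Hs. exact Hs. }
  generalize (filter_and _ _ (L a al) (filter_and _ _ (L E be) (L c ga))).
  apply filter_imp. intros s [A [B D]]. apply H. split; [split|]; assumption.
Qed.

(** One direction [(al, be, ga)] covers the three partial derivatives, obtained from the unit
    vectors. A single variation [v] yields all entries of a row of the Jacobian. *)
Lemma wave_family_direction (f F : R -> R) (um up : param -> R) (u : param -> R -> R)
  (a E c al be ga : R) :
  is_C2 f -> (forall v, is_derive F v (f v)) -> wave_family f F um up u (a, E, c) ->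
  let p0 := (a, E, c) in
  let p := fun s : R => (a + s * al, E + s * be, c + s * ga) in
  let l := um p0 in let T := period F um up p0 in
  let k := a + c * l - f l in
  exists v v' : R -> R,
  (forall x, is_derive v x (v' x)) /\
  (forall x, is_derive v' x (al + ga * u p0 x - (Derive f (u p0 x) - c) * v x)) /\
  v 0 = - (be + al * l + ga * l ^ 2 / 2) / k /\ v' 0 = 0 /\
  is_derive (fun s => period F um up (p s)) 0 (- v' T / k) /\
  is_derive (fun s => mass F um up u (p s)) 0 (RInt v 0 T + l * (- v' T / k)) /\
  is_derive (fun s => momentum F um up u (p s)) 0
    (2 * RInt (fun x => u p0 x * v x) 0 T + l ^ 2 * (- v' T / k)).
Proof.
  intros hf hF hu p0 p l T k.
  assert (Hp : p 0 = p0).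
  { unfold p, p0. f_equal; [f_equal|]; ring. }
  destruct (locally_singleton _ _ hu) as [hwell [Cum [Cup hprof]]].
  pose proof (profile_orbit f F um up a E c (u (a, E, c)) hf hF hwell hprof) as O.
  destruct (well_slope f F a E c _ _ hF hwell) as [Hk Hkr].
  destruct (variation_exists f F a E c _ _ _ _ hf O al ga
    (- (be + al * l + ga * l ^ 2 / 2) / k)) as [v [v' [Hv [Hv' [I0 I1]]]]].
  exists v, v'.
  assert (HG : locally 0 (fun s => orbit f F (a + s * al) (E + s * be) (c + s * ga)
    (um (p s)) (up (p s)) (period F um up (p s)) (u (p s)))).
  { generalize (locally_line a E c al be ga _ hu). apply filter_imp.
    intros s [W [_ [_ Pr]]]. now apply profile_orbit. }
  assert (Cl : continuous (fun s => um (p s)) 0).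
  { intros P HP. rewrite Hp in HP. 
    apply (locally_line a E c al be ga (fun p => P (um p))). now apply Cum. }
  assert (Cr : continuous (fun s => up (p s)) 0).
  { intros P HP. rewrite Hp in HP. 
    apply (locally_line a E c al be ga (fun p => P (up p))). now apply Cup. }
  split; [assumption|]. split; [assumption|]. split; [assumption|]. split; [assumption|].
  pose proof (period_derive f F a E c al be ga (fun s => um (p s)) (fun s => up (p s))
    (fun s => period F um up (p s)) (fun s => u (p s)) v v') as PD.
  pose proof (mass_derive f F a E c al be ga (fun s => um (p s)) (fun s => up (p s))
    (fun s => period F um up (p s)) (fun s => u (p s)) v v') as MD.
  pose proof (momentum_derive f F a E c al be ga (fun s => um (p s)) (fun s => up (p s))
    (fun s => period F um up (p s)) (fun s => u (p s)) v v') as QD.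
  cbv beta in PD, MD, QD. rewrite Hp in PD, MD, QD.
  split; [apply PD; assumption|]. split; [apply MD; assumption|apply QD; assumption].
Qed.

Lemma Derive_line (h : R -> R) (g : R -> R) (x d : R) :
  (forall t, g t = h (t - x)) -> is_derive h 0 d -> Derive g x = d.
Proof.
  intros H D. apply is_derive_unique.
  apply (is_derive_ext (fun t => h (t - x))); [intros t; symmetry; apply H|].
  replace d with (scal 1 d) by (unfold scal; simpl; unfold mult; simpl; ring).
  apply (is_derive_comp (V := R_NormedModule) h (fun t => t - x)).
  - now rewrite Rminus_diag.
  - auto_derive; auto. 
Qed.

Lemma D_a_line (g : param -> R) (a E c d : R) :
  is_derive (fun s => g (a + s * 1, E + s * 0, c + s * 0)) 0 d -> D_a g (a, E, c) = d.
Proof.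
  apply Derive_line. intros t. unfold pa, pE, pc; simpl. f_equal. f_equal; [f_equal|]; ring.
Qed.

Lemma D_E_line (g : param -> R) (a E c d : R) :
  is_derive (fun s => g (a + s * 0, E + s * 1, c + s * 0)) 0 d -> D_E g (a, E, c) = d.
Proof.
  apply Derive_line. intros t. unfold pa, pE, pc; simpl. f_equal. f_equal; [f_equal|]; ring.
Qed.

Lemma D_c_line (g : param -> R) (a E c d : R) :
  is_derive (fun s => g (a + s * 0, E + s * 0, c + s * 1)) 0 d -> D_c g (a, E, c) = d.
Proof.
  apply Derive_line. intros t. unfold pa, pE, pc; simpl. f_equal. f_equal; [f_equal|]; ring.
Qed.

Theorem corollary1 (f F : R -> R)
    (hf : is_C2 f) (hF : forall v, is_derive F v (f v))
    (um up : param -> R) (u : param -> R -> R) (a E c : R)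
    (hu : wave_family f F um up u (a, E, c))
    (hT : ~ (D_a (period F um up) (a, E, c) = 0 /\
             D_E (period F um up) (a, E, c) = 0))
    (hJ : jacobian_aEc (period F um up) (mass F um up u) (momentum F um up u)
            (a, E, c) < 0) :
  exists mu : R, mu <> 0 /\ spec_dxL f c (u (a, E, c)) (RtoC mu).
Proof.
  clear hT.
  destruct (wave_family_direction f F um up u a E c 1 0 0 hf hF hu)
    as [va [va' [Ha [Ha' [_ [a0 [Ta [Ma Pa]]]]]]]].
  destruct (wave_family_direction f F um up u a E c 0 1 0 hf hF hu)
    as [ve [ve' [He [He' [Ie [e0 [Te [Me Pe]]]]]]]].
  destruct (wave_family_direction f F um up u a E c 0 0 1 hf hF hu)
    as [vc [vc' [Hc [Hc' [_ [c0 [Tc [Mc Pc]]]]]]]].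
  apply D_a_line in Ta, Ma, Pa. apply D_E_line in Te, Me, Pe. apply D_c_line in Tc, Mc, Pc.
  unfold jacobian_aEc in hJ.
  rewrite Ta, Ma, Pa, Te, Me, Pe, Tc, Mc, Pc in hJ.
  clear Ta Ma Pa Te Me Pe Tc Mc Pc.
  destruct (locally_singleton _ _ hu) as [hwell [_ [_ hprof]]].
  pose proof (profile_orbit f F um up a E c (u (a, E, c)) hf hF hwell hprof) as O.
  destruct (well_slope f F a E c _ _ hF hwell) as [Hk _].
  set (w := u (a, E, c)) in *. set (T := period F um up (a, E, c)) in *.
  set (l := um (a, E, c)) in *. set (k := a + c * l - f l) in *.
  destruct (coef_bounded f F a E c _ _ _ _ hf O) as [Q HQ].
  destruct (coef_derive_bounded f F a E c _ _ _ _ hf O) as [Q1 HQ1].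
  destruct (floquet_root (fun x => Derive f (w x) - c)
    (fun x => Derive (Derive f) (w x) * Derive w x) Q Q1 T)
    as [mu [y1 [y2 [y3 [Hmu [Y [P1 [P2 [P3 Nz]]]]]]]]]; auto.
  - apply (coef_derive f F a E c _ _ _ _ hf O).
  - rewrite <- (Rplus_0_l T). apply (coef_periodic f F a E c _ _ _ _ O).
  - apply (orbit_period_pos f F a E c _ _ _ _ O).
  - apply (small_mu_det f F a E c l _ T w hf O Hk va va' ve ve' vc vc'); auto.
    (* For the direction of [E] the initial value [l'] reduces to [- 1 / k]. *)
    + rewrite Ie. unfold k. f_equal. field.
    + assert (Cw : forall x, continuous w x)
        by (intros x; exact (is_derive_continuous _ _ _ (orbit_derive f F a E c _ _ _ _ O x))).
      assert (Cv : forall x, continuous vc x)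
        by (intros x; exact (is_derive_continuous _ _ _ (Hc x))).
      replace (RInt (fun x => - vc x) 0 T) with (- RInt vc 0 T).
      2: { symmetry. apply (RInt_opp (V := R_CompleteNormedModule)). now apply ex_RInt_cont. }
      replace (RInt (fun x => w x * - vc x) 0 T) with (- RInt (fun x => w x * vc x) 0 T).
      2: { symmetry. rewrite <- (RInt_opp (V := R_CompleteNormedModule)).
           - apply (RInt_ext (V := R_CompleteNormedModule)). intros x _.
             unfold opp; simpl. ring.
           - apply ex_RInt_cont. intros x. now apply (continuous_mult (K := R_AbsRing)). }
      (* The multiples of [T'] inside [M'] and [P'] cancel by column operations. The first column of
         [J] has the factor [- 1 / k] and the third the factor 2; moving the row of [c] to the top
         is an even permutation, and its change of sign makes the ratio [k / 2] positive. *)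
      match type of hJ with ?J < 0 => match goal with |- ?D < 0 =>
        replace D with (k / 2 * J) by (unfold det3; field; lra);
        replace (k / 2 * J) with (- (k / 2 * - J)) by ring;
        assert (0 < k / 2 * - J) by (apply Rmult_lt_0_compat; lra); lra end end.
  - exists mu. split; [lra|].
    now apply (eigenfunction f F a E c l _ T w hf O mu y1 y2 y3).
Qed.
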